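(* Let $K$ be a number field, $S$ a finite set of places of $K$ containing all archimedean places, $n\ge 0$ and $m\ge 2$ integers, $Q\subset\mathbb P^{n+1}_K$ a smooth quadric hypersurface, $\mathcal Q$ the closure of $Q$ in $\mathbb P^{n+1}_{\mathcal O_S}$, and $\mathcal Q_m=(1-1/m)\mathcal Q$. Then the orbifold model $(\mathbb P^{n+1}_{\mathcal O_S},\mathcal Q_m)$ (i) satisfies Campana weak approximation, and $(\mathbb P^{n+1}_{\mathcal O_S},\mathcal Q_m)^{C}(\mathcal O_S)\neq\emptyset$; (ii) fails Darmon weak weak approximation if $m$ is even.
   Context: Let $\mathcal O_S$ be the ring of $S$-integers of $K$; for non-archimedean $v$ let $\mathcal O_v\subset K_v$ be the valuation ring with uniformiser $\pi_v$. Let $X$ be a smooth proper variety over $K$ with proper flat $\mathcal O_S$-model $\mathcal X$, $E\subset X$ an effective divisor with Zariski closure $\mathcal E\subset\mathcal X$, $m\ge2$ an integer, and $\mathcal E_m=(1-1/m)\mathcal E$ (in the claim, $X=\mathbb P^{n+1}$, $\mathcal X=\mathbb P^{n+1}_{\mathcal O_S}$, $E=Q$). Put $U=X\setminus E$, $\mathcal U=\mathcal X\setminus\mathcal E$. For $v\notin S$ and $P\in X(K_v)$ with induced $\mathcal P\in\mathcal X(\mathcal O_v)$: $n_v(\mathcal E,P)=\infty$ if $P\in E$, and otherwise $n_v(\mathcal E,P)=n$ where $\mathcal P\times_{\mathcal X}\mathcal E\cong\mathrm{Spec}\,\mathcal O_v/(\pi_v^n)$. For $v\notin S$, the local Campana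 points $(\mathcal X,\mathcal E_m)^C(\mathcal O_v)$ are the $P\in X(K_v)$ with $n_v(\mathcal E,P)\in\mathbb Z_{\ge m}\cup\{0,\infty\}$; the local Darmon points $(\mathcal X,\mathcal E_m)^D(\mathcal O_v)$ are those with $m\mid n_v(\mathcal E,P)$ ($\infty$ counts as divisible by $m$). For $v\in S$ both sets are $X(K_v)$. For finite $S'\supseteq S$ and $*\in\{C,D\}$, $(\mathcal X,\mathcal E_m)^*(\mathcal O_{S'})$ is the set of $P\in X(K)$ lying in $(\mathcal X,\mathcal E_m)^*(\mathcal O_v)$ for all $v\notin S'$. For a finite set $T$ of places, $(\mathcal X,\mathcal E_m)^*(\mathbb A^T_{K,S})$ is the disjoint union of the strict part $\prod_{v\in S\setminus T}U(K_v)\times\prod'_{v\notin S\cup T}\big((\mathcal X,\mathcal E_m)^*(\mathcal O_v)\cap U(K_v),\mathcal U(\mathcal O_v)\big)$ (restricted product) and the non-strict part $\prod_{v\in S\setminus T}E(K_v)\times\prod_{v\notin S\cup T}\mathcal E(\mathcal O_v)$. Its product topology is the subspace topology from $\prod_{v\notin T}X(K_v)$. $(\mathcal X,\mathcal E_m)$ satisfies weak approximation for $*$-points off $T$ if $(\mathcal X,\mathcal E_m)^*(\mathcal O_{S\cup T})$ (embedded diagonally) is dense in $(\mathcal X,\mathcal E_m)^*(\mathbb A^T_{K,S})$ for the product topology. Campana (resp. Darmon) weak approximation is this property with $T=\emptyset$ and $*=C$ (resp. $D$); Campana (resp. Darmon) weak weak approximation means it holds off some finite $T$. *)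

(* Defs.v *)
From HB Require Import structures.
From mathcomp.multinomials Require Import mpoly.
From mathcomp Require Import all_boot all_order all_algebra all_field.
From mathcomp Require Import all_classical reals topology exp.

Set Implicit Arguments.
Unset Strict Implicit.
Unset Printing Implicit Defensive.

Import Order.TTheory GRing.Theory Num.Theory.

Local Open Scope classical_set_scope.
Local Open Scope ring_scope.

Record absval (R : realType) (K : fieldType) := AbsVal {
  absval_fun :> K -> R;
  absval_ge0 : forall x, 0 <= absval_fun x;
  absval_eq0 : forall x, absval_fun x = 0 <-> x = 0;
  absvalM : forall x y, absval_fun (x * y) = absval_fun x * absval_fun y;
  absvalD : forall x y, absval_fun (x + y) <= absval_fun x + absval_fun y
}.

Section AbsvalTheory.
Context {R : realType} {K : fieldType} (v : absval R K).

Lemma absval0 : v 0 = 0.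
Proof. by rewrite (absval_eq0 v 0). Qed.

Lemma absval1 : v 1 = 1.
Proof.
have v1n0 : v 1 != 0 by apply/eqP => /absval_eq0 /eqP; rewrite oner_eq0.
by apply: (mulfI v1n0); rewrite -absvalM !mulr1.
Qed.

Lemma absvalN x : v (- x) = v x.
Proof.
have vN1 : v (-1) = 1.
  apply/eqP; rewrite -(@pexpr_eq1 _ _ 2)// ?absval_ge0//.
  by rewrite expr2 -absvalM mulrNN mulr1 absval1.
by rewrite -mulN1r absvalM vN1 mul1r.
Qed.

End AbsvalTheory.

HB.instance Definition _ (R : realType) (K : fieldType) :=
  gen_eqMixin (absval R K).
HB.instance Definition _ (R : realType) (K : fieldType) :=
  gen_choiceMixin (absval R K).

Definition nontrivial_absval (R : realType) (K : fieldType) :=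
  {v : absval R K | `[< exists x, x != 0 /\ v x != 1 >]}.

Section Places.
Context (R : realType) (K : fieldType).

Definition absval_equiv (v w : nontrivial_absval R K) : bool :=
  `[< exists s : R, 0 < s /\ forall x, val w x = (val v x) `^ s >].

Lemma absval_equiv_refl : reflexive absval_equiv.
Proof.
move=> v; apply/asboolP; exists 1; split=> // x.
by rewrite powRr1// absval_ge0.
Qed.

Lemma absval_equiv_sym : symmetric absval_equiv.
Proof.
have H v w : absval_equiv v w -> absval_equiv w v.
  move=> /asboolP[s [s0 vw]]; apply/asboolP; exists s^-1.
  split=> [|x]; first by rewrite invr_gt0.
  by rewrite vw -powRrM mulfV ?gt_eqF// powRr1// absval_ge0.
by move=> v w; apply/idP/idP => /H.
Qed.

Lemma absval_equiv_trans : transitive absval_equiv.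
Proof.
move=> w v u /asboolP[s [s0 vw]] /asboolP[t [t0 wu]]; apply/asboolP.
exists (s * t); split=> [|x]; first exact: mulr_gt0.
by rewrite wu vw powRrM.
Qed.

Canonical absval_equiv_rel :=
  EquivRel absval_equiv absval_equiv_refl absval_equiv_sym absval_equiv_trans.

Definition place := {eq_quot absval_equiv_rel}%qT.
HB.instance Definition _ := Choice.on place.

(* A chosen absolute value in the class [v]; another choice replaces it by a
   power, with the same completion and the same unit ball. *)
Definition place_absval (v : place) : absval R K := val (repr v).

Definition archimedean (v : place) : Prop :=
  ~ forall x y, place_absval v (x + y)
                <= Num.max (place_absval v x) (place_absval v y).

End Places.

Coercion place_absval : place >-> absval.

Definition S_integer (R : realType) (K : fieldType) (S : set (place R K)) :
  set K := [set x | forall v : place R K, ~ S v -> v x <= 1].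

(* [L] with the topology given by the metric [w (x - y)]. *)
Definition valued (R : realType) (L : fieldType) (w : absval R L) : Type := L.

Section Valued.
Context {R : realType} {L : fieldType} (w : absval R L).

HB.instance Definition _ := GRing.Field.on (valued w).

Let dist (x y : valued w) : R := w (x - y).

Let distxx x : dist x x = 0.
Proof. by rewrite /dist subrr absval0. Qed.

Let dist_eq0 x y : dist x y = 0 -> x = y.
Proof. by move=> /absval_eq0/eqP; rewrite subr_eq0 => /eqP. Qed.

Let distC x y : dist x y = dist y x.
Proof. by rewrite /dist -opprB absvalN. Qed.

Let dist_triangle y x z : dist x z <= dist x y + dist y z.
Proof. by rewrite /dist -(subrKA y) absvalD. Qed.

HB.instance Definition _ :=
  isMetric.Build R (valued w) distxx dist_eq0 distC dist_triangle.

End Valued.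

(* The completion of a field with respect to an absolute value, given by its
   universal characterisation: it is unique up to a unique isometric
   isomorphism over [K]. *)
Record completion (R : realType) (K : fieldType) (v : absval R K) :=
  Completion {
  completion_field : fieldType;
  completion_abs : absval R completion_field;
  completion_emb : {rmorphism K -> completion_field};
  completion_isometry : forall x,
    completion_abs (completion_emb x) = v x;
  completion_dense :
    dense (range completion_emb : set (valued completion_abs));
  completion_complete : forall F : set_system (valued completion_abs),
    ProperFilter F -> cauchy F -> exists l : valued completion_abs, F --> l
}.

Notation cfield C := (valued (completion_abs C)).

Definition cabs (R : realType) (K : fieldType) (v : absval R K)
  (C : completion v) (x : cfield C) : R := completion_abs C x.

Definition cemb (R : realType) (K : fieldType) (v : absval R K)
  (C : completion v) : {rmorphism K -> cfield C} := completion_emb C.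

Definition nonzero_vec (n : nat) (L : fieldType) : Type :=
  set_type [set x : 'rV[L]_n.+1 | x != 0].

Section ProjectiveSpace.
Context (n : nat) (L : fieldType).

Definition proportional (x y : nonzero_vec n L) : bool :=
  `[< exists a : L, a != 0 /\ val y = a *: val x >].

Lemma proportional_refl : reflexive proportional.
Proof.
by move=> x; apply/asboolP; exists 1; rewrite oner_neq0 scale1r.
Qed.

Lemma proportional_sym : symmetric proportional.
Proof.
have H x y : proportional x y -> proportional y x.
  move=> /asboolP[a [a0 yE]]; apply/asboolP; exists a^-1.
  by rewrite invr_eq0 yE scalerA mulVf// scale1r.
by move=> x y; apply/idP/idP => /H.
Qed.

Lemma proportional_trans : transitive proportional.
Proof.
move=> y x z /asboolP[a [a0 yE]] /asboolP[b [b0 zE]]; apply/asboolP.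
by exists (b * a); rewrite mulf_neq0// zE yE scalerA.
Qed.

Canonical proportional_rel :=
  EquivRel proportional proportional_refl proportional_sym proportional_trans.

Definition proj_space := {eq_quot proportional_rel}%qT.
HB.instance Definition _ := Choice.on proj_space.

End ProjectiveSpace.

Lemma nonzero_map_subproof (n : nat) (K L : fieldType) (f : {rmorphism K -> L})
  (x : nonzero_vec n K) : map_mx f (val x) \in [set y : 'rV[L]_n.+1 | y != 0].
Proof. by apply/mem_set; rewrite /= map_mx_eq0; exact: (set_valP x). Qed.

Definition nonzero_map (n : nat) (K L : fieldType) (f : {rmorphism K -> L})
  (x : nonzero_vec n K) : nonzero_vec n L :=
  exist _ (map_mx f (val x)) (nonzero_map_subproof f x).

Definition proj_map (n : nat) (K L : fieldType) (f : {rmorphism K -> L})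
  (P : proj_space n K) : proj_space n L :=
  \pi_(proj_space n L)%qT (nonzero_map f (repr P)).

(* The value at [x] of [G], its coefficients being moved to [L] by [f]. *)
Definition form_eval (n : nat) (K L : fieldType) (f : {rmorphism K -> L})
  (G : {mpoly K[n.+1]}) (x : nonzero_vec n L) : L :=
  mmap f (fun i => val x 0 i) G.

(* The [L]-points of the hypersurface [F = 0]; meaningful for homogeneous [F],
   for which the choice of [repr P] is irrelevant. *)
Definition hypersurface_points (n : nat) (K L : fieldType)
  (f : {rmorphism K -> L}) (F : {mpoly K[n.+1]}) : set (proj_space n L) :=
  [set P | form_eval f F (repr P) = 0].

(* Jacobian criterion, at the points over every extension [L] of [K]. *)
Definition smooth_hypersurface (n : nat) (K : fieldType)
  (F : {mpoly K[n.+1]}) : Prop :=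
  forall (L : fieldType) (f : {rmorphism K -> L}) (x : nonzero_vec n L),
    form_eval f F x = 0 -> exists i, form_eval f F^`M(i) x != 0.

Definition smooth_quadric (n : nat) (K : fieldType) (F : {mpoly K[n.+1]}) :
  Prop := [/\ F != 0, F \is 2.-homog & smooth_hypersurface F].

Inductive point_kind := Campana | Darmon.

(* [None] stands for an infinite intersection multiplicity. *)
Definition admissible_mult (star : point_kind) (m : nat) (k : option nat) :
  bool :=
  match star, k with
  | _, None => true
  | Campana, Some k => (m <= k)%N || (k == 0)%N
  | Darmon, Some k => (m %| k)%N
  end.

Unset Implicit Arguments.

Section Orbifold.
Context {R : realType} {K : fieldType}.
Context (Kv : forall v : place R K, completion v) (S : set (place R K)).
Context {n : nat} (F : {mpoly K[n.+1]}) (m : nat).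

Definition valuation_ring (v : place R K) : set (cfield (Kv v)) :=
  [set a | cabs a <= 1].

Definition uniformiser {v : place R K} (p : cfield (Kv v)) : Prop :=
  p != 0 /\
  [set a : cfield (Kv v) | cabs a < 1] = [set p * a | a in valuation_ring v].

Definition local_proj (v : place R K) : topologicalType :=
  quotient_topology (proj_space n (cfield (Kv v))).

(* The homogeneous elements of [O_S[x_0..x_n] `&` F K[x_0..x_n]], the ideal of
   the Zariski closure of [F = 0] in projective space over [O_S]. *)
Definition closure_ideal : set {mpoly K[n.+1]} :=
  [set G | [/\ exists d, G \is d.-homog,
               forall mu, S_integer S G@_mu
             & exists H, G = H * F]].

(* Coordinates, unique up to units, of the [O_v]-point extending [P]. *)
Definition integral_coordinates {v : place R K} (P : local_proj v) :
  set (nonzero_vec n (cfield (Kv v))) :=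
  [set x | [/\ \pi_(proj_space n (cfield (Kv v)))%qT x = P,
               forall i, cabs (val x 0 i) <= 1
             & exists i, cabs (val x 0 i) = 1]].

(* The ideal of [O_v] defining the pullback of the closure along the
   [O_v]-point with coordinates [x]. *)
Definition pullback_ideal {v : place R K}
  (x : nonzero_vec n (cfield (Kv v))) : set (cfield (Kv v)) :=
  [set y | exists2 s : seq (cfield (Kv v) * {mpoly K[n.+1]}),
     (forall p, p \in s -> valuation_ring v p.1 /\ closure_ideal p.2)
     & y = \sum_(p <- s) p.1 * form_eval (cemb (Kv v)) p.2 x].

(* [div_points v] and [compl_points v] are E(K_v) and U(K_v), for E the divisor
   F = 0 and U its complement. *)
Definition div_points (v : place R K) : set (local_proj v) :=
  hypersurface_points (cemb (Kv v)) F.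

Definition compl_points (v : place R K) : set (local_proj v) :=
  ~` div_points v.

(* The integral versions are sets of [O_v]-points, identified with their generic
   points by properness: those factoring through the Zariski closure of E,
   resp. through its complement. *)
Definition div_integral_points (v : place R K) : set (local_proj v) :=
  [set P | exists2 x, integral_coordinates P x & pullback_ideal x = [set 0]].

Definition compl_integral_points (v : place R K) : set (local_proj v) :=
  [set P | exists2 x, integral_coordinates P x
                    & pullback_ideal x = valuation_ring v].

Definition intersection_mult {v : place R K} (P : local_proj v)
  (k : option nat) : Prop :=
  match k with
  | None => div_points v P
  | Some k => ~ div_points v P /\
      exists (x : nonzero_vec n (cfield (Kv v))) (p : cfield (Kv v)),
        [/\ integral_coordinates P x, uniformiser p
           & pullback_ideal x = [set p ^+ k * a | a in valuation_ring v]]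
  end.

Definition local_orbifold_points (star : point_kind) (v : place R K) :
  set (local_proj v) :=
  [set P | S v \/
     exists2 k, intersection_mult P k & admissible_mult star m k].

(* The points over [O_S'], for S' containing S. *)
Definition orbifold_points (star : point_kind) (S' : set (place R K)) :
  set (proj_space n K) :=
  [set P | forall v, ~ S' v ->
     local_orbifold_points star v (proj_map (cemb (Kv v)) P : local_proj v)].

Definition local_product (T : set (place R K)) : topologicalType :=
  prod_topology (fun v : ~` T => local_proj (val v)).

Definition adelic_strict (star : point_kind) (T : set (place R K)) :
  set (local_product T) :=
  [set P | [/\ forall v : ~` T, S (val v) -> compl_points (val v) (P v),
               forall v : ~` T, ~ S (val v) ->
                 (local_orbifold_points star (val v) `&` compl_points (val v))
                   (P v)
             & finite_set [set v : ~` T |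
                 ~ S (val v) /\ ~ compl_integral_points (val v) (P v)]]].

Definition adelic_nonstrict (T : set (place R K)) : set (local_product T) :=
  [set P | forall v : ~` T,
     (S (val v) -> div_points (val v) (P v)) /\
     (~ S (val v) -> div_integral_points (val v) (P v))].

Definition adelic_orbifold_points (star : point_kind) (T : set (place R K)) :
  set (local_product T) := adelic_strict star T `|` adelic_nonstrict T.

Definition diagonal_emb (T : set (place R K)) (P : proj_space n K) :
  local_product T :=
  fun v : ~` T => proj_map (cemb (Kv (val v))) P : local_proj (val v).

Definition weak_approximation_off (star : point_kind) (T : set (place R K)) :
  Prop :=
  adelic_orbifold_points star T
  `<=` closure (diagonal_emb T @` orbifold_points star (S `|` T)).

Definition orbifold_weak_approximation (star : point_kind) : Prop :=
  weak_approximation_off star set0.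

Definition orbifold_weak_weak_approximation (star : point_kind) : Prop :=
  exists T : set (place R K), finite_set T /\ weak_approximation_off star T.

End Orbifold.

(* Main.v *)
(* Campana points. Interpolate the prescribed local points by a single point
   [x] of the base field and restrict [F] to a plane spanned by [x] and [y], where
   [F (s x + t y) = F x * N (s + t theta)] for the norm [N] of a quadratic etale
   algebra. If [w = t ^ m * u ^ (m + 1)] in that algebra, then outside finitely
   many places the multiplicity of the corresponding point is [m] times a
   valuation of [N t] plus [m + 1] times one of [N u], hence [0] or at least [m];
   and if [t] is close to the conjugate of [z] and [u] to [z], then [w] is close
   to [N z ^ m * z], that is, projectively to [z].

   Darmon points, for [m] even. The value of [F] at a Darmon point has even
   valuation outside finitely many places, so its norm to the rationals has even
   [p]-adic valuation for all primes [p] outside a finite set [B]. At suitable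
   primes [l_1, ..., l_r] the local points can be chosen so that this norm is a
   square or a nonsquare modulo each [l_j], independently. If weak approximation
   held, all [2 ^ r] patterns would come from rational points; for [r] larger than
   [#|B| + 1], two of these have norms of the same sign and the same parities of
   valuations at [B], so that the product of the norms is a square, although one
   of them is a square modulo some [l_j] and the other is not. *)
Require Import Defs.
From mathcomp.multinomials Require Import mpoly.
From mathcomp Require Import all_boot all_order all_algebra all_field.
From mathcomp Require Import all_classical reals topology exp.
From mathcomp Require Import normedtype sequences.
From mathcomp Require Import ring lra zify.

Set Implicit Arguments.
Unset Strict Implicit.
Unset Printing Implicit Defensive.

Import Order.TTheory GRing.Theory Num.Theory.
Import numFieldNormedType.Exports.

Local Open Scope classical_set_scope.
Local Open Scope ring_scope.

(** * Absolute values and weak approximation *)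

(** The exponents [m] and [m + 1] are consecutive because conj(z)^m z^(m+1) = N(z)^m z, a scalar
    multiple of [z]. The multiplicity is the valuation of the norm only after the content of [w] is
    divided out. If [t] and [u] are divisible by conjugate primes over one place,
    [t ^ m * u ^ (m + 1)] acquires a content and may be left with multiplicity 1. Hence [u] is
    chosen after [t], close to 1 wherever the multiplicity of [t] is nonzero outside the exceptional
    set; and the algebra has to be etale there, so that contents of powers are powers of contents.

    In the Darmon part, descending to the rationals removes the class group and the units of [K]: an
    integer whose valuations are all even is a square up to sign. The norm is a determinant attached
    to [Z[X] / f], and the places over almost every prime [p] are built by hand from the roots of
    [f] modulo [p], so ideals of the ring of integers never appear. A prime dividing a value of [f]
    at an integer has a rational root modulo itself; changing the residue at that root alone
    multiplies the norm by a chosen element of the prime field. *)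

Section Absval.
Context {R : realType} {L : fieldType} (w : absval R L).

Lemma absval_eq0b x : (w x == 0) = (x == 0).
Proof. by apply/eqP/eqP => [/absval_eq0//|->]; rewrite absval0. Qed.

Lemma absval_gt0 x : (0 < w x) = (x != 0).
Proof. by rewrite lt_neqAle absval_ge0 andbT eq_sym absval_eq0b. Qed.

Lemma absvalX x k : w (x ^+ k) = w x ^+ k.
Proof.
by elim: k => [|k IH]; rewrite ?expr0 ?absval1// !exprS absvalM IH.
Qed.

Lemma absvalV x : w x^-1 = (w x)^-1.
Proof.
have [->|x0] := eqVneq x 0; first by rewrite invr0 absval0 invr0.
apply: (@mulfI _ (w x)); first by rewrite absval_eq0b.
by rewrite -absvalM !divff ?absval1// absval_eq0b.
Qed.

Lemma absvalBC x y : w (x - y) = w (y - x).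
Proof. by rewrite -opprB absvalN. Qed.

Lemma absval_lerB x y : w x - w y <= w (x - y).
Proof. by rewrite lerBlDr -{1}(subrK y x) absvalD. Qed.

Definition ultra := forall x y, w (x + y) <= Num.max (w x) (w y).

Hypothesis uw : ultra.

Lemma ultraD_le x y e : w x <= e -> w y <= e -> w (x + y) <= e.
Proof. by move=> xe ye; rewrite (le_trans (uw _ _))// ge_max xe ye. Qed.

Lemma ultraD_lt x y e : w x < e -> w y < e -> w (x + y) < e.
Proof. by move=> xe ye; rewrite (le_lt_trans (uw _ _))// gt_max xe ye. Qed.

Lemma ultraB_le x y e : w x <= e -> w y <= e -> w (x - y) <= e.
Proof. by move=> xe ye; apply: ultraD_le; rewrite ?absvalN. Qed.

Lemma ultraB_lt x y e : w x < e -> w y < e -> w (x - y) < e.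
Proof. by move=> xe ye; apply: ultraD_lt; rewrite ?absvalN. Qed.

Lemma ultra_sum_le (I : Type) (r : seq I) (P : pred I) (F : I -> L) e :
  0 <= e -> (forall i, P i -> w (F i) <= e) ->
  w (\sum_(i <- r | P i) F i) <= e.
Proof.
move=> e0 h; elim/big_ind: _ => //; first by rewrite absval0.
by move=> x y; exact: ultraD_le.
Qed.

Lemma ultra_sum_lt (I : Type) (r : seq I) (P : pred I) (F : I -> L) e :
  0 < e -> (forall i, P i -> w (F i) < e) ->
  w (\sum_(i <- r | P i) F i) < e.
Proof.
move=> e0 h; elim/big_ind: _ => //; first by rewrite absval0.
by move=> x y; exact: ultraD_lt.
Qed.

Lemma ultra_close x y : w (x - y) < w y -> w x = w y.
Proof.
move=> h; apply/eqP; rewrite eq_le; apply/andP; split.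
  by rewrite -(subrK y x) ultraD_le// ltW.
rewrite leNgt; apply/negP => xy.
suff : w y < w y by rewrite ltxx.
by rewrite -{1}(subKr x y) ultraB_lt// absvalBC.
Qed.

Lemma ultra_nat k : w k%:R <= 1.
Proof.
elim: k => [|k IH]; first by rewrite absval0 ler01.
by rewrite -addn1 natrD ultraD_le// absval1.
Qed.

Lemma ultra_int (k : int) : w k%:~R <= 1.
Proof.
by case: k => k; rewrite ?NegzE ?mulrNz ?absvalN ultra_nat.
Qed.

End Absval.

Section Limits.
Context {R : realType} {L : fieldType} (w : absval R L).

(** Stated through real distances rather than in the topology of [valued w], so that one sequence
    can be followed at several absolute values at once. *)
Definition acvg (c : nat -> L) (l : L) := w (c k - l) @[k --> \oo] --> (0 : R).

Lemma acvg_le (c : nat -> L) (l : L) (u : nat -> R) :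
  (\forall k \near \oo, w (c k - l) <= u k) -> u @ \oo --> (0 : R) -> acvg c l.
Proof.
move=> cu u0; rewrite /acvg; apply: squeeze_cvgr (cvg_cst (0 : R)) u0.
by apply: filterS cu => k ->; rewrite absval_ge0.
Qed.

Lemma acvg_cst l : acvg (fun=> l) l.
Proof.
apply: (acvg_le (u := fun=> 0)); last exact: cvg_cst.
by near=> k; rewrite subrr absval0.
Unshelve. all: by end_near. Qed.

Lemma acvg_lt c l e : acvg c l -> 0 < e -> \forall k \near \oo, w (c k - l) < e.
Proof.
move=> cl e0; have /cvgrPdist_lt/(_ _ e0) := cl.
by apply: filterS => k; rewrite sub0r normrN ger0_norm// absval_ge0.
Qed.

Lemma acvg_harmonic c l : (forall k, w (c k - l) < k.+1%:R^-1) -> acvg c l.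
Proof.
move=> h; apply: acvg_le (@cvg_harmonic R).
by apply: nearW => k; rewrite ltW.
Qed.

Lemma acvgD c l d m : acvg c l -> acvg d m -> acvg (fun k => c k + d k) (l + m).
Proof.
move=> cl dm.
have h : w (c k - l) + w (d k - m) @[k --> \oo] --> (0 + 0 : R) by exact: cvgD.
rewrite addr0 in h; apply: acvg_le h.
by apply: nearW => k; rewrite opprD addrACA absvalD.
Qed.

Lemma acvgM c l d m : acvg c l -> acvg d m -> acvg (fun k => c k * d k) (l * m).
Proof.
move=> cl dm.
pose u k := w (c k - l) * w (d k - m) + w (c k - l) * w m + w l * w (d k - m).
have : u @ \oo --> (0 * 0 + 0 * w m + w l * 0 : R).
  apply: cvgD; first apply: cvgD.
  - exact: cvgM.
  - by apply: cvgM => //; exact: cvg_cst.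
  - by apply: cvgM => //; exact: cvg_cst.
rewrite !mul0r !mulr0 !addr0; apply: acvg_le; apply: nearW => k.
have -> : c k * d k - l * m =
    (c k - l) * (d k - m) + (c k - l) * m + l * (d k - m) by ring.
rewrite (le_trans (absvalD _ _ _))// absvalM lerD2r.
by rewrite (le_trans (absvalD _ _ _))// !absvalM.
Qed.

Lemma acvgX c l j : acvg c l -> acvg (fun k => c k ^+ j) (l ^+ j).
Proof.
move=> cl; elim: j => [|j IH]; first exact: acvg_cst.
rewrite exprS; under [X in acvg X]eq_fun do rewrite exprS; exact: acvgM.
Qed.

Lemma acvg_sum (I : Type) (r : seq I) (P : pred I) (c : I -> nat -> L) (l : I -> L) :
  (forall i, P i -> acvg (c i) (l i)) ->
  acvg (fun k => \sum_(i <- r | P i) c i k) (\sum_(i <- r | P i) l i).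
Proof.
move=> h; elim: r => [|i r IH].
  by rewrite big_nil; under [X in acvg X]eq_fun do rewrite big_nil; exact: acvg_cst.
rewrite big_cons; under [X in acvg X]eq_fun do rewrite big_cons.
by case: ifPn => // Pi; apply: acvgD => //; exact: h.
Qed.

Lemma acvgV c l : l != 0 -> acvg c l -> acvg (fun k => (c k)^-1) l^-1.
Proof.
move=> l0 cl; have wl : 0 < w l by rewrite absval_gt0.
have w2 : 0 < w l / 2 by rewrite divr_gt0.
have : (fun k => w (c k - l) * (2 / w l ^+ 2)) @ \oo --> (0 * (2 / w l ^+ 2) : R).
  by apply: cvgM => //; exact: cvg_cst.
rewrite mul0r; apply: acvg_le; have := acvg_lt cl w2.
apply: filterS => k h.
have hc : w l / 2 <= w (c k).
  by have := absval_lerB w l (l - c k); rewrite subKr absvalBC; lra.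
have c0 : c k != 0 by rewrite -(absval_gt0 w); apply: lt_le_trans hc.
have -> : (c k)^-1 - l^-1 = (l - c k) * ((c k)^-1 * l^-1) by field; rewrite c0 l0.
rewrite !absvalM absvalBC ler_wpM2l ?absval_ge0// !absvalV expr2 invfM mulrA.
rewrite ler_wpM2r ?invr_ge0 ?absval_ge0//.
by rewrite -(invrK (2 / w l)) lef_pV2 ?posrE ?invr_gt0 ?divr_gt0 ?absval_gt0// invf_div.
Qed.

Lemma acvg_geo a : w a < 1 -> acvg (fun k => a ^+ k) 0.
Proof.
move=> a1; rewrite /acvg; under eq_fun do rewrite subr0 absvalX.
by apply: cvg_expr; rewrite ger0_norm// absval_ge0.
Qed.

(** Together with the limit 1 when [1 < w a], this turns one separating element into a sequence that
    tends to 1 at some places and to 0 at others. *)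
Lemma acvg_frac_lt1 a : w a < 1 -> acvg (fun k => a ^+ k / (1 + a ^+ k)) 0.
Proof.
move=> a1; rewrite -(mul0r (1 + 0 : L)^-1); apply: acvgM; first exact: acvg_geo.
apply: acvgV; first by rewrite addr0 oner_eq0.
by apply: acvgD; [exact: acvg_cst|exact: acvg_geo].
Qed.

Lemma acvg_frac_gt1 a : 1 < w a -> acvg (fun k => a ^+ k / (1 + a ^+ k)) 1.
Proof.
move=> a1; have a0 : a != 0 by rewrite -(absval_gt0 w) (lt_trans ltr01).
have -> : (fun k => a ^+ k / (1 + a ^+ k)) = fun k => (1 + a^-1 ^+ k)^-1.
  apply/funext => k; have ak0 : a ^+ k != 0 by rewrite expf_neq0.
  rewrite exprVn -[1 + (a ^+ k)^-1](mulfK ak0) mulrDl mul1r mulVf//.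
  by rewrite invfM invrK addrC mulrC.
rewrite -[X in acvg _ X](_ : (1 + 0)^-1 = 1); last by rewrite addr0 invr1.
apply: acvgV; first by rewrite addr0 oner_eq0.
apply: acvgD; first exact: acvg_cst.
by apply: acvg_geo; rewrite absvalV invf_lt1// (lt_trans ltr01).
Qed.

End Limits.

Section WeakApproximation.
Context {R : realType} {K : fieldType}.
Implicit Types (v w : place R K).

Lemma place_nontrivial v : exists2 x, x != 0 & 1 < v x.
Proof.
have /asboolP[x [x0 vx]] := valP (repr v).
case: (ltP 1 (v x)) => [?|vx1]; first by exists x.
exists x^-1; first by rewrite invr_eq0.
by rewrite absvalV invf_gt1 ?absval_gt0// lt_neqAle vx.
Qed.

(** With [c] fixed, the ratios [ln (v a) / ln (v c)] and [ln (w a) / ln (w c)] agree: if the second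
    were larger, a fraction m/k strictly between them would make [a ^+ k * c ^ (- m)] small at [v]
    and large at [w]. Replacing [a] by its inverse gives the other inequality, and the common ratio
    gives the exponent relating [v] and [w]. *)
Lemma place_eq_absval v w :
  (forall a, v a < 1 -> w a < 1) -> v = w.
Proof.
move=> vw; have [c c0 vc] := place_nontrivial v.
have gt1 a : 1 < v a -> 1 < w a.
  move=> va; have a0 : a != 0 by rewrite -(absval_gt0 v) (lt_trans ltr01).
  have := vw a^-1; rewrite !absvalV !invf_lt1 ?absval_gt0//; exact.
have lnv : 0 < ln (v c) by rewrite ln_gt0.
have lnw : 0 < ln (w c) by rewrite ln_gt0// gt1.
have key a : a != 0 -> ln (w a) / ln (w c) <= ln (v a) / ln (v c).
  move=> a0; rewrite leNgt; apply/negP => lt.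
  set T := ln (v a) / ln (v c) in lt; set T' := ln (w a) / ln (w c) in lt.
  have [k hk] : exists k : nat, 1 < k%:R * (T' - T).
    have d0 : 0 < T' - T by rewrite subr_gt0.
    exists (Num.bound (T' - T)^-1).
    by rewrite -ltr_pdivrMr// mul1r archi_boundP// invr_ge0 ltW.
  pose m : int := Num.floor (k%:R * T) + 1.
  have m1 : k%:R * T < m%:~R by rewrite floorD1_gt.
  have m2 : m%:~R <= k%:R * T + 1 by rewrite rmorphD/= lerD2r floor_le.
  have m3 : m%:~R < k%:R * T' by lra.
  have hlnX (u : place R K) (x : K) (j : int) : x != 0 -> ln (u (x ^ j)) = j%:~R * ln (u x).
    move=> x0; case: j => j.
      by rewrite -exprnP absvalX lnXn ?absval_gt0// mulr_natl.
    rewrite NegzE -exprnN absvalV absvalX lnV ?posrE ?exprn_gt0 ?absval_gt0//.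
    by rewrite lnXn ?absval_gt0// mulrNz mulNr mulr_natl.
  have q0 : a ^+ k * c ^ (- m) != 0 by rewrite mulf_neq0 ?expf_neq0 ?expfz_neq0.
  have hln (u : place R K) :
     ln (u (a ^+ k * c ^ (- m))) = k%:R * ln (u a) - m%:~R * ln (u c).
    rewrite absvalM lnM ?posrE ?absval_gt0 ?expf_neq0 ?expfz_neq0//.
    rewrite hlnX// absvalX lnXn ?absval_gt0// mulr_natl.
    by rewrite rmorphN mulNr.
  have : w (a ^+ k * c ^ (- m)) < 1.
    apply: vw; rewrite -ltr_ln ?posrE ?absval_gt0 ?ltr01// ln1 hln subr_lt0.
    by rewrite -ltr_pdivrMr// -mulrA.
  rewrite -ltr_ln ?posrE ?absval_gt0 ?ltr01// ln1 hln subr_lt0.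
  by rewrite -ltr_pdivrMr// -mulrA => /lt_trans /(_ m3); rewrite ltxx.
have lnE a : a != 0 -> ln (w a) = (ln (w c) / ln (v c)) * ln (v a).
  move=> a0; have e : ln (w a) / ln (w c) = ln (v a) / ln (v c).
    apply/eqP; rewrite eq_le key//=.
    have aV0 : a^-1 != 0 by rewrite invr_eq0.
    have := key _ aV0; rewrite !absvalV !lnV ?posrE ?absval_gt0// !mulNr lerN2.
    by [].
  have lnw0 : ln (w c) != 0 by rewrite gt_eqF.
  by rewrite -[LHS](mulfVK lnw0) e; ring.
rewrite -[v]reprK -[w]reprK; apply/eqmodP/asboolP.
exists (ln (w c) / ln (v c)); split; first by rewrite divr_gt0.
move=> x; have [->|x0] := eqVneq x 0.
  by rewrite !absval0 powR0// gt_eqF// divr_gt0.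
rewrite -[LHS]lnK ?posrE ?absval_gt0//.
by rewrite [X in expR X](lnE x x0) /powR gt_eqF// absval_gt0.
Qed.

Lemma place_sep v w : v != w -> exists2 a, 1 < v a & w a < 1.
Proof.
have half (u u' : place R K) : u != u' -> exists2 a, u a < 1 & 1 <= u' a.
  move=> uu'; apply: contrapT => h; move/eqP: uu'; apply.
  apply: place_eq_absval => a ua; rewrite ltNge; apply/negP => u'a.
  by apply: h; exists a.
move=> vw; have [a va wa] := half _ _ vw.
have [b wb vb] := half w v (ltac:(by rewrite eq_sym)).
have a0 : a != 0 by rewrite -(absval_gt0 w) (lt_le_trans ltr01).
have va0 : 0 < v a by rewrite absval_gt0.
have wa0 : 0 < w a by rewrite absval_gt0.
exists (b / a); rewrite absvalM absvalV.
  by rewrite ltr_pdivlMr// mul1r (lt_le_trans va).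
by rewrite ltr_pdivrMr// mul1r (lt_le_trans wb).
Qed.

Lemma near_all_seq (I : eqType) (s : seq I) (P : I -> nat -> Prop) :
  (forall i, i \in s -> \forall k \near \oo, P i k) ->
  \forall k \near \oo, forall i, i \in s -> P i k.
Proof.
elim: s => [|i s IH] h; first exact: nearW.
have hi := h i (mem_head _ _).
have {IH} hs := IH (fun j js => h j (mem_behead (s := i :: s) js)).
by apply: filterS2 hi hs => k hi hs j; rewrite in_cons => /orP[/eqP->|/hs].
Qed.

(** Induction on [s], with [b] separating [v] from the new place [w]. If [w a <= 1], a high power of
    [a] times [b] works. Otherwise [a ^+ k / (1 + a ^+ k)] tends to 1 at [v] and [w] and to 0 on
    [s], so multiplying [b] by it changes [b] only where it has to. *)
Lemma place_sep_seq v (s : seq (place R K)) : v \notin s ->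
  exists2 a, 1 < v a & forall w, w \in s -> w a < 1.
Proof.
elim: s => [_|w s IH].
  by have [x _ vx] := place_nontrivial v; exists x.
rewrite in_cons negb_or => /andP[vw /IH[a va sa]].
have [b vb wb] := place_sep vw.
case: (leP (w a) 1) => wa.
  have : \forall k \near \oo, forall u : place R K, u \in s -> u (a ^+ k * b) < 1.
    apply: near_all_seq => /= u us.
    have : acvg (u : place R K) (fun k => a ^+ k * b) (0 * b).
      by apply: acvgM; [apply: acvg_geo; exact: sa|exact: acvg_cst].
    by move=> /acvg_lt/(_ ltr01); apply: filterS => k; rewrite mul0r subr0.
  move=> /filter_ex[k hk]; exists (a ^+ k * b).
    rewrite absvalM absvalX (lt_le_trans vb)// ler_peMl ?absval_ge0//.
    by rewrite exprn_ege1// ltW.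
  move=> u; rewrite in_cons => /orP[/eqP->|]; last exact: hk.
  rewrite absvalM absvalX (le_lt_trans _ wb)// ler_piMl ?absval_ge0//.
  by rewrite exprn_ile1// absval_ge0.
pose c k := b * (a ^+ k / (1 + a ^+ k)).
have cb (u : place R K) : 1 < u a -> acvg u c b.
  by move=> ua; rewrite -[b]mulr1; apply: acvgM; [exact: acvg_cst|exact: acvg_frac_gt1].
have hs : \forall k \near \oo, forall u : place R K, u \in s -> u (c k) < 1.
  apply: near_all_seq => /= u us.
  have : acvg (u : place R K) c (b * 0).
    by apply: acvgM; [exact: acvg_cst|apply: acvg_frac_lt1; exact: sa].
  by move=> /acvg_lt/(_ ltr01); apply: filterS => k; rewrite mulr0 subr0.
have hv : \forall k \near \oo, 1 < v (c k).
  have vb1 : 0 < v b - 1 by rewrite subr_gt0.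
  apply: filterS (acvg_lt (cb v va) vb1) => k.
  by have := absval_lerB v b (b - c k); rewrite subKr absvalBC; lra.
have hw : \forall k \near \oo, w (c k) < 1.
  have wb1 : 0 < 1 - w b by rewrite subr_gt0.
  apply: filterS (acvg_lt (cb w wa) wb1) => k.
  by have := absvalD w (c k - b) b; rewrite subrK; lra.
have /filter_ex[k [hvk hwk hsk]] : \forall k \near \oo,
    [/\ 1 < v (c k), w (c k) < 1 & forall u : place R K, u \in s -> u (c k) < 1].
  by apply: filterS3 hv hw hs.
by exists (c k) => // u; rewrite in_cons => /orP[/eqP->|/hsk].
Qed.

Lemma place_unit_seq v (s : seq (place R K)) : v \notin s ->
  exists e : nat -> K, acvg v e 1 /\ forall w, w \in s -> acvg w e 0.
Proof.
move=> /place_sep_seq[a va sa]; exists (fun k => a ^+ k / (1 + a ^+ k)); split.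
  exact: acvg_frac_gt1.
by move=> w ws; apply: acvg_frac_lt1; exact: sa.
Qed.

Lemma weak_approximation_cvg (s : seq (place R K)) (x : place R K -> K) : uniq s ->
  exists c : nat -> K, forall v, v \in s -> acvg v c (x v).
Proof.
move=> us.
have /choice[e he] : forall v, exists e : nat -> K, v \in s ->
    acvg v e 1 /\ forall w, w \in s -> w != v -> acvg w e 0.
  move=> v; have [|e [ev es]] := @place_unit_seq v (rem v s).
    by rewrite mem_rem_uniqF.
  exists e => vs; split=> // w ws wv; apply: es.
  by rewrite mem_rem_uniq// inE wv.
exists (fun k => \sum_(v <- s) x v * e v k) => v vs.
have -> : x v = \sum_(w <- s) x w * (w == v)%:R.
  rewrite (bigD1_seq v)//= eqxx mulr1 big1 ?addr0// => w /negPf->.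
  by rewrite mulr0.
rewrite big_seq; under [X in acvg _ X _]eq_fun do rewrite big_seq.
apply: acvg_sum => w ws; apply: acvgM; first exact: acvg_cst.
have [ew es] := he w ws.
by have [<-//|wv] := eqVneq w v; apply: es; rewrite // eq_sym.
Qed.

Lemma weak_approximation (Z : set (place R K)) (I : finType)
    (x : place R K -> I -> K) (e : place R K -> R) : finite_set Z ->
  (forall v, Z v -> 0 < e v) ->
  exists a : I -> K, forall v, Z v -> forall i, v (a i - x v i) < e v.
Proof.
move=> /finite_seqP[s sZ] e0.
have us := undup_uniq s.
have /choice[c hc] := fun i => weak_approximation_cvg (fun v => x v i) us.
have : \forall k \near \oo, forall p : place R K * I, p \in [seq (v, i) | v <- undup s, i <-
  enum I] ->
     p.1 (c p.2 k - x p.1 p.2) < e p.1.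
  apply: near_all_seq => -[v i] /allpairsP[[v' i'] [/= vs _ [-> ->]]].
  by apply: acvg_lt; [exact: hc|by apply: e0; rewrite sZ/= -mem_undup].
move=> /filter_ex[k hk]; exists (fun i => c i k) => v; rewrite sZ/= -mem_undup => vs i.
by apply: (hk (v, i)); apply/allpairsP; exists (v, i); split=> //=; rewrite mem_enum.
Qed.

End WeakApproximation.

(** * Finite places of a number field *)

Section NumberField.
Context {R : realType} {K : fieldExtType rat}.
Implicit Types (v w : place R K) (a b : K).

Lemma natr_eq0_ext k : (k%:R == 0 :> K) = (k == 0)%N.
Proof.
rewrite -(rmorph_nat (GRing.in_alg K)) /= scaler_eq0 oner_eq0 orbF.
by rewrite pnatr_eq0.
Qed.

Lemma intr_eq0_ext (z : int) : (z%:~R == 0 :> K) = (z == 0).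
Proof.
by case: z => k; rewrite ?NegzE ?mulrNz ?oppr_eq0 -?[_%:~R]/(_%:R) natr_eq0_ext.
Qed.

Lemma int_minPoly a : exists2 q : {poly int}, q != 0 &
  map_poly intr q = (lead_coef q)%:~R *: minPoly 1%AS a.
Proof.
have /polyOver1P[p0 p0E] := minPolyOver 1%AS a.
have [q [c c0 qE]] := rat_poly_scale p0.
have p0m : p0 \is monic.
  by have := monic_minPoly 1%AS a; rewrite p0E map_monic.
have p0N : p0 != 0 by rewrite monic_neq0.
have cQ0 : c%:~R != 0 :> rat by rewrite intr_eq0.
have qE' : map_poly intr q = c%:~R *: p0 by rewrite qE scalerA divff// scale1r.
have lq : lead_coef q = c.
  apply: (@intr_inj rat); rewrite -(lead_coef_map_inj (@intr_inj rat))//.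
  by rewrite qE' lead_coefZ (monicP p0m) mulr1.
exists q.
  by apply: contraNneq c0 => q0; rewrite -lq q0 lead_coef0.
apply/polyP => i; rewrite lq p0E coefZ !coef_map_id0 ?rmorph0//.
have /(congr1 (fun r : {poly rat} => GRing.in_alg K r`_i)) := qE'.
by rewrite coefZ coef_map_id0// rmorphM !rmorph_int.
Qed.

Lemma ultra_prime_coprime v p q : ultra v -> prime p -> prime q ->
  v p%:R < 1 -> v q%:R < 1 -> p = q.
Proof.
move=> uv pp pq vp vq; apply/eqP; apply: contraT => npq.
have cop : coprime p q by rewrite prime_coprime// dvdn_prime2.
have [km kn e _] := egcdnP q (prime_gt0 pp).
have : v (km * p)%:R < 1.
  by rewrite natrM absvalM (le_lt_trans _ vp)// ler_piMl ?absval_ge0// ultra_nat.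
rewrite e (eqP cop) natrD => h.
have : v ((kn * q)%:R + 1 - (kn * q)%:R) < 1.
  apply: ultraB_lt => //.
  by rewrite natrM absvalM (le_lt_trans _ vq)// ler_piMl ?absval_ge0// ultra_nat.
by rewrite addrAC subrr add0r absval1 ltxx.
Qed.

Lemma ultra_nat_lt1 v k : ultra v -> (0 < k)%N -> v k%:R < 1 ->
  exists2 p, p \in primes k & v p%:R < 1.
Proof.
move=> uv; elim/ltn_ind: k => k IH k0 vk.
have k1 : (1 < k)%N.
  by case: k k0 vk {IH} => [|[|k]]// _; rewrite absval1 ltxx.
have [vp|vp] := ltP (v (pdiv k)%:R) 1.
  by exists (pdiv k) => //; rewrite mem_primes pdiv_prime// k0 pdiv_dvd.
have vp1 : v (pdiv k)%:R = 1 by apply/le_anti; rewrite vp ultra_nat.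
have kE : k = (k %/ pdiv k * pdiv k)%N by rewrite divnK// pdiv_dvd.
have d0 : (0 < k %/ pdiv k)%N.
  by rewrite divn_gt0 ?pdiv_gt0// pdiv_leq.
have [p pk pv] : exists2 p, p \in primes (k %/ pdiv k) & v p%:R < 1.
  apply: IH => //; last by rewrite kE natrM absvalM vp1 mulr1 in vk.
  by rewrite ltn_Pdiv// prime_gt1// pdiv_prime.
exists p => //; move: pk; rewrite !mem_primes => /and3P[-> _ /= pd].
by rewrite k0 kE dvdn_mulr.
Qed.

Lemma ultra_nat_logn v p k : ultra v -> prime p -> v p%:R < 1 -> (0 < k)%N ->
  v k%:R = v p%:R ^+ logn p k.
Proof.
move=> uv pp vp k0; have [m cop kE] := pfactor_coprime pp k0.
rewrite {1}kE natrM natrX absvalM absvalX (_ : v m%:R = 1) ?mul1r//.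
apply/le_anti; rewrite ultra_nat//= leNgt; apply/negP => vm.
have m0 : (0 < m)%N by move: k0; rewrite kE muln_gt0 => /andP[].
have [q] := ultra_nat_lt1 uv m0 vm.
rewrite mem_primes => /and3P[pq _ qm] vq.
move: cop; rewrite (ultra_prime_coprime uv pp pq vp vq) prime_coprime//.
by rewrite qm.
Qed.

Lemma ultra_int_logn v p (z : int) : ultra v -> prime p -> v p%:R < 1 -> z != 0 ->
  v z%:~R = v p%:R ^+ logn p `|z|%N.
Proof.
move=> uv pp vp z0; rewrite -ultra_nat_logn ?absz_gt0//.
by case: z z0 => k //; rewrite NegzE mulrNz absvalN abszN.
Qed.

Lemma integral_le1 v (f : {poly int}) a : ultra v -> f \is monic ->
  root (map_poly intr f) a -> v a <= 1.
Proof.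
move=> uv fm; have lf : lead_coef f = 1 by apply/monicP.
have sf : size (map_poly (intr : int -> K) f) = size f.
  by rewrite size_map_poly_id0// lf oner_eq0.
have f0 : (0 < size f)%N by rewrite lt0n size_poly_eq0 monic_neq0.
move=> /rootP; rewrite horner_coef sf -(prednK f0) big_ord_recr/=.
rewrite coef_map_id0// -[f`_(size f).-1]/(lead_coef f) lf mul1r.
move=> /eqP; rewrite addrC addr_eq0 => /eqP aE.
rewrite leNgt; apply/negP => a1.
have a0 : 0 < v a by rewrite (lt_trans ltr01).
suff : v (a ^+ (size f).-1) < v a ^+ (size f).-1 by rewrite absvalX ltxx.
rewrite {1}aE absvalN; apply: ultra_sum_lt => //; first by rewrite exprn_gt0.
move=> i _; rewrite coef_map_id0// absvalM absvalX.
rewrite (le_lt_trans (y := v a ^+ i))//.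
  by rewrite ler_piMl ?exprn_ge0// ?absval_ge0// ultra_int.
by rewrite ltr_eXn2l.
Qed.

(* If q is integral with leading coefficient c and q(a) = 0, then
   c^(deg q - 1) q(x / c) is monic and integral, with root c a. *)
Lemma int_multiple_root a (q : {poly int}) : q != 0 ->
  root (map_poly intr q) a -> (1 < size q)%N ->
  exists f : {poly int}, [/\ f \is monic, size f = size q
    & root (map_poly intr f) ((lead_coef q)%:~R * a)].
Proof.
move=> q0 qa sq; set c := lead_coef q; set d := (size q).-1.
have d0 : (0 < d)%N by rewrite /d -subn1 subn_gt0.
have qd : size q = d.+1 by rewrite /d prednK// ltnW.
pose f : {poly int} := \poly_(i < d.+1) (if i == d :> nat then 1 else q`_i * c ^+ (d.-1 - i)).
have fd : f`_d = 1 by rewrite coef_poly ltnSn eqxx.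
have sf : size f = d.+1 by rewrite size_poly_eq// eqxx oner_eq0.
have sfK : size (map_poly (intr : int -> K) f) = d.+1.
  by rewrite size_map_poly_id0// lead_coefE sf/= fd oner_eq0.
have sqK : size (map_poly (intr : int -> K) q) = d.+1.
  by rewrite size_map_poly_id0// intr_eq0_ext lead_coef_eq0.
exists f; split; [by rewrite monicE lead_coefE sf/= fd|by rewrite sf qd|].
apply/rootP; rewrite horner_coef sfK.
transitivity (c%:~R ^+ d.-1 * (map_poly intr q).[a]); last by rewrite (rootP qa) mulr0.
rewrite horner_coef sqK mulr_sumr; apply: eq_bigr => i _.
rewrite !coef_map_id0// coef_poly ltn_ord; case: eqP => [->|/eqP id].
  rewrite -[q`_d]/(lead_coef q) -/c exprMn mul1r -[in LHS](prednK d0) exprSr mulrA.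
  by rewrite (prednK d0).
have {}id : (i <= d.-1)%N.
  by rewrite -ltnS prednK// ltn_neqAle id -ltnS ltn_ord.
by rewrite intrM rmorphXn/= exprMn -[in RHS](subnK id) exprD; ring.
Qed.

Lemma exists_integral_multiple a : exists2 D : nat, (0 < D)%N &
  forall v, ultra v -> v (D%:R * a) <= 1.
Proof.
have [q q0 qE] := int_minPoly a.
have qa : root (map_poly intr q) a by rewrite qE rootZ ?root_minPoly// intr_eq0_ext lead_coef_eq0.
have sq : (1 < size q)%N.
  have : size (map_poly (intr : int -> K) q) = size q.
    by rewrite size_map_poly_id0// intr_eq0_ext lead_coef_eq0.
  move=> <-; apply: (root_size_gt1 _ qa).
  by rewrite qE scaler_eq0 intr_eq0_ext lead_coef_eq0 (negPf q0)/= monic_neq0// monic_minPoly.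
have [f [fm _ fr]] := int_multiple_root q0 qa sq.
exists `|lead_coef q|%N; first by rewrite absz_gt0 lead_coef_eq0.
move=> v uv; have := integral_le1 uv fm fr.
case: (lead_coef q) => k //; rewrite NegzE mulrNz mulNr absvalN abszN.
by [].
Qed.

Lemma ultra_prime v : ultra v -> exists2 p, prime p & v p%:R < 1.
Proof.
move=> uv; have [x x0 vx] := place_nontrivial v.
have [D D0 hD] := exists_integral_multiple x.
have [p pD vp] : exists2 p, p \in primes D & v p%:R < 1.
  apply: ultra_nat_lt1 => //; rewrite ltNge; apply/negP => vD.
  have := hD v uv; rewrite absvalM leNgt => /negP; apply.
  by rewrite (lt_le_trans vx)// ler_peMl ?absval_ge0.
by exists p => //; move: pD; rewrite mem_primes => /and3P[].
Qed.

(** The right-hand side does not mention [v]: all places over [p] have the same unit ball on the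
    rationals, which allows comparisons of rational coefficients to be moved from one such place to
    another. *)
Lemma ultra_rat_le1 v p (q : rat) : ultra v -> prime p -> v p%:R < 1 -> q != 0 ->
  (v q%:A <= 1) = (logn p `|denq q| <= logn p `|numq q|)%N.
Proof.
move=> uv pp vp q0.
have n0 : numq q != 0 by rewrite numq_eq0.
have p0 : 0 < v p%:R by rewrite absval_gt0 natr_eq0_ext -lt0n prime_gt0.
have -> : v q%:A = v (numq q)%:~R / v (denq q)%:~R.
  rewrite -[q in LHS]divq_num_den -[_%:A]/(GRing.in_alg K _) rmorphM fmorphV.
  by rewrite absvalM absvalV !rmorph_int.
rewrite !(ultra_int_logn uv pp vp)// ler_pdivrMr ?exprn_gt0// mul1r.
by rewrite ler_iXn2l.
Qed.

(** There are at most as many such places as the degree of [K]. Elements of value 1 at one place and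
    less than 1 at the others are linearly independent over the rationals: in a relation divided by
    its p-adically largest coefficient, the term with coefficient 1 dominates at its own place. *)
Lemma finite_places_over p : prime p ->
  finite_set [set v : place R K | ultra v /\ v p%:R < 1].
Proof.
move=> pp; apply: contrapT => /(@infinite_set_fset _ _ (\dim {:K}).+1)[B BA].
set s := finmap.enum_fset B => dimB.
have us : uniq s by exact: finmap.fset_uniq.
have sP (v : place R K) : v \in s -> ultra v /\ v p%:R < 1 by move=> vs; apply: BA.
have fin : finite_set [set` s] by exact: finite_seq.
have /choice[e he] : forall v : place R K, exists e : K, v \in s ->
    v e = 1 /\ forall w, w \in s -> w != v -> w e < 1.
  move=> v; have [a ha] := @weak_approximation R K [set` s] unit
     (fun w _ => (w == v)%:R) (fun=> 1) fin (fun=> fun=> ltr01).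
  exists (a tt) => vs; split.
    rewrite -(absval1 v); apply: (ultra_close (sP v vs).1).
    by have := ha v vs tt; rewrite eqxx absval1.
  by move=> w ws wv; have := ha w ws tt; rewrite (negPf wv) subr0.
pose X := [tuple of map e (in_tuple s)].
suff /eqP freeX : free X.
  have := dimvS (subvf <<X>>%VS); rewrite freeX size_tuple => /leq_trans.
  by move=> /(_ _ (leqnn _)); rewrite leqNgt dimB.
apply/freeP => k; set m := size s in k *.
have [i0|] := boolP [forall i : 'I_m, k i == 0].
  by move=> _ i; apply/eqP; move: i; exact/forallP.
rewrite negb_forall => /existsP[i1 ki1].
have [vi1 pi1] := sP _ (mem_nth (nth (tnth (in_tuple s) i1) s 0) (ltn_ord i1)).
set v1 : place R K := nth _ s i1 in vi1 pi1.
have [i ki hi] := @Order.TotalTheory.arg_maxP _ _ _ i1 (fun i => k i != 0)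
   (fun i => v1 (k i)%:A) ki1.
move=> sum0.
have Xi (j : 'I_m) : X`_j = e (tnth (in_tuple s) j).
  by rewrite /= (nth_map v1)// (tnth_nth v1).
pose vi : place R K := tnth (in_tuple s) i.
have vis : vi \in s by exact: mem_tnth.
have [uvi pvi] := sP _ vis.
(* The coefficient [k i] is largest at the auxiliary place [v1]; being rational, it is then also
   largest at [vi]. *)
have le1 (j : 'I_m) : vi (k j / k i)%:A <= 1.
  have [->|kj] := eqVneq (k j) 0; first by rewrite mul0r scale0r absval0 ler01.
  have kji : k j / k i != 0 by rewrite mulf_neq0// invr_eq0.
  rewrite (ultra_rat_le1 uvi pp pvi kji) -(ultra_rat_le1 vi1 pp pi1 kji).
  have ki0 : 0 < v1 (k i)%:A by rewrite absval_gt0 scaler_eq0 oner_eq0 orbF.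
  rewrite -[_%:A]/(GRing.in_alg K _) rmorphM fmorphV absvalM absvalV.
  by rewrite ler_pdivrMr// mul1r; exact: hi.
have sumE : \sum_(j < m) (k j / k i) *: e (tnth (in_tuple s) j) = 0.
  transitivity ((k i)^-1 *: \sum_(j < m) k j *: X`_j); last by rewrite sum0 scaler0.
  by rewrite scaler_sumr; apply: eq_bigr => j _; rewrite Xi scalerA mulrC.
have : e vi = - \sum_(j < m | j != i) (k j / k i) *: e (tnth (in_tuple s) j).
  apply/eqP; rewrite -addr_eq0; apply/eqP; rewrite -[RHS]sumE [in RHS](bigD1 i)//=.
  by rewrite divff// scale1r.
move=> /(congr1 vi); rewrite (he vi vis).1 absvalN => h.
have : vi (\sum_(j < m | j != i) (k j / k i) *: e (tnth (in_tuple s) j)) < 1.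
  apply: ultra_sum_lt => // j ji; rewrite -mulr_algl absvalM.
  apply: (le_lt_trans (ler_piMl (absval_ge0 _ _) (le1 j))).
  have tj : tnth (in_tuple s) j \in s by exact: mem_tnth.
  apply: (he _ tj).2 => //.
  apply: contraNneq ji; rewrite /vi !(tnth_nth vi) /= => /eqP.
  by rewrite nth_uniq// => /eqP/ord_inj->.
by rewrite -h ltxx.
Qed.

Lemma finite_places_nonunit a : a != 0 ->
  finite_set [set v : place R K | ultra v /\ v a != 1].
Proof.
move=> a0; have [D D0 hD] := exists_integral_multiple a.
have [E E0 hE] := exists_integral_multiple a^-1.
apply: (@sub_finite_set _ _ (\bigcup_(p in [set` primes (D * E)])
    [set v : place R K | ultra v /\ v p%:R < 1])).
  move=> v [uv va]; have DE0 : (0 < D * E)%N by rewrite muln_gt0 D0.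
  have vDE : v (D * E)%:R < 1.
    rewrite lt_neqAle ultra_nat// andbT; apply: contra va => /eqP.
    rewrite natrM absvalM => h.
    have vD : v D%:R = 1.
      apply/le_anti; rewrite ultra_nat//= -h ler_piMr ?absval_ge0// ultra_nat//.
    have vE : v E%:R = 1 by move: h; rewrite vD mul1r.
    have := hD v uv; have := hE v uv; rewrite !absvalM vD vE !mul1r absvalV.
    by rewrite invf_le1 ?absval_gt0// eq_le => -> ->.
  by have [p pDE vp] := ultra_nat_lt1 uv DE0 vDE; exists p.
apply: bigcup_finite; first exact: finite_seq.
by move=> p /=; rewrite mem_primes => /and3P[pp _ _]; exact: finite_places_over.
Qed.

Lemma finite_places_nonintegral a :
  finite_set [set v : place R K | ultra v /\ ~~ (v a <= 1)].
Proof.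
have [->|a0] := eqVneq a 0.
  rewrite (_ : [set _ | _] = set0)//; apply/seteqP; split=> // v [_].
  by rewrite absval0 ler01.
apply: sub_finite_set (finite_places_nonunit a0) => v [uv va]; split=> //.
by apply: contraNneq va => ->.
Qed.

(** In the integral equation of [a], the largest value is attained by two terms. Comparing them
    writes [v a ^+ (j - i)] as a power of [v p%:R], and [j - i], being at most the degree of [K],
    divides its factorial. *)
Lemma ultra_power_prime v p a : ultra v -> prime p -> v p%:R < 1 -> a != 0 ->
  v a <= 1 -> exists j : nat, v a ^+ (\dim {:K})`! = v p%:R ^+ j.
Proof.
move=> uv pp vp a0 va1.
have p0 : 0 < v p%:R by rewrite absval_gt0 natr_eq0_ext -lt0n prime_gt0.
have [q q0 qE] := int_minPoly a.
have qa : root (map_poly intr q) a by rewrite qE rootZ ?root_minPoly// intr_eq0_ext lead_coef_eq0.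
have sqK : size (map_poly (intr : int -> K) q) = size q.
  by rewrite size_map_poly_id0// intr_eq0_ext lead_coef_eq0.
have sq : (size q <= (\dim {:K}).+1)%N.
  rewrite -sqK qE size_scale ?intr_eq0_ext ?lead_coef_eq0// size_minPoly ltnS.
  have := dim_Fadjoin 1%AS a; rewrite dimv1 muln1 => <-; exact/dimvS/subvf.
pose T (i : 'I_(size q)) := (q`_i)%:~R * a ^+ i : K.
have T0 : \sum_i T i = 0.
  have /rootP := qa; rewrite horner_coef sqK => e; rewrite -[RHS]e; apply: eq_bigr => i _.
  by rewrite coef_map_id0.
have sq0 : (0 < size q)%N by rewrite lt0n size_poly_eq0.
have Tn0 (i : 'I_(size q)) : q`_i != 0 -> T i != 0.
  by move=> qi; rewrite mulf_neq0 ?expf_neq0// intr_eq0_ext.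
have lsq : ((size q).-1 < size q)%N by rewrite prednK.
have Tl : T (Ordinal lsq) != 0 by rewrite Tn0// -lead_coefE lead_coef_eq0.
have [i [j [ij vij Ti Tj]]] :
    exists i j : 'I_(size q), [/\ (i < j)%N, v (T i) = v (T j), T i != 0 & T j != 0].
  have [i Ti hi] := @Order.TotalTheory.arg_maxP _ _ _ (Ordinal lsq)
    (fun i => T i != 0) (fun i => v (T i)) Tl.
  apply: contrapT => h.
  suff : v (T i) < v (T i) by rewrite ltxx.
  move: T0; rewrite (bigD1 i)//= => /eqP; rewrite addr_eq0 => /eqP {1}->.
  rewrite absvalN; apply: ultra_sum_lt => //; first by rewrite absval_gt0.
  move=> j ji; have [->|Tj] := eqVneq (T j) 0; first by rewrite absval0 absval_gt0.
  have /= hj := hi j Tj; rewrite lt_neqAle hj andbT; apply/negP => /eqP vij; apply: h.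
  move: ji; rewrite -val_eqE neq_ltn => /orP[ji|ij]; first by exists j, i.
  by exists i, j.
have qi : q`_i != 0 by apply: contraNneq Ti => qi; rewrite /T qi mul0r.
have qj : q`_j != 0 by apply: contraNneq Tj => qj; rewrite /T qj mul0r.
move: vij; rewrite /T !absvalM !(ultra_int_logn uv pp vp)// !absvalX.
set al := logn _ _; set be := logn _ _.
have va0 : 0 < v a by rewrite absval_gt0.
rewrite -(subnK (ltnW ij)) exprD mulrA => /(mulIf (lt0r_neq0 (exprn_gt0 _ va0))) e.
have ba : (be <= al)%N.
  rewrite -(ler_iXn2l p0 vp) e ler_piMr// ?exprn_ge0 ?(ltW p0)//.
  by rewrite exprn_ile1// ltW.
have {}e : v a ^+ (j - i) = v p%:R ^+ (al - be).
  apply: (mulfI (lt0r_neq0 (exprn_gt0 be p0))).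
  by rewrite -e -exprD subnKC.
have /dvdnP[k kE] : (j - i %| (\dim {:K})`!)%N.
  rewrite dvdn_fact// subn_gt0 ij/= (leq_trans (leq_subr _ _))//.
  by rewrite -ltnS (leq_trans (ltn_ord j)).
by exists ((al - be) * k)%N; rewrite kE mulnC exprM e -exprM.
Qed.

Definition is_uniformizer v a := [/\ a != 0, v a < 1 &
  forall b, b != 0 -> v b <= 1 -> exists j : nat, v b = v a ^+ j].

(** After raising to the power [N], the nonzero values at most 1 become powers of [v p%:R]. An
    element with the least positive exponent is a uniformizer, by repeated division. *)
Lemma exists_uniformizer v : ultra v -> exists a, is_uniformizer v a.
Proof.
move=> uv; have [p pp vp] := ultra_prime uv; set N := (\dim {:K})`!.
have p0 : 0 < v p%:R by rewrite absval_gt0 natr_eq0_ext -lt0n prime_gt0.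
have N0 : (0 < N)%N by exact: fact_gt0.
pose P j := `[< exists a, [/\ a != 0, v a ^+ N = v p%:R ^+ j & (0 < j)%N] >].
have exP : exists j, P j.
  by exists N; apply/asboolP; exists p%:R; split; rewrite // natr_eq0_ext -lt0n prime_gt0.
have [j0 /asboolP[a [a0 va j00]] minj0] := ex_minnP exP.
have va1 : v a < 1.
  by rewrite -(@expr_lt1 _ N) ?absval_ge0// va exprn_ilt1 -?lt0n// ltW.
exists a; split=> // b b0 vb.
have [j vj] := ultra_power_prime uv pp vp b0 vb.
elim/ltn_ind: j b b0 vb vj => j IH b b0 vb vj.
have [j_0|jgt0] := posnP j.
  exists 0%N; move: vj; rewrite j_0 expr0 => /eqP.
  by rewrite pexpr_eq1 ?absval_ge0// => /eqP.
have j0j : (j0 <= j)%N by apply: minj0; apply/asboolP; exists b.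
have va0 : 0 < v a by rewrite absval_gt0.
have [k hk] : exists k : nat, v (b / a) = v a ^+ k.
  apply: (IH (j - j0)%N); first by rewrite ltn_subrL j00 jgt0.
  - by rewrite mulf_neq0 ?invr_eq0.
  - rewrite absvalM absvalV ler_pdivrMr// mul1r.
    rewrite -(ler_pXn2r N0) ?nnegrE ?absval_ge0//.
    by rewrite va vj ler_iXn2l.
  - rewrite absvalM absvalV exprMn exprVn va vj.
    apply: (mulIf (lt0r_neq0 (exprn_gt0 j0 p0))).
    by rewrite mulfVK ?lt0r_neq0 ?exprn_gt0// -exprD subnK.
exists k.+1; rewrite exprSr -hk absvalM absvalV mulfVK//.
by rewrite absval_eq0b.
Qed.

Lemma uniformizer_max v a b : is_uniformizer v a -> v b < 1 -> v b <= v a.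
Proof.
move=> [a0 va h] vb; have [->|b0] := eqVneq b 0; first by rewrite absval0 absval_ge0.
have [[|j] vbE] := h b b0 (ltW vb).
  by move: vb; rewrite vbE expr0 ltxx.
by rewrite vbE exprS ler_piMr ?absval_ge0// exprn_ile1 ?absval_ge0// ltW.
Qed.

(* Approximate at all the places over the rational primes involved, then clear
   the remaining denominators with an integer prime to those primes. *)
Lemma integral_separation v (Z : set (place R K)) (e : place R K -> R) : ultra v ->
  finite_set Z -> (forall w, Z w -> ultra w) -> ~ Z v -> (forall w, Z w -> 0 < e w) ->
  exists a : K, [/\ v a = 1, forall w, Z w -> w a < e w
    & forall w, ultra w -> w a <= 1].
Proof.
move=> uv finZ uZ Zv e0.
have /choice[pr prP] : forall w, exists p, ultra w -> prime p /\ w p%:R < 1.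
  move=> w; have [uw|nuw] := pselect (ultra w); last by exists 0%N.
  by have [p pp wp] := ultra_prime uw; exists p.
have finZv : finite_set (v |` Z) by rewrite finite_setU; split.
have [s sE] := (finite_seqP _).1 finZv.
have sP w : w \in s -> ultra w.
  move=> ws; have : (v |` Z) w by rewrite sE.
  by move=> [->|/uZ].
pose M := \prod_(w <- s) pr w.
have M0 : (0 < M)%N.
  by rewrite /M big_seq prodn_cond_gt0// => w /sP/prP[/prime_gt0].
have finM : finite_set [set w : place R K | ultra w /\ w M%:R != 1].
  by apply: finite_places_nonunit; rewrite natr_eq0_ext -lt0n.
have ZM w : (v |` Z) w -> ultra w /\ w M%:R != 1.
  rewrite sE => ws; have uw := sP w ws; have [pp wp] := prP w uw; split=> //.
  rewrite lt_eqF// /M (big_rem w)//= natrM absvalM (le_lt_trans _ wp)//.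
  by rewrite ler_piMr ?absval_ge0// ultra_nat.
pose d w := if `[< Z w >] then Num.min (e w) 1 else 1.
have d0 w : 0 < d w.
  by rewrite /d; case: asboolP => [/e0|_]; rewrite ?lt_min ltr01// andbT.
have d1 w : d w <= 1 by rewrite /d; case: asboolP => _; rewrite ?ge_min lexx ?orbT.
have [a0 ha0] := @weak_approximation R K _ unit
  (fun w _ => (w == v)%:R) d finM (fun w _ => d0 w).
set a := a0 tt in ha0.
have va : v a = 1.
  rewrite -(absval1 v); apply: (ultra_close uv); rewrite absval1.
  have := ha0 v (ZM v (or_introl erefl)) tt; rewrite eqxx => /lt_le_trans; apply.
  exact: d1.
have aM w : ultra w -> w M%:R != 1 -> w a <= 1.
  move=> uw wM; have [->|wv] := eqVneq w v; first by rewrite va.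
  have := ha0 w (conj uw wM) tt; rewrite (negPf wv) subr0 => /ltW /le_trans; apply.
  exact: d1.
have [D D0 hD] := exists_integral_multiple a.
(* Over the primes of [M], [a] is already integral and [D2] is a unit; elsewhere [D1] is a unit, so
   [D2 * a] is as integral as [D * a]. *)
pose D1 := (D`_\pi(M))%N; pose D2 := (D`_\pi(M)^')%N.
have DE : D = (D1 * D2)%N by rewrite partnC.
have D2M w : ultra w -> w M%:R != 1 -> w D2%:R = 1.
  move=> uw wM; apply/le_anti; rewrite ultra_nat//= leNgt; apply/negP => wD.
  have [p pD wp] := ultra_nat_lt1 uw (part_gt0 _ _) wD.
  have [q qM wq] : exists2 q, q \in primes M & w q%:R < 1.
    by apply: ultra_nat_lt1 => //; rewrite lt_neqAle wM ultra_nat.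
  have pp : prime p by move: pD; rewrite mem_primes => /and3P[].
  have pq : prime q by move: qM; rewrite mem_primes => /and3P[].
  have pqE := ultra_prime_coprime uw pp pq wp wq.
  by move: pD; rewrite primes_part mem_filter !inE pqE qM.
have D1M w : ultra w -> w M%:R = 1 -> w D1%:R = 1.
  move=> uw wM; apply/le_anti; rewrite ultra_nat//= leNgt; apply/negP => wD.
  have [p pD wp] := ultra_nat_lt1 uw (part_gt0 _ _) wD.
  move: pD; rewrite primes_part mem_filter inE => /andP[].
  rewrite mem_primes => /and3P[_ _ /dvdnP[k kE]] _.
  have : w M%:R < 1.
    rewrite kE natrM absvalM (le_lt_trans _ wp)//.
    by rewrite ler_piMl ?absval_ge0// ultra_nat.
  by rewrite wM ltxx.
exists (D2%:R * a); split.
- rewrite absvalM va mulr1; apply: D2M => //.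
  exact: (ZM v (or_introl erefl)).2.
- move=> w Zw; rewrite absvalM.
  have vw : v != w by apply: contra_notN Zv => /eqP ->.
  have [uw wM] := ZM w (or_intror Zw).
  rewrite D2M// mul1r.
  have := ha0 w (conj uw wM) tt; rewrite eq_sym (negPf vw) subr0 => /lt_le_trans; apply.
  by rewrite /d asboolT// ge_min lexx.
- move=> w uw; have [wM|wM] := eqVneq (w M%:R) 1.
    by have := hD w uw; rewrite DE natrM !absvalM D1M// mul1r.
  by rewrite absvalM D2M// mul1r aM.
Qed.

End NumberField.

(** * Quadratic forms and their contents *)

Section VectorNorm.
Context {R : realType} {L : fieldType} (w : absval R L) {n : nat}.
Implicit Types x y : 'rV[L]_n.+1.

Definition vnorm x : R := \big[Num.max/0]_(i < n.+1) w (x 0 i).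

Lemma le_vnorm x i : w (x 0 i) <= vnorm x.
Proof. exact: le_bigmax. Qed.

Lemma vnorm_ge0 x : 0 <= vnorm x.
Proof. exact: bigmax_ge_id. Qed.

Lemma vnorm_le x (e : R) : 0 <= e -> (forall i, w (x 0 i) <= e) -> vnorm x <= e.
Proof. by move=> e0 h; apply/bigmax_leP; split. Qed.

Lemma vnorm_ex x : exists i, vnorm x = w (x 0 i).
Proof.
have [i _ hi] := @Order.TotalTheory.arg_maxP _ _ _ (ord0 : 'I_n.+1) xpredT
  (fun i => w (x 0 i)) isT.
exists i; apply/le_anti; rewrite le_vnorm andbT.
by apply: vnorm_le => [|j]; [exact: absval_ge0|exact: hi].
Qed.

Lemma vnorm_gt0 x : (0 < vnorm x) = (x != 0).
Proof.
have [->|x0] := eqVneq x 0.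
  by have [i ->] := vnorm_ex 0; rewrite mxE absval0 ltxx.
have [i xi] : exists i, x 0 i != 0.
  apply: contrapT => /forallNP h; move/eqP: x0; apply; apply/rowP => i.
  by have := h i; rewrite mxE => /negP; rewrite negbK => /eqP.
by rewrite (lt_le_trans _ (le_vnorm x i))// absval_gt0.
Qed.

Lemma vnormZ a x : vnorm (a *: x) = w a * vnorm x.
Proof.
apply/le_anti/andP; split.
  apply: vnorm_le => [|i]; first by rewrite mulr_ge0 ?absval_ge0 ?vnorm_ge0.
  by rewrite mxE absvalM ler_wpM2l ?absval_ge0 ?le_vnorm.
by have [i ->] := vnorm_ex x; rewrite -absvalM (le_trans _ (le_vnorm _ i))// mxE.
Qed.

Lemma vnorm_close x y : ultra w -> (forall i, w (x 0 i - y 0 i) < vnorm y) ->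
  vnorm x = vnorm y.
Proof.
move=> uw h; apply/le_anti/andP; split.
  apply: vnorm_le => [|i]; first exact: vnorm_ge0.
  by rewrite -(subrK (y 0 i) (x 0 i)) ultraD_le ?le_vnorm// ltW.
have [i yi] := vnorm_ex y.
have := h i; rewrite yi => /(ultra_close uw) <-; exact: le_vnorm.
Qed.

End VectorNorm.

Lemma vnorm_map (R : realType) (K L : fieldType) (v : absval R K) (w : absval R L)
    (f : {rmorphism K -> L}) n (x : 'rV[K]_n.+1) :
  (forall a, w (f a) = v a) -> vnorm w (map_mx f x) = vnorm v x.
Proof. by move=> wf; apply: eq_bigr => i _; rewrite mxE wf. Qed.

Section QuadraticForm.
Context {K : fieldType} {n : nat} (F : {mpoly K[n.+1]}).
Hypothesis Fhom : F \is 2.-homog.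

Definition qcoef (p : 'I_n.+1 * 'I_n.+1) : K := F@_(U_(p.1) + U_(p.2)).

(** The sum runs over ordered pairs of indices instead of using a symmetric matrix, which avoids a
    division by 2 and keeps the bounds by the content valid above 2. *)
Definition qform (L : fieldType) (f : {rmorphism K -> L}) (x : 'rV[L]_n.+1) : L :=
  \sum_(p : 'I_n.+1 * 'I_n.+1 | (p.1 <= p.2)%N) f (qcoef p) * (x 0 p.1 * x 0 p.2).

Definition qpolar (L : fieldType) (f : {rmorphism K -> L}) (x y : 'rV[L]_n.+1) : L :=
  \sum_(p : 'I_n.+1 * 'I_n.+1 | (p.1 <= p.2)%N)
    f (qcoef p) * (x 0 p.1 * y 0 p.2 + y 0 p.1 * x 0 p.2).

Lemma mnm_U2_inj (i j a b : 'I_n.+1) : (i <= j)%N -> (a <= b)%N ->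
  (U_(i) + U_(j) = U_(a) + U_(b))%MM -> i = a /\ j = b.
Proof.
move=> ij ab e.
have ek (k : 'I_n.+1) : ((i == k) + (j == k) = (a == k) + (b == k))%N.
  by have := congr1 (fun m : 'X_{1..n.+1} => m k) e; rewrite !mnmDE !mnm1E.
have [ia|ia] := eqVneq i a.
  split=> //; have := ek j; rewrite -ia eqxx => /addnI.
  by case: eqVneq.
have := ek a; rewrite (negPf ia) eqxx add0n; case: eqVneq => // ja.
have := ek i; rewrite eqxx ja (eq_sym a i) (negPf ia) addn0 add0n.
case: (eqVneq b i) => // bi _ _.
by move: ia; rewrite -val_eqE eqn_leq -ja ij /= -bi ja ab.
Qed.

Lemma quadratic_expand : F = \sum_(p : 'I_n.+1 * 'I_n.+1 | (p.1 <= p.2)%N)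
  qcoef p *: ('X_p.1 * 'X_p.2).
Proof.
apply/mpolyP => m; rewrite raddf_sum/=.
under eq_bigr => p _ do rewrite mcoeffZ -mpolyXD mcoeffX.
have [[p [pp pm]]|np] := pselect (exists p : 'I_n.+1 * 'I_n.+1,
    (p.1 <= p.2)%N /\ (U_(p.1) + U_(p.2))%MM = m).
  rewrite (bigD1 p)//= pm eqxx mulr1 big1 ?addr0 ?/qcoef ?pm// => q /andP[qq qp].
  case: eqP => [qm|]; last by rewrite mulr0.
  have [q1 q2] := mnm_U2_inj qq pp (etrans qm (esym pm)).
  by move: qp; rewrite -pair_eqE /pair_eq q1 q2 !eqxx.
rewrite big1 => [|p pp]; last first.
  by case: eqP => [pm|]; [exfalso; apply: np; exists p|rewrite mulr0].
apply: (dhomog_nemf_coeff Fhom); apply/negP => /eqP /= m2; apply: np.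
have [a ma] : exists a, (0 < m a)%N.
  apply: contrapT => /forallNP h; move: m2; rewrite mdegE big1// => i _.
  by apply/eqP; rewrite -leqn0 leqNgt; apply/negP.
have Um : (U_(a) <= m)%MM.
  by apply/mnm_lepP => i; rewrite mnm1E; case: eqVneq => [<-|].
have mE : m = (m - U_(a) + U_(a))%MM by rewrite submK.
have /mdeg1P[b /eqP mb] : mdeg (m - U_(a))%MM == 1%N.
  by move: m2; rewrite {1}mE mdegD mdeg1 addn1 => -[->].
have [ab|ba] := leqP a b.
  by exists (a, b); split => //=; rewrite addmC -mb -mE.
by exists (b, a); split => /=; [exact: ltnW|rewrite -mb -mE].
Qed.

Lemma mmap_qform (L : fieldType) (f : {rmorphism K -> L}) (x : 'rV[L]_n.+1) :
  mmap f (fun i => x 0 i) F = qform f x.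
Proof.
rewrite {1}quadratic_expand raddf_sum/=; apply: eq_bigr => p _.
by rewrite mmapZ rmorphM/= !mmapX !mmap1U.
Qed.

Lemma mmap_mderiv_qform (L : fieldType) (f : {rmorphism K -> L}) (x : 'rV[L]_n.+1) i :
  mmap f (fun i => x 0 i) F^`M(i) = qpolar f x (delta_mx 0 i).
Proof.
rewrite {1}quadratic_expand linear_sum raddf_sum /qpolar.
apply: eq_bigr => p _.
pose e : 'rV[L]_n.+1 := delta_mx 0 i.
change (mmap f (fun i => x 0 i) ((qcoef p *: ('X_p.1 * 'X_p.2))^`M(i)) =
  f (qcoef p) * (x 0 p.1 * e 0 p.2 + e 0 p.1 * x 0 p.2)).
rewrite mderivZ mmapZ mderivM !mderivX !rmorphD/= !rmorphM/= !mmapZ !mmapX.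
rewrite !mnm1E !mxE !mmap1U !eqxx/=.
have h (j : 'I_n.+1) : f (j == i)%:R * mmap1 (fun k => x 0 k) (U_(j) - U_(i)) = (j == i)%:R.
  rewrite rmorph_nat; case: eqVneq => [->|]; last by rewrite mul0r.
  by rewrite mul1r (_ : (_ - _)%MM = 0%MM) ?mmap11//; apply/mnmP => k; rewrite mnmBE subnn mnm0E.
by rewrite !h addrC mulrC.
Qed.

Lemma qform_map (L : fieldType) (f : {rmorphism K -> L}) (x : 'rV[K]_n.+1) :
  qform f (map_mx f x) = f (qform idfun x).
Proof.
by rewrite /qform rmorph_sum; apply: eq_bigr => p _; rewrite !mxE !rmorphM.
Qed.

Section Bilinear.
Context {L : fieldType} (f : {rmorphism K -> L}).
Implicit Types x y z : 'rV[L]_n.+1.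

Lemma qformZ a x : qform f (a *: x) = a ^+ 2 * qform f x.
Proof.
by rewrite /qform mulr_sumr; apply: eq_bigr => p _; rewrite !mxE; ring.
Qed.

Lemma qformD x y : qform f (x + y) = qform f x + qpolar f x y + qform f y.
Proof.
rewrite /qform /qpolar -!big_split; apply: eq_bigr => p _; rewrite !mxE/=; ring.
Qed.

Lemma qpolarC x y : qpolar f x y = qpolar f y x.
Proof. by apply: eq_bigr => p _; ring. Qed.

Lemma qpolarZr a x y : qpolar f x (a *: y) = a * qpolar f x y.
Proof.
by rewrite /qpolar mulr_sumr; apply: eq_bigr => p _; rewrite !mxE; ring.
Qed.

Lemma qpolarDr x y z : qpolar f x (y + z) = qpolar f x y + qpolar f x z.
Proof.
by rewrite /qpolar -big_split; apply: eq_bigr => p _; rewrite !mxE/=; ring.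
Qed.

Lemma qpolarxx x : qpolar f x x = 2 * qform f x.
Proof.
by rewrite /qpolar /qform mulr_sumr; apply: eq_bigr => p _; ring.
Qed.

Lemma qform_comb s t x y :
  qform f (s *: x + t *: y) =
  s ^+ 2 * qform f x + s * t * qpolar f x y + t ^+ 2 * qform f y.
Proof. by rewrite qformD !qformZ qpolarZr qpolarC qpolarZr qpolarC; ring. Qed.

Lemma qform_delta i : qform f (delta_mx 0 i) = f (qcoef (i, i)).
Proof.
rewrite /qform (bigD1 (i, i))//= !mxE !eqxx/= !mulr1 big1 ?addr0// => p /andP[_].
rewrite -pair_eqE /pair_eq negb_and !mxE/=.
by case/orP => /negPf ->; rewrite ?mulr0 ?mul0r ?mulr0.
Qed.

Lemma qpolar_delta (i j : 'I_n.+1) : (i < j)%N ->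
  qpolar f (delta_mx 0 i) (delta_mx 0 j) = f (qcoef (i, j)).
Proof.
move=> ij; have nij : j != i by rewrite -val_eqE gtn_eqF.
rewrite /qpolar (bigD1 (i, j)) ?(ltnW ij)//= !mxE !eqxx/= eq_sym (negPf nij) /=.
rewrite mul0r addr0 !mulr1 big1 ?addr0// => -[a b] /andP[/= ab].
rewrite -pair_eqE /pair_eq/= !mxE/=.
have [->|ai] := eqVneq a i; have [->|bj] := eqVneq b j; rewrite /= ?mul0r ?mulr0 ?add0r//.
- by rewrite eq_sym (negPf nij) mul0r mulr0.
- by rewrite (negPf nij) !mulr0.
have [aj|] := eqVneq a j; have [bi|] := eqVneq b i; rewrite ?mul0r ?mulr0//.
by move: ab; rewrite aj bi leqNgt ij.
Qed.

End Bilinear.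

End QuadraticForm.

(** * Contents of polynomials and Gauss's lemma *)

Section Content.
Context {R : realType} {K : fieldType} {n : nat} (v : absval R K) (F : {mpoly K[n]}).

(** A coefficient of largest value rather than that value, so that one can divide by it in [K]. It
    depends on [v]. *)
Definition content : K := F@_(xget 0%MM [set m | forall m', v F@_m' <= v F@_m]).

Lemma le_content m : v F@_m <= v content.
Proof.
suff [m0 hm0] : exists m0, forall m', v F@_m' <= v F@_m0.
  by rewrite /content; case: xgetP => [? ->//|/(_ m0)].
have [->|F0] := eqVneq F 0.
  by exists 0%MM => m'; rewrite !mcoeff0.
have s0 : (0 < size (msupp F))%N by rewrite lt0n size_eq0 msupp_eq0.
have [i _ hi] := @Order.TotalTheory.arg_maxP _ _ _ (Ordinal s0) xpredT
  (fun i => v F@_(nth 0%MM (msupp F) i)) isT.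
exists (nth 0%MM (msupp F) i) => m'.
have [m'F|] := boolP (m' \in msupp F); last first.
  by move=> /memN_msupp_eq0 ->; rewrite absval0 absval_ge0.
have im : (index m' (msupp F) < size (msupp F))%N by rewrite index_mem.
by have := hi (Ordinal im) isT; rewrite /= nth_index.
Qed.

Lemma content_ex : exists m, content = F@_m.
Proof. by eexists; reflexivity. Qed.

Lemma content_neq0 : F != 0 -> content != 0.
Proof.
move=> F0; rewrite -(absval_gt0 v) (lt_le_trans _ (le_content (mlead F)))//.
by rewrite absval_gt0 mleadc_eq0.
Qed.

End Content.

Section Gauss.
Context {R : realType} {K : fieldType} {n : nat} (v : absval R K).
Hypothesis uv : ultra v.
Implicit Types (G H : {mpoly K[n]}).

Lemma mcoeffM_lt G H (a b : R) m : 0 < a -> 0 < b ->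
  (forall k, v G@_k <= a) -> (forall k, v H@_k < b) -> v (G * H)@_m < a * b.
Proof.
move=> a0 b0 Ga Hb; rewrite mcoeffM; apply: ultra_sum_lt => //; first exact: mulr_gt0.
move=> k _; rewrite absvalM (le_lt_trans (y := a * v H@_k.2))//.
  by rewrite ler_wpM2r ?absval_ge0.
by rewrite ltr_pM2l.
Qed.

(** A lift of the reduction of [G / content v G] to the residue field, up to the factor
    [content v G]. *)
Definition top_part G : {mpoly K[n]} :=
  \sum_(m <- msupp G | v G@_m == v (content v G)) G@_m *: 'X_[m].

Lemma mcoeff_top_part G m :
  (top_part G)@_m = if v G@_m == v (content v G) then G@_m else 0.
Proof.
rewrite /top_part raddf_sum/=; under eq_bigr do rewrite mcoeffZ mcoeffX.
have [mG|mG] := boolP (m \in msupp G); last first.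
  rewrite (memN_msupp_eq0 mG) if_same big_seq_cond big1// => k /andP[kG _].
  by case: eqP => [km|]; rewrite ?mulr0//; rewrite -km kG in mG.
rewrite big_mkcond (bigD1_seq m) ?msupp_uniq//= eqxx mulr1 big1 ?addr0// => k km.
by rewrite (negPf km) mulr0 if_same.
Qed.

Lemma top_part_neq0 G : G != 0 -> top_part G != 0.
Proof.
move=> G0; have [m cm] := content_ex v G; apply/eqP => /(congr1 (mcoeff m)).
rewrite mcoeff_top_part -cm eqxx mcoeff0 => /eqP; apply/negP.
exact: content_neq0.
Qed.

Lemma absval_top_part G m : (top_part G)@_m != 0 ->
  v (top_part G)@_m = v (content v G).
Proof. by rewrite mcoeff_top_part; case: ifP => [/eqP//|_]; rewrite eqxx. Qed.

Lemma absval_low_part G m : G != 0 -> v (G - top_part G)@_m < v (content v G).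
Proof.
move=> G0; rewrite mcoeffB mcoeff_top_part; case: ifPn => [_|h].
  by rewrite subrr absval0 absval_gt0 content_neq0.
by rewrite subr0 lt_neqAle h le_content.
Qed.

(** The leading terms of the two top parts multiply without cancellation, and everything discarded
    from [G] and [H] contributes strictly less to that coefficient. *)
Lemma gauss_content G H : G != 0 -> H != 0 ->
  exists m, v (G * H)@_m = v (content v G) * v (content v H).
Proof.
move=> G0 H0; set g := content v G; set h := content v H.
have g0 : 0 < v g by rewrite absval_gt0 content_neq0.
have h0 : 0 < v h by rewrite absval_gt0 content_neq0.
pose G1 := top_part G; pose H1 := top_part H.
have G1le k : v G1@_k <= v g.
  have [->|/absval_top_part ->//] := eqVneq G1@_k 0.
  by rewrite absval0 ltW.
exists (mlead G1 + mlead H1)%MM; rewrite -absvalM.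
have -> : v (g * h) = v (G1 * H1)@_(mlead G1 + mlead H1).
  rewrite mleadcM !absvalM !absval_top_part// mleadc_eq0; exact: top_part_neq0.
have e1 : v (G1 * H1)@_(mlead G1 + mlead H1) = v g * v h.
  rewrite mleadcM !absvalM !absval_top_part// mleadc_eq0; exact: top_part_neq0.
apply: (ultra_close uv); rewrite e1.
have -> : (G * H)@_(mlead G1 + mlead H1) - (G1 * H1)@_(mlead G1 + mlead H1) =
   (G1 * (H - H1))@_(mlead G1 + mlead H1) + (H * (G - G1))@_(mlead G1 + mlead H1).
  by rewrite -mcoeffB -mcoeffD; congr (mcoeff _ _); ring.
apply: (ultraD_lt uv).
  by apply: mcoeffM_lt => // k; exact: absval_low_part.
rewrite [v g * _]mulrC; apply: mcoeffM_lt => // k; last exact: absval_low_part.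
exact: le_content.
Qed.

End Gauss.

Section UltraForm.
Context {R : realType} {K : fieldType} {n : nat} (F : {mpoly K[n.+1]}).
Hypothesis Fhom : F \is 2.-homog.
Context (v : absval R K).
Hypothesis uv : ultra v.

Section Bounds.
Context {L : fieldType} (w : absval R L) (f : {rmorphism K -> L}).
Hypothesis wf : forall a, w (f a) = v a.
Hypothesis uw : ultra w.

Lemma mmap_bound (H : {mpoly K[n.+1]}) (x : 'rV[L]_n.+1) : vnorm w x <= 1 ->
  w (mmap f (fun i => x 0 i) H) <= v (content v H).
Proof.
move=> x1; rewrite /mmap; apply: ultra_sum_le => //; first exact: absval_ge0.
move=> m _; rewrite absvalM wf -[leRHS]mulr1 ler_pM ?absval_ge0 ?le_content//.
rewrite /mmap1; elim/big_ind: _ => [|a b a1 b1|i _]; first by rewrite absval1.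
  by rewrite absvalM mulr_ile1 ?absval_ge0.
by rewrite absvalX exprn_ile1 ?absval_ge0// (le_trans (le_vnorm w x i)).
Qed.

Lemma qform_bound (x : 'rV[L]_n.+1) :
  w (qform F f x) <= v (content v F) * vnorm w x ^+ 2.
Proof.
apply: ultra_sum_le => //; first by rewrite mulr_ge0 ?absval_ge0 ?exprn_ge0 ?vnorm_ge0.
move=> p _; rewrite !absvalM wf ler_pM ?absval_ge0 ?le_content ?mulr_ge0 ?absval_ge0//.
by rewrite expr2 ler_pM ?absval_ge0 ?le_vnorm.
Qed.

Lemma qpolar_bound (x y : 'rV[L]_n.+1) :
  w (qpolar F f x y) <= v (content v F) * (vnorm w x * vnorm w y).
Proof.
apply: ultra_sum_le => //; first by rewrite !mulr_ge0 ?absval_ge0 ?vnorm_ge0.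
move=> p _; rewrite absvalM wf ler_pM ?absval_ge0 ?le_content//.
apply: (ultraD_le uw); rewrite absvalM; last rewrite mulrC;
  by rewrite ler_pM ?absval_ge0 ?le_vnorm.
Qed.

End Bounds.

(* A quadratic form over the residue field that vanishes at all the vectors e_i
   and e_i + e_j is zero. *)
Lemma exists_unit_vector : F != 0 -> exists x : 'rV[K]_n.+1,
  vnorm v x = 1 /\ v (qform F idfun x) = v (content v F).
Proof.
move=> F0; have c0 : 0 < v (content v F) by rewrite absval_gt0 content_neq0.
have delta1 i : vnorm v (delta_mx 0 i : 'rV[K]_n.+1) = 1.
  apply/le_anti/andP; split.
    by apply: vnorm_le => // j; rewrite mxE/= ultra_nat.
  by rewrite -(absval1 v) (le_trans _ (le_vnorm v _ i))// mxE !eqxx.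
have [[i hi]|ni] := pselect (exists i, v (qcoef F (i, i)) = v (content v F)).
  by exists (delta_mx 0 i); rewrite delta1 qform_delta.
have lti i : v (qcoef F (i, i)) < v (content v F).
  by rewrite lt_neqAle le_content andbT; apply/eqP => h; apply: ni; exists i.
have [i [j [ij hij]]] : exists i j : 'I_n.+1, (i < j)%N /\
    v (qcoef F (i, j)) = v (content v F).
  apply: contrapT => h.
  have [m cm] := content_ex v F.
  suff : v F@_m < v F@_m by rewrite ltxx.
  rewrite -{2}cm [in ltLHS](quadratic_expand Fhom) raddf_sum/=.
  apply: ultra_sum_lt => // -[i j] /= ij; rewrite mcoeffZ -mpolyXD mcoeffX absvalM.
  rewrite (le_lt_trans (y := v (qcoef F (i, j))))//.
    by rewrite ler_piMr ?absval_ge0// ultra_nat.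
  rewrite lt_neqAle le_content andbT; apply/eqP => e.
  move: ij; rewrite leq_eqVlt => /orP[/eqP/ord_inj ij|ij].
    by have := lti i; rewrite {2}ij e ltxx.
  by apply: h; exists i, j.
exists (delta_mx 0 i + delta_mx 0 j); split.
  apply/le_anti/andP; split.
    by apply: vnorm_le => // k; rewrite !mxE/= -natrD ultra_nat.
  rewrite -(absval1 v) (le_trans _ (le_vnorm v _ i))// !mxE !eqxx/=.
  by rewrite (_ : (i == j) = false) ?addr0// -val_eqE ltn_eqF.
rewrite -hij; apply: (ultra_close uv).
rewrite qformD qpolar_delta// !qform_delta/= hij.
rewrite (_ : _ - _ = qcoef F (i, i) + qcoef F (j, j)); last by ring.
exact: ultraD_lt.
Qed.

End UltraForm.

(** * Local intersection multiplicities *)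

Section ProjectivePoints.
Context {n : nat} {L : fieldType}.
Implicit Types x y : nonzero_vec n L.

Definition nzvec (x : 'rV[L]_n.+1) (x0 : x != 0) : nonzero_vec n L :=
  exist _ x (mem_set (x0 : [set y : 'rV[L]_n.+1 | y != 0] x)).

Lemma nonzero_vecP x : val x != 0.
Proof. exact: (set_valP x). Qed.

Lemma pi_proj_eq x y a : a != 0 -> val y = a *: val x ->
  \pi_(proj_space n L)%qT x = \pi_(proj_space n L)%qT y.
Proof. by move=> a0 e; apply/eqmodP/asboolP; exists a. Qed.

Lemma repr_pi_proj x : exists2 a, a != 0 &
  val (repr (\pi_(proj_space n L)%qT x)) = a *: val x.
Proof.
have : proportional x (repr (\pi_(proj_space n L)%qT x)).
  by apply/eqmodP; rewrite reprK.
by move=> /asboolP[a [a0 e]]; exists a.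
Qed.

Lemma pi_proj_inj x y : \pi_(proj_space n L)%qT x = \pi_(proj_space n L)%qT y ->
  exists2 a, a != 0 & val y = a *: val x.
Proof. by move=> /eqmodP/asboolP[a [a0 e]]; exists a. Qed.

End ProjectivePoints.

Lemma proj_map_pi (n : nat) (K L : fieldType) (f : {rmorphism K -> L})
    (x : nonzero_vec n K) :
  proj_map f (\pi_(proj_space n K)%qT x) = \pi_(proj_space n L)%qT (nonzero_map f x).
Proof.
have [a a0 e] := repr_pi_proj x.
apply/esym; apply: (@pi_proj_eq _ _ _ _ (f a)); first by rewrite fmorph_eq0.
by rewrite /= e map_mxZ.
Qed.

Lemma form_evalM (n : nat) (K L : fieldType) (f : {rmorphism K -> L})
    (G H : {mpoly K[n.+1]}) (x : nonzero_vec n L) :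
  form_eval f (G * H) x = form_eval f G x * form_eval f H x.
Proof. exact: rmorphM. Qed.

Lemma form_evalE (n : nat) (K L : fieldType) (f : {rmorphism K -> L})
    (F : {mpoly K[n.+1]}) (x : nonzero_vec n L) : F \is 2.-homog ->
  form_eval f F x = qform F f (val x).
Proof. by move=> Fh; exact: mmap_qform. Qed.

Section Local.
Context {R : realType} {K : fieldExtType rat}.
Context (Kv : forall v : place R K, completion v) (S : set (place R K)).
Hypothesis S_nonarch : forall v, ~ S v -> ultra v.
Context {n : nat} (F : {mpoly K[n.+1]}) (m : nat).
Hypothesis Fhom : F \is 2.-homog.
Hypothesis F0 : F != 0.
Implicit Types v w : place R K.

(* Sealed, so that simplification does not expose [cabs]. *)
Fact cval_subproof v : {w : absval R (cfield (Kv v)) | forall x, cabs x = w x}.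
Proof.
have h0 (x : cfield (Kv v)) : 0 <= cabs x by exact: absval_ge0.
have h1 (x : cfield (Kv v)) : cabs x = 0 <-> x = 0 by exact: absval_eq0.
have h2 (x y : cfield (Kv v)) : cabs (x * y) = cabs x * cabs y by exact: absvalM.
have h3 (x y : cfield (Kv v)) : cabs (x + y) <= cabs x + cabs y by exact: absvalD.
by exists (AbsVal h0 h1 h2 h3).
Qed.

Definition cval v : absval R (cfield (Kv v)) := sval (cval_subproof v).

Lemma cabsE v (x : cfield (Kv v)) : cabs x = cval v x.
Proof. exact: svalP (cval_subproof v) x. Qed.

Lemma valuation_ringP v x : valuation_ring Kv v x <-> cval v x <= 1.
Proof. by rewrite -cabsE. Qed.

Lemma cval_emb v a : cval v (cemb (Kv v) a) = v a.
Proof. by rewrite -cabsE; exact: completion_isometry. Qed.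

Lemma cval_dense v (x : cfield (Kv v)) (e : R) : 0 < e ->
  exists a, cval v (x - cemb (Kv v) a) < e.
Proof.
move=> e0; have := @completion_dense _ _ _ (Kv v) (interior (ball x e)).
case.
- by exists x; exact: nbhsx_ballx.
- exact: open_interior.
- move=> y [/interior_subset xy [a _ ay]]; exists a.
  by rewrite ballEmdist in xy; rewrite -cabsE [cemb _ _]ay; exact: xy.
Qed.

Lemma cval_ultra v : ultra v -> ultra (cval v).
Proof.
move=> uv x y; apply/ler_addgt0Pr => e e0.
have e3 : 0 < e / 3 by rewrite divr_gt0.
have [a xa] := cval_dense x e3; have [b yb] := cval_dense y e3.
have hx := absvalD (cval v) (cemb (Kv v) a - x) x.
have hy := absvalD (cval v) (cemb (Kv v) b - y) y.
rewrite subrK cval_emb absvalBC in hx; rewrite subrK cval_emb absvalBC in hy.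
have hab : v (a + b) <= Num.max (cval v x) (cval v y) + e / 3.
  rewrite (le_trans (uv a b))// ge_max (le_trans hx) ?(le_trans hy)//.
    by rewrite addrC lerD ?le_max ?lexx ?orbT// ltW.
  by rewrite addrC lerD ?le_max ?lexx ?orbT// ltW.
have -> : x + y = cemb (Kv v) (a + b) + (x - cemb (Kv v) a) + (y - cemb (Kv v) b).
  by rewrite rmorphD/=; ring.
rewrite (le_trans (absvalD _ _ _))// (le_trans (lerD (absvalD _ _ _) (lexx _)))//.
by rewrite cval_emb; lra.
Qed.

(** Completion does not enlarge the value group, so uniformizers can always be taken in [K]. *)
Lemma cval_group v (x : cfield (Kv v)) : ultra v -> x != 0 ->
  exists2 a, a != 0 & cval v x = v a.
Proof.
move=> uv x0; have wx : 0 < cval v x by rewrite absval_gt0.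
have [a xa] := cval_dense x wx; rewrite absvalBC in xa.
have xE := ultra_close (cval_ultra uv) xa; rewrite cval_emb in xE.
by exists a => //; rewrite -(absval_gt0 v) xE.
Qed.

Lemma uniformiser_emb v a : ultra v -> is_uniformizer v a ->
  uniformiser Kv (cemb (Kv v) a).
Proof.
move=> uv ua; have [a0 va _] := ua; have fa0 : cemb (Kv v) a != 0 by rewrite fmorph_eq0.
split=> //; apply/seteqP; split=> x /=.
  move=> x1; exists (x / cemb (Kv v) a); last by rewrite mulrC divfK.
  apply/valuation_ringP; rewrite absvalM absvalV cval_emb.
  rewrite ler_pdivrMr ?absval_gt0// mul1r.
  have [->|x0] := eqVneq x 0; first by rewrite absval0 absval_ge0.
  have [b b0 xb] := cval_group uv x0.
  by rewrite xb; apply: uniformizer_max ua _; rewrite -xb -cabsE.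
move=> [y /valuation_ringP y1 <-].
rewrite cabsE absvalM cval_emb (le_lt_trans _ va)// ler_piMr ?absval_ge0//.
Qed.

Lemma uniformiser_lt v (p : cfield (Kv v)) : uniformiser Kv p -> p != 0 /\ cval v p < 1.
Proof.
move=> [p0 e]; split=> //; rewrite -cabsE; have : [set p * a | a in valuation_ring Kv v] p.
  exists 1; last by rewrite mulr1.
  by apply/valuation_ringP; rewrite absval1.
by rewrite -e.
Qed.

(** The ideal of coefficients of [F] need not be principal, so [c] is adapted to the single place
    [v]. Dividing by [content v F] is right at [v] and at almost all other places; a numerator that
    is a unit at [v] and small at the remaining ones repairs those. *)
Lemma content_inverse v : ~ S v -> exists2 c : K, v (c * content v F) = 1 &
  forall w, ~ S w -> w (c * content w F) <= 1.
Proof.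
move=> Sv; have uv := S_nonarch Sv; have [m0 cm0] := content_ex v F.
set f0 := content v F in cm0 *.
have f00 : f0 != 0 by exact: content_neq0.
pose Z : set (place R K) := [set w | ~ S w /\ (w != v /\ w f0 != w (content w F))].
have finZ : finite_set Z.
  apply: (@sub_finite_set _ _ (\bigcup_(k in [set` msupp F])
    [set w : place R K | ultra w /\ w F@_k != 1])).
    move=> w [Sw [_ wf]]; have uw := S_nonarch Sw.
    apply: contrapT => h; move/eqP: wf; apply.
    have h1 k : F@_k != 0 -> w F@_k = 1.
      rewrite -mcoeff_msupp => kF; apply: contrapT => /eqP h2; apply: h.
      by exists k.
    have [k ck] := content_ex w F.
    have e1 : w (content w F) = 1 by rewrite ck h1// -ck content_neq0.
    have e2 : w f0 = 1 by rewrite cm0 h1// -cm0.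
    by rewrite e1 e2.
  apply: bigcup_finite; first exact: finite_seq.
  by move=> k /= kF; apply: finite_places_nonunit; rewrite -mcoeff_msupp.
have [a [va aZ a1]] := integral_separation (e := fun w => w f0 / w (content w F))
  uv finZ (fun w Zw => S_nonarch Zw.1) (ltac:(by move=> [_ [/eqP]]))
  (ltac:(by move=> w _; rewrite divr_gt0// absval_gt0// content_neq0)).
exists (a / f0); first by rewrite mulfVK.
move=> w Sw; rewrite -mulrA absvalM.
have [->|wv] := eqVneq w v; first by rewrite mulVf// va absval1 mulr1.
have [wf|wf] := eqVneq (w f0) (w (content w F)).
  by rewrite absvalM absvalV -wf mulVf ?mulr1 ?a1 ?absval_eq0b//; exact: S_nonarch.
have /ltW := aZ w (conj Sw (conj wv wf)).
rewrite absvalM absvalV ler_pdivlMr ?absval_gt0 ?content_neq0// => h.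
by rewrite mulrA mulrAC ler_pdivrMr ?absval_gt0// mul1r.
Qed.

(** The ideal of the closure becomes principal at [v]: Gauss's lemma bounds the cofactor [H] of any
    integral multiple [H * F] by the inverse of the content of [F], and the multiple [c *: F] from
    [content_inverse] attains this bound. *)
Lemma pullback_idealE v (x : nonzero_vec n (cfield (Kv v))) : ~ S v ->
  vnorm (cval v) (val x) <= 1 ->
  pullback_ideal Kv S F x = [set y | cval v y * v (content v F) <=
    cval v (qform F (cemb (Kv v)) (val x))].
Proof.
move=> Sv x1; have uv := S_nonarch Sv; have ucv := cval_ultra uv.
have c0 : 0 < v (content v F) by rewrite absval_gt0 content_neq0.
have FE : form_eval (cemb (Kv v)) F x = qform F (cemb (Kv v)) (val x).
  exact: form_evalE.
apply/seteqP; split=> y /=.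
  move=> [s hs ->]; rewrite -ler_pdivlMr//; rewrite big_seq; apply: (ultra_sum_le ucv).
    by rewrite divr_ge0 ?absval_ge0.
  move=> p /hs[/valuation_ringP p1 [_ Sp [H pE]]]; rewrite pE.
  rewrite absvalM (le_trans (ler_piMl (absval_ge0 _ _) p1))//.
  rewrite form_evalM absvalM FE ler_pdivlMr//.
  rewrite mulrAC ler_piMl ?absval_ge0//.
  have [->|H0] := eqVneq H 0; first by rewrite /form_eval mmap0 absval0 mul0r ler01.
  rewrite (le_trans (ler_wpM2r (ltW c0) (mmap_bound (v := v) (cval_emb v) ucv H x1)))//.
  by have [k <-] := gauss_content uv H0 F0; rewrite -pE; exact: Sp.
move=> yx; have [y0|y0] := eqVneq y 0.
  by exists [::] => //; rewrite big_nil.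
have [c cv cS] := content_inverse Sv.
have cc0 : cemb (Kv v) c != 0.
  rewrite fmorph_eq0; apply: contra_eq_neq cv => ->.
  by rewrite mul0r absval0 eq_sym oner_eq0.
have Q0 : qform F (cemb (Kv v)) (val x) != 0.
  rewrite -(absval_gt0 (cval v)) (lt_le_trans _ yx)// mulr_gt0// absval_gt0//.
pose b := y / (cemb (Kv v) c * qform F (cemb (Kv v)) (val x)).
exists [:: (b, c *: F)].
  move=> p; rewrite inE => /eqP ->/=; split.
    apply/valuation_ringP; rewrite /b absvalM absvalV absvalM cval_emb ler_pdivrMr ?mul1r;
      last first.
      by rewrite mulr_gt0 ?absval_gt0// -(fmorph_eq0 (cemb (Kv v))).
    rewrite -ler_pdivrMl ?absval_gt0 -?(fmorph_eq0 (cemb (Kv v)))//.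
    rewrite mulrC (_ : (v c)^-1 = v (content v F))//.
    apply: (mulfI (x := v c)); first by rewrite absval_eq0b -(fmorph_eq0 (cemb (Kv v))).
    by rewrite -absvalM cv divff// absval_eq0b -(fmorph_eq0 (cemb (Kv v))).
  split; [exists 2%N; exact: dhomogZ| |by exists c%:MP; rewrite mul_mpolyC].
  move=> mu w Sw; rewrite mcoeffZ absvalM (le_trans _ (cS w Sw))//.
  by rewrite absvalM ler_wpM2l ?absval_ge0 ?le_content.
rewrite big_cons big_nil addr0/= /form_eval mmapZ -/(form_eval _ F x) FE.
by rewrite /b divfK// mulf_neq0.
Qed.


(** The quotient of the value of the form by [v (content v F) * vnorm w x ^+ 2] is invariant under
    scaling and measures the multiplicity. The two alternatives are multiplicity 0 and multiplicity
    at least [m], the infinite one included. The field [L] may be [K] or a completion. *)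
Definition campana_at v (L : fieldType) (w : absval R L) (f : {rmorphism K -> L})
    (x : 'rV[L]_n.+1) : Prop :=
  exists2 a, is_uniformizer v a &
    w (qform F f x) = v (content v F) * vnorm w x ^+ 2 \/
    w (qform F f x) <= v (content v F) * vnorm w x ^+ 2 * v a ^+ m.

Lemma campana_at_map v x : campana_at v v idfun x ->
  campana_at v (cval v) (cemb (Kv v)) (map_mx (cemb (Kv v)) x).
Proof.
move=> [a ua h]; exists a => //; rewrite qform_map cval_emb.
by rewrite (vnorm_map _ (cval_emb v)).
Qed.

Lemma div_points_pi v (x : nonzero_vec n (cfield (Kv v))) :
  div_points Kv F v (\pi_(proj_space n (cfield (Kv v)))%qT x) <->
  qform F (cemb (Kv v)) (val x) = 0.
Proof.
rewrite /div_points/= /hypersurface_points/= form_evalE//.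
have [a a0 ->] := repr_pi_proj x; rewrite qformZ; split=> [/eqP|->]; last by rewrite mulr0.
by rewrite mulf_eq0 expf_eq0 (negPf a0) /= => /eqP.
Qed.

Lemma integral_coordinates_ex v (x : nonzero_vec n (cfield (Kv v))) :
  exists2 y, integral_coordinates Kv (\pi_(proj_space n (cfield (Kv v)))%qT x) y &
  exists2 a, a != 0 & val y = a *: val x /\ cval v a * vnorm (cval v) (val x) = 1.
Proof.
have [i xi] := vnorm_ex (cval v) (val x).
have x0 : 0 < vnorm (cval v) (val x) by rewrite vnorm_gt0 nonzero_vecP.
have xi0 : val x 0 i != 0 by rewrite -(absval_gt0 (cval v)) -xi.
have a0 : (val x 0 i)^-1 != 0 by rewrite invr_eq0.
have y0 : (val x 0 i)^-1 *: val x != 0.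
  by rewrite scaler_eq0 negb_or a0 nonzero_vecP.
exists (nzvec y0); last first.
  exists (val x 0 i)^-1 => //; split=> //.
  by rewrite absvalV -xi mulVf// gt_eqF.
split; first by apply/esym; apply: (@pi_proj_eq _ _ _ _ (val x 0 i)^-1).
  move=> j; rewrite cabsE /= mxE absvalM absvalV -xi.
  by rewrite ler_pdivrMl// mulr1 le_vnorm.
by exists i; rewrite cabsE /= mxE mulVf// absval1.
Qed.

Lemma integral_coordinates_norm v (x : nonzero_vec n (cfield (Kv v))) P :
  integral_coordinates Kv P x -> vnorm (cval v) (val x) = 1.
Proof.
move=> [_ h [i hi]]; apply/le_anti/andP; split.
  by apply: vnorm_le => // j; rewrite -cabsE.
by rewrite -hi cabsE le_vnorm.
Qed.

Lemma intersection_mult_intro v (x : nonzero_vec n (cfield (Kv v))) a k : ~ S v ->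
  is_uniformizer v a ->
  cval v (qform F (cemb (Kv v)) (val x)) =
    v (content v F) * vnorm (cval v) (val x) ^+ 2 * v a ^+ k ->
  intersection_mult Kv S F (\pi_(proj_space n (cfield (Kv v)))%qT x) (Some k).
Proof.
move=> Sv ua h; have uv := S_nonarch Sv; have [a0 _ _] := ua.
have c0 : 0 < v (content v F) by rewrite absval_gt0 content_neq0.
have x0 : 0 < vnorm (cval v) (val x) by rewrite vnorm_gt0 nonzero_vecP.
split.
  move=> /div_points_pi Q0; move/eqP: h; rewrite Q0 absval0 eq_sym.
  by rewrite !mulf_eq0 !expf_eq0 !gt_eqF ?andbF// absval_gt0.
have [y yx [b b0 [yE bx]]] := integral_coordinates_ex x.
exists y, (cemb (Kv v) a); split=> //; first exact: uniformiser_emb.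
have y1 := integral_coordinates_norm yx.
rewrite pullback_idealE ?y1//.
have -> : cval v (qform F (cemb (Kv v)) (val y)) = v (content v F) * v a ^+ k.
  rewrite yE qformZ absvalM absvalX h.
  transitivity ((cval v b * vnorm (cval v) (val x)) ^+ 2 * (v (content v F) * v a ^+ k)).
    by ring.
  by rewrite bx expr1n mul1r.
have ak0 : cemb (Kv v) a ^+ k != 0 by rewrite expf_neq0// fmorph_eq0.
apply/seteqP; split=> z /=.
  rewrite mulrC ler_pM2l// => hz; exists (z / cemb (Kv v) a ^+ k); last first.
    by rewrite mulrC divfK.
  apply/valuation_ringP; rewrite absvalM absvalV absvalX cval_emb.
  by rewrite ler_pdivrMr ?mul1r// exprn_gt0// absval_gt0.
move=> [z' /valuation_ringP z'1 <-]; rewrite absvalM absvalX cval_emb.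
by rewrite [leLHS]mulrC ler_pM2l// ler_piMr ?exprn_ge0// ?absval_ge0.
Qed.

Lemma intersection_mult_elim v (x : nonzero_vec n (cfield (Kv v))) k : ~ S v ->
  intersection_mult Kv S F (\pi_(proj_space n (cfield (Kv v)))%qT x) (Some k) ->
  exists p : cfield (Kv v), [/\ p != 0, cval v p < 1 &
  cval v (qform F (cemb (Kv v)) (val x)) =
    v (content v F) * vnorm (cval v) (val x) ^+ 2 * cval v p ^+ k].
Proof.
move=> Sv [_ [y [p [yx up yk]]]]; have [p0 p1] := uniformiser_lt up.
exists p; split=> //; have uv := S_nonarch Sv.
have y1 := integral_coordinates_norm yx; rewrite pullback_idealE ?y1// in yk.
have c0 : 0 < v (content v F) by rewrite absval_gt0 content_neq0.
have [yx' _ _] := yx.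
have [b b0 xE] := pi_proj_inj yx'.
rewrite xE qformZ vnormZ y1 mulr1 absvalM absvalX mulrC [RHS]mulrAC; congr (_ * _).
apply/le_anti/andP; split.
  have : [set p ^+ k * a | a in valuation_ring Kv v]
      (qform F (cemb (Kv v)) (val y) / cemb (Kv v) (content v F)).
    rewrite -yk/= absvalM absvalV cval_emb mulfVK//.
    by rewrite gt_eqF.
  move=> [z /valuation_ringP z1 /(congr1 (cval v))].
  rewrite absvalM absvalM absvalV cval_emb absvalX => e.
  by rewrite mulrC -ler_pdivrMr// -e ler_piMr ?exprn_ge0 ?absval_ge0.
have : [set p ^+ k * a | a in valuation_ring Kv v] (p ^+ k).
  exists 1; last by rewrite mulr1.
  by apply/valuation_ringP; rewrite absval1.
by rewrite -yk/= absvalX mulrC.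
Qed.

Lemma campana_local_intro v (x : nonzero_vec n (cfield (Kv v))) :
  (~ S v -> campana_at v (cval v) (cemb (Kv v)) (val x)) ->
  local_orbifold_points Kv S F m Campana v (\pi_(proj_space n (cfield (Kv v)))%qT x).
Proof.
move=> h; have [Sv|Sv] := pselect (S v); [by left|right].
have [a ua hx] := h Sv; have [a0 va aX] := ua; have uv := S_nonarch Sv.
have [/eqP Q0|Q0] := boolP (qform F (cemb (Kv v)) (val x) == 0).
  by exists None => //=; apply/div_points_pi.
have c0 : 0 < v (content v F) by rewrite absval_gt0 content_neq0.
have x0 : 0 < vnorm (cval v) (val x) by rewrite vnorm_gt0 nonzero_vecP.
have cx : 0 < v (content v F) * vnorm (cval v) (val x) ^+ 2.
  by rewrite mulr_gt0// exprn_gt0.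
have [i xi] := vnorm_ex (cval v) (val x).
(* [r] is the form normalised by its content and by a coordinate of largest value; the exponent of
   its value in terms of [v a] is the multiplicity. *)
pose r := qform F (cemb (Kv v)) (val x) / (cemb (Kv v) (content v F) * val x 0 i ^+ 2).
have wr : cval v r = cval v (qform F (cemb (Kv v)) (val x)) /
    (v (content v F) * vnorm (cval v) (val x) ^+ 2).
  by rewrite /r absvalM absvalV absvalM absvalX cval_emb xi.
have r0 : r != 0 by rewrite -(absval_gt0 (cval v)) wr divr_gt0 ?absval_gt0.
have [b b0 rb] := cval_group uv r0.
have [k bk] : exists k : nat, v b = v a ^+ k.
  apply: aX => //; rewrite -rb wr ler_pdivrMr// mul1r.
  exact: (qform_bound F (cval_emb v) (cval_ultra uv)).
have e : cval v (qform F (cemb (Kv v)) (val x)) =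
    v (content v F) * vnorm (cval v) (val x) ^+ 2 * v a ^+ k.
  by rewrite -bk -rb wr mulrC mulfVK// gt_eqF.
exists (Some k); first exact: intersection_mult_intro e.
have va0 : 0 < v a by rewrite absval_gt0.
case: hx; rewrite e.
  move=> /eqP; rewrite -[X in _ == X]mulr1 (inj_eq (mulfI (lt0r_neq0 cx))).
  rewrite -[X in _ == X](expr0 (v a)) => /eqP e'.
  by apply/orP; right; rewrite -leqn0 -(ler_iXn2l va0 va) e'.
by rewrite ler_pM2l// ler_iXn2l//= => ->.
Qed.

Lemma campana_local_elim v (x : nonzero_vec n (cfield (Kv v))) : ~ S v ->
  qform F (cemb (Kv v)) (val x) != 0 ->
  local_orbifold_points Kv S F m Campana v (\pi_(proj_space n (cfield (Kv v)))%qT x) ->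
  campana_at v (cval v) (cemb (Kv v)) (val x).
Proof.
move=> Sv Q0 []// [[k|] hk adm]; last by move: hk => /div_points_pi/eqP; rewrite (negPf Q0).
have [p [p0 p1 e]] := intersection_mult_elim Sv hk.
have uv := S_nonarch Sv; have [a ua] := exists_uniformizer uv; exists a => //.
rewrite e; move: adm => /= /orP[mk|/eqP ->]; last by left; rewrite expr0 mulr1.
right; rewrite ler_wpM2l ?mulr_ge0 ?absval_ge0 ?exprn_ge0 ?vnorm_ge0//.
have [b b0 pb] := cval_group uv p0; rewrite pb in p1 *.
have va1 : v a < 1 by case: ua.
rewrite (le_trans (y := v b ^+ m)) ?ler_wiXn2l ?absval_ge0 ?(ltW p1)//.
by rewrite lerXn2r ?nnegrE ?absval_ge0// uniformizer_max.
Qed.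

End Local.

(** * Quadratic algebras *)

(* The algebra [K[X] / (X^2 - b X + c)], an element [s + t X] being represented
   by the pair [(s, t)]; over a field extension splitting the polynomial, a form
   [F] on a plane is, up to a factor, the norm of this algebra. *)
Section QuadraticAlgebra.
Context {K : fieldType} (b c : K).
Implicit Types z w : K * K.

Definition qmul z w : K * K :=
  (z.1 * w.1 - c * (z.2 * w.2), z.1 * w.2 + z.2 * w.1 + b * (z.2 * w.2)).

Definition qpow z k : K * K := iter k (qmul z) (1, 0).

Definition qnorm z : K := z.1 ^+ 2 + b * (z.1 * z.2) + c * z.2 ^+ 2.

Definition qconj z : K * K := (z.1 + b * z.2, - z.2).

Lemma qmulC z w : qmul z w = qmul w z.
Proof. by congr pair; ring. Qed.

Lemma qmulA x z w : qmul x (qmul z w) = qmul (qmul x z) w.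
Proof. by congr pair; rewrite /qmul/=; ring. Qed.

Lemma qmul1l z : qmul (1, 0) z = z.
Proof. by case: z => s t; congr pair => /=; ring. Qed.

Lemma qpowD z j k : qpow z (j + k) = qmul (qpow z j) (qpow z k).
Proof. by elim: j => [|j IH]; rewrite ?qmul1l//= IH qmulA. Qed.

Lemma qpowM z j k : qpow z (j * k) = qpow (qpow z j) k.
Proof. by elim: k => [|k IH]; rewrite ?muln0// mulnS qpowD IH. Qed.

Lemma qnormM z w : qnorm (qmul z w) = qnorm z * qnorm w.
Proof. by rewrite /qnorm /qmul/=; ring. Qed.

Lemma qnormX z k : qnorm (qpow z k) = qnorm z ^+ k.
Proof.
elim: k => [|k IH]; last by rewrite /= qnormM IH exprS.
by rewrite /qnorm/= expr0; ring.
Qed.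

Lemma qnorm_conj z : qnorm (qconj z) = qnorm z.
Proof. by rewrite /qnorm /qconj/=; ring. Qed.

Lemma qmul_conj z w : qmul (qconj z) (qmul z w) = (qnorm z * w.1, qnorm z * w.2).
Proof. by congr pair; rewrite /qnorm /qmul /qconj/=; ring. Qed.

Lemma qpow_conj z k : qmul (qpow (qconj z) k) (qpow z k.+1) =
  (qnorm z ^+ k * z.1, qnorm z ^+ k * z.2).
Proof.
elim: k => [|k IH].
  by rewrite qmul1l /= qmulC qmul1l expr0 !mul1r; case: z.
have -> : qmul (qpow (qconj z) k.+1) (qpow z k.+2) =
   qmul (qconj z) (qmul z (qmul (qpow (qconj z) k) (qpow z k.+1))).
  rewrite [qpow _ k.+1 in LHS]/= [qpow _ k.+2]/= -/(qpow z k.+1).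
  by rewrite -[LHS]qmulA; congr qmul; rewrite qmulA (qmulC (qpow _ k)) -qmulA.
by rewrite IH qmul_conj/= exprS !mulrA.
Qed.

End QuadraticAlgebra.

Section QuadraticAlgebraUltra.
Context {R : realType} {K : fieldType} (v : absval R K) (b c : K).
Hypotheses (uv : ultra v) (b1 : v b <= 1) (c1 : v c <= 1)
  (disc1 : v (b ^+ 2 - 4 * c) = 1).
Implicit Types z w : K * K.

Definition qabs z : R := Num.max (v z.1) (v z.2).

Lemma qabs_ge0 z : 0 <= qabs z.
Proof. by rewrite le_max absval_ge0. Qed.

Lemma qabs_ge1 z : v z.1 <= qabs z.
Proof. by rewrite le_max lexx. Qed.

Lemma qabs_ge2 z : v z.2 <= qabs z.
Proof. by rewrite le_max lexx orbT. Qed.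

Lemma qabs_mul_le z w : qabs (qmul b c z w) <= qabs z * qabs w.
Proof.
have h (i j : R) : 0 <= i -> i <= qabs z -> 0 <= j -> j <= qabs w -> i * j <= qabs z * qabs w.
  by move=> *; exact: ler_pM.
have h1 (a : K) (r : R) : v a <= 1 -> 0 <= r -> r <= qabs z * qabs w -> v a * r <= qabs z * qabs
  w.
  by move=> a1 r0; apply: le_trans; rewrite ler_piMl.
have H11 : v (z.1 * w.1) <= qabs z * qabs w.
  by rewrite absvalM h ?absval_ge0 ?qabs_ge1.
have H12 : v (z.1 * w.2) <= qabs z * qabs w.
  by rewrite absvalM h ?absval_ge0 ?qabs_ge1 ?qabs_ge2.
have H21 : v (z.2 * w.1) <= qabs z * qabs w.
  by rewrite absvalM h ?absval_ge0 ?qabs_ge1 ?qabs_ge2.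
have H22 : v (z.2 * w.2) <= qabs z * qabs w.
  by rewrite absvalM h ?absval_ge0 ?qabs_ge2.
rewrite /qabs ge_max /=; apply/andP; split.
  by apply: (ultraB_le uv) => //; rewrite absvalM h1// absval_ge0.
apply: (ultraD_le uv); first exact: (ultraD_le uv).
by rewrite absvalM h1// absval_ge0.
Qed.

Lemma qnorm_le z : v (qnorm b c z) <= qabs z ^+ 2.
Proof.
have z11 : v (z.1 ^+ 2) <= qabs z ^+ 2.
  by rewrite absvalX lerXn2r ?nnegrE ?absval_ge0 ?qabs_ge0 ?qabs_ge1.
have z22 : v (z.2 ^+ 2) <= qabs z ^+ 2.
  by rewrite absvalX lerXn2r ?nnegrE ?absval_ge0 ?qabs_ge0 ?qabs_ge2.
have z12 : v (z.1 * z.2) <= qabs z ^+ 2.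
  by rewrite absvalM expr2 ler_pM ?absval_ge0 ?qabs_ge1 ?qabs_ge2.
apply: (ultraD_le uv); first apply: (ultraD_le uv) => //.
  by rewrite absvalM (le_trans _ z12)// ler_piMl ?absval_ge0.
by rewrite absvalM (le_trans _ z22)// ler_piMl ?absval_ge0.
Qed.

(* The reduced algebra is etale, hence without nilpotents: with
   [A + B X] the square of [s + t X], [disc t^4 = 2 b t^2 B - B^2 + 4 A t^2]. *)
Lemma qabs_sqr z : qabs (qmul b c z z) = qabs z ^+ 2.
Proof.
apply/le_anti; rewrite expr2 qabs_mul_le/= leNgt; apply/negP.
set r := qabs z; rewrite {1}/qabs gt_max => /andP[/=].
set s := z.1; set t := z.2; set A := _ - _; set B := _ + _ => hA hB.
have r20 : 0 < r * r by rewrite (le_lt_trans _ hA)// absval_ge0.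
have r0 : 0 < r by rewrite lt_neqAle qabs_ge0 andbT; apply: contraTneq r20 => <-;
  rewrite mul0r ltxx.
have sr : v s <= r by exact: qabs_ge1.
have tr : v t <= r by exact: qabs_ge2.
have t2r : v (t ^+ 2) <= r * r by rewrite absvalX expr2 ler_pM ?absval_ge0.
have bt2r : v (b * t ^+ 2) <= r * r.
  by rewrite absvalM (le_trans _ t2r)// ler_piMl ?absval_ge0.
have small (k x y : K) : v k <= 1 -> v x <= r * r -> v y < r * r -> v (k * (x * y)) < r * r * (r
  * r).
  move=> k1 hx hy; rewrite absvalM (le_lt_trans (ler_piMl (absval_ge0 _ _) k1))//.
  rewrite absvalM (le_lt_trans (y := r * r * v y))//.
    by rewrite ler_wpM2r ?absval_ge0.
  by rewrite ltr_pM2l.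
have e : (b ^+ 2 - 4 * c) * t ^+ 4 =
    2 * (b * t ^+ 2 * B) - 1 * (B * B) + 4 * (t ^+ 2 * A).
  by rewrite /A /B; ring.
have vt4 : v t ^+ 4 < r ^+ 4.
  rewrite -absvalX -[v _]mul1r -disc1 -absvalM e.
  have -> : r ^+ 4 = r * r * (r * r) by ring.
  apply: (ultraD_lt uv); last by apply: small; rewrite ?ultra_nat.
  apply: (ultraB_lt uv); apply: small; rewrite ?ultra_nat ?absval1//.
  exact: ltW.
have tlt : v t < r by rewrite -(@ltr_pXn2r _ 4) ?nnegrE ?absval_ge0 ?(ltW r0).
have slt : v s < r.
  have : v (s ^+ 2) < r ^+ 2.
    have -> : s ^+ 2 = A + c * (t * t) by rewrite /A; ring.
    apply: (ultraD_lt uv); first by rewrite expr2.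
    rewrite absvalM (le_lt_trans (ler_piMl (absval_ge0 _ _) c1))//.
    by rewrite absvalM expr2 ltr_pM ?absval_ge0.
  by rewrite absvalX ltr_pXn2r ?nnegrE ?absval_ge0 ?(ltW r0).
suff : r < r by rewrite ltxx.
by rewrite {1}/r /qabs gt_max slt tlt.
Qed.

Lemma qabs_pow_le z k : qabs (qpow b c z k) <= qabs z ^+ k.
Proof.
elim: k => [|k IH]; first by rewrite /qabs/= absval1 absval0 expr0 ge_max ler01 lexx.
by rewrite exprS (le_trans (qabs_mul_le _ _))// ler_wpM2l ?qabs_ge0.
Qed.

(** Repeated squaring gives equality for the exponent [2 ^ k]; since [k <= 2 ^ k] and [qabs] is
    submultiplicative, a strict inequality at [k] would persist there. *)
Lemma qabs_pow z k : qabs (qpow b c z k) = qabs z ^+ k.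
Proof.
apply/le_anti; rewrite qabs_pow_le/=.
have pow2 j : qabs (qpow b c z (2 ^ j)) = qabs z ^+ (2 ^ j).
  elim: j => [|j IH].
    by rewrite expn0 expr1 /= qmulC qmul1l.
  by rewrite expnSr qpowM /= [qmul _ _ _ (1, 0)]qmulC qmul1l qabs_sqr IH exprM.
have [z0|z0] := leP (qabs z) 0.
  have {}z0 : qabs z = 0 by apply/le_anti; rewrite z0 qabs_ge0.
  case: k => [|k]; last by rewrite z0 exprS mul0r qabs_ge0.
  by rewrite expr0 /qabs/= absval1 le_max lexx.
have k2 : (k <= 2 ^ k)%N by rewrite ltnW// ltn_expl.
have := pow2 k; rewrite -{1}(subnKC k2) qpowD => e.
have := qabs_mul_le (qpow b c z k) (qpow b c z (2 ^ k - k)); rewrite e.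
rewrite -{1}(subnKC k2) exprD => h.
rewrite -(ler_pM2r (exprn_gt0 (2 ^ k - k) z0)) (le_trans h)//.
by rewrite ler_wpM2l ?qabs_ge0// qabs_pow_le.
Qed.

(** The hypothesis says that [w] is a scalar times a unit of the reduced algebra. Multiplying
    [z * w] by the conjugate of [w] gives [qnorm b c w] times [z], which yields the missing lower
    bound. *)
Lemma qabs_mul_unit z w : v (qnorm b c w) = qabs w ^+ 2 ->
  qabs (qmul b c z w) = qabs z * qabs w.
Proof.
move=> hw; apply/le_anti; rewrite qabs_mul_le/=.
have [w0|w0] := leP (qabs w) 0.
  have {}w0 : qabs w = 0 by apply/le_anti; rewrite w0 qabs_ge0.
  by rewrite w0 mulr0 qabs_ge0.
have conjw : qabs (qconj b w) <= qabs w.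
  rewrite /qabs ge_max/= absvalN; apply/andP; split; last exact: qabs_ge2.
  apply: (ultraD_le uv); first exact: qabs_ge1.
  by rewrite absvalM (le_trans (ler_piMl (absval_ge0 _ _) b1))// qabs_ge2.
have h := qabs_mul_le (qconj b w) (qmul b c w z); rewrite qmul_conj in h.
have e : qabs (qnorm b c w * z.1, qnorm b c w * z.2) = qabs w ^+ 2 * qabs z.
  by rewrite /qabs/= !absvalM -maxr_pMr ?absval_ge0// hw.
rewrite e qmulC in h.
rewrite -(ler_pM2l w0) mulrCA mulrC -expr2 (le_trans h)//.
by rewrite ler_wpM2r ?qabs_ge0.
Qed.

Lemma qnorm_pow_unit z k : v (qnorm b c z) = qabs z ^+ 2 ->
  v (qnorm b c (qpow b c z k)) = qabs (qpow b c z k) ^+ 2.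
Proof. by move=> h; rewrite qnormX absvalX h qabs_pow -!exprM mulnC. Qed.

End QuadraticAlgebraUltra.

Section QuadraticAlgebraLimits.
Context {R : realType} {K : fieldType} (v : absval R K) (b c : K).

Definition qcvg (z : nat -> K * K) (l : K * K) :=
  acvg v (fun k => (z k).1) l.1 /\ acvg v (fun k => (z k).2) l.2.

Lemma qcvg_mul z l z' l' : qcvg z l -> qcvg z' l' ->
  qcvg (fun k => qmul b c (z k) (z' k)) (qmul b c l l').
Proof.
move=> [z1 z2] [z1' z2']; split=> /=; rewrite -?mulNr.
  apply: acvgD; first exact: acvgM.
  under [X in acvg _ X _]eq_fun do rewrite -mulNr.
  by apply: acvgM; [exact: acvg_cst|exact: acvgM].
apply: acvgD; first by apply: acvgD; exact: acvgM.
by apply: acvgM; [exact: acvg_cst|exact: acvgM].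
Qed.

Lemma qcvg_pow z l j : qcvg z l -> qcvg (fun k => qpow b c (z k) j) (qpow b c l j).
Proof.
move=> zl; elim: j => [|j IH]; last exact: qcvg_mul.
by split; exact: acvg_cst.
Qed.

Lemma acvg_qnorm z l : qcvg z l -> acvg v (fun k => qnorm b c (z k)) (qnorm b c l).
Proof.
move=> [z1 z2]; apply: acvgD; last first.
  by apply: acvgM; [exact: acvg_cst|exact: acvgX].
apply: acvgD; first exact: acvgX.
by apply: acvgM; [exact: acvg_cst|exact: acvgM].
Qed.

End QuadraticAlgebraLimits.

(** * Global Campana points *)

Section GlobalPoint.
Context {R : realType} {K : fieldExtType rat}.
Implicit Types (v w : place R K).

Lemma near_all_set (Z : set (place R K)) (P : place R K -> nat -> Prop) :
  finite_set Z -> (forall v, Z v -> \forall k \near \oo, P v k) ->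
  \forall k \near \oo, forall v, Z v -> P v k.
Proof.
move=> /finite_seqP[s ->] h; exact: near_all_seq.
Qed.

Lemma weak_approximation_seq (Z : set (place R K)) (I : finType)
    (x : place R K -> I -> K) : finite_set Z ->
  exists c : nat -> I -> K, forall v, Z v -> forall i, acvg v (fun k => c k i) (x v i).
Proof.
move=> finZ.
have /choice[c hc] : forall k : nat, exists a : I -> K, forall v, Z v -> forall i,
    v (a i - x v i) < k.+1%:R^-1.
  by move=> k; apply: weak_approximation => // v _; rewrite invr_gt0 ltr0n.
by exists c => v Zv i; apply: acvg_harmonic => k; exact: hc.
Qed.

Section Form.
Context {n : nat} (F : {mpoly K[n.+1]}).
Hypothesis Fhom : F \is 2.-homog.
Local Notation Q := (qform F idfun).
Local Notation B := (qpolar F idfun).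
Local Notation disc x y := (B x y ^+ 2 - 4 * (Q x * Q y)).

Lemma acvg_qform (L : fieldType) (w : absval R L) (f : {rmorphism K -> L})
    (c : nat -> 'rV[L]_n.+1) (l : 'rV[L]_n.+1) :
  (forall i, acvg w (fun k => c k 0 i) (l 0 i)) ->
  acvg w (fun k => qform F f (c k)) (qform F f l).
Proof.
move=> cl; apply: acvg_sum => p _; apply: acvgM; first exact: acvg_cst.
exact: acvgM.
Qed.

Lemma acvg_qpolar (L : fieldType) (w : absval R L) (f : {rmorphism K -> L}) x
    (c : nat -> 'rV[L]_n.+1) (l : 'rV[L]_n.+1) :
  (forall i, acvg w (fun k => c k 0 i) (l 0 i)) ->
  acvg w (fun k => qpolar F f x (c k)) (qpolar F f x l).
Proof.
move=> cl; apply: acvg_sum => p _; apply: acvgM; first exact: acvg_cst.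
by apply: acvgD; apply: acvgM => //; exact: acvg_cst.
Qed.

Lemma acvg_neq0 (L : fieldType) (w : absval R L) (c : nat -> L) l :
  l != 0 -> acvg w c l -> \forall k \near \oo, c k != 0.
Proof.
move=> l0 cl; have wl : 0 < w l by rewrite absval_gt0.
apply: filterS (acvg_lt cl wl) => k; apply: contraTneq => ->.
by rewrite sub0r absvalN ltxx.
Qed.

Lemma acvg_ultra_eq (L : fieldType) (w : absval R L) (c : nat -> L) l : ultra w ->
  l != 0 -> acvg w c l -> \forall k \near \oo, w (c k) = w l.
Proof.
move=> uw l0 cl; have wl : 0 < w l by rewrite absval_gt0.
by apply: filterS (acvg_lt cl wl) => k; exact: ultra_close.
Qed.

Lemma acvg_vnorm_eq (L : fieldType) (w : absval R L) (c : nat -> 'rV[L]_n.+1) (l : 'rV[L]_n.+1) :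
  ultra w -> l != 0 -> (forall i, acvg w (fun k => c k 0 i) (l 0 i)) ->
  \forall k \near \oo, vnorm w (c k) = vnorm w l.
Proof.
move=> uw l0 cl; have wl : 0 < vnorm w l by rewrite vnorm_gt0.
have : \forall k \near \oo, forall i, i \in enum 'I_n.+1 -> w (c k 0 i - l 0 i) < vnorm w l.
  by apply: near_all_seq => i _; exact: acvg_lt.
apply: filterS => k h; apply: vnorm_close => // i; apply: h; exact: mem_enum.
Qed.

Lemma qform_neq0 (L : fieldType) (f : {rmorphism K -> L}) x : qform F f x != 0 -> x != 0.
Proof.
by apply: contra_neq => ->; rewrite -(scale0r 0) qformZ expr0n mul0r.
Qed.

(* [F] being smooth, it is not proportional to the square of a linear form. *)
Lemma exists_disc_neq0 (x : 'rV[K]_n.+1) : (0 < n)%N ->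
  smooth_hypersurface F -> Q x != 0 -> exists y, disc x y != 0.
Proof.
move=> n0 Fs Qx; apply: contrapT => /forallNP h.
have QE y : 4 * (Q x * Q y) = B x y ^+ 2.
  by apply/esym/eqP; rewrite -subr_eq0; apply: contrapT => /negP; exact: h.
have four : (4 : K) != 0 by rewrite natr_eq0_ext.
(* As [0 < n], there are two distinct coordinate vectors, and some nonzero combination of them is
   orthogonal to [x]. *)
have [y y0 By] : exists2 y, y != 0 & B x y = 0.
  pose i1 : 'I_n.+1 := ord0; pose i2 : 'I_n.+1 := ord_max.
  have i12 : i1 != i2 by rewrite -val_eqE /= eq_sym -lt0n.
  pose d1 : 'rV[K]_n.+1 := delta_mx 0 i1; pose d2 : 'rV[K]_n.+1 := delta_mx 0 i2.
  have [B1|B1] := eqVneq (B x d1) 0.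
    exists d1 => //; apply/eqP => /rowP/(_ i1); rewrite !mxE !eqxx => /eqP.
    by rewrite oner_eq0.
  exists (B x d1 *: d2 + (- B x d2) *: d1); last first.
    by rewrite qpolarDr !qpolarZr; ring.
  apply/eqP => /rowP/(_ i2); rewrite !mxE !eqxx/= eq_sym (negPf i12) mulr0 addr0 mulr1.
  by move/eqP; rewrite (negPf B1).
have Qy : Q y = 0.
  by apply/eqP; have /eqP := QE y; rewrite By expr0n !mulf_eq0 (negPf four) (negPf Qx).
have := Fs K idfun (nzvec y0); rewrite form_evalE// Qy => /(_ erefl)[i].
rewrite /form_eval mmap_mderiv_qform//= => /eqP; apply.
(* Adding [y] to a basis vector leaves its product with [x] unchanged, so by [QE] it leaves [Q]
   unchanged; hence the partial derivative of [F] at the zero [y] vanishes. *)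
have := QE (y + delta_mx 0 i); rewrite qformD Qy add0r qpolarDr By add0r -QE.
move=> /(mulfI four)/(mulfI Qx) /eqP; rewrite -subr_eq0 addrK => /eqP.
by [].
Qed.

Lemma qform_comb_norm (x y : 'rV[K]_n.+1) (z : K * K) : Q x != 0 ->
  Q (z.1 *: x + z.2 *: y) = Q x * qnorm (B x y / Q x) (Q y / Q x) z.
Proof. by move=> Qx; rewrite qform_comb /qnorm; field. Qed.

(** At such a place [Q x] is a unit, so [b] and [c] are integral, and the unit discriminant makes
    the quadratic algebra etale over the residue field and the coordinates on the plane compatible
    with the integral structure. *)
Definition good_plane v (x y : 'rV[K]_n.+1) :=
  [/\ [/\ v (content v F) = 1, vnorm v x <= 1 & vnorm v y <= 1],
      v (Q x) = 1, v (B x y) <= 1, v (Q y) <= 1 & v (disc x y) = 1].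

Section GoodPlane.
Context (v : place R K) (x y : 'rV[K]_n.+1).
Hypotheses (uv : ultra v) (gxy : good_plane v x y).
Local Notation b := (B x y / Q x).
Local Notation c := (Q y / Q x).
Local Notation pt z := (z.1 *: x + z.2 *: y).

Lemma good_plane_Qx : Q x != 0.
Proof. by case: gxy => _ h _ _ _; rewrite -(absval_gt0 v) h ltr01. Qed.

Lemma good_plane_b : v b <= 1.
Proof. by case: gxy => _ h h' _ _; rewrite absvalM absvalV h invr1 mulr1. Qed.

Lemma good_plane_c : v c <= 1.
Proof. by case: gxy => _ h _ h' _; rewrite absvalM absvalV h invr1 mulr1. Qed.

Lemma good_plane_disc : v (b ^+ 2 - 4 * c) = 1.
Proof.
have -> : b ^+ 2 - 4 * c = disc x y / Q x ^+ 2.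
  by have := good_plane_Qx; move=> ?; field.
by case: gxy => _ h _ _ h'; rewrite absvalM h' absvalV absvalX h expr1n invr1 mulr1.
Qed.

(** The Gram matrix of [x] and [y] has determinant minus the discriminant, a unit. Cramer's rule
    therefore recovers [z] integrally from the products of [pt z] with [x] and [y]. *)
Lemma vnorm_good_plane z : vnorm v (pt z) = qabs v z.
Proof.
have [[c1 x1 y1] Qx Bxy Qy dxy] := gxy.
have id_iso a : v ((idfun : {rmorphism K -> K}) a) = v a by [].
apply/le_anti/andP; split.
  apply: vnorm_le => [|i]; first exact: qabs_ge0.
  rewrite !mxE; apply: (ultraD_le uv); rewrite absvalM.
    rewrite (le_trans _ (qabs_ge1 v z))// ler_piMr ?absval_ge0//.
    exact: le_trans (le_vnorm v x i) x1.
  rewrite (le_trans _ (qabs_ge2 v z))// ler_piMr ?absval_ge0//.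
  exact: le_trans (le_vnorm v y i) y1.
have hx : v (2 * Q x * z.1 + B x y * z.2) <= vnorm v (pt z).
  have -> : 2 * Q x * z.1 + B x y * z.2 = B x (pt z).
    by rewrite qpolarDr !qpolarZr qpolarxx; ring.
  rewrite (le_trans (qpolar_bound F id_iso uv x (pt z)))// c1 mul1r.
  by rewrite ler_piMl ?vnorm_ge0.
have hy : v (B x y * z.1 + 2 * Q y * z.2) <= vnorm v (pt z).
  have -> : B x y * z.1 + 2 * Q y * z.2 = B y (pt z).
    by rewrite qpolarDr !qpolarZr qpolarxx [B y x]qpolarC; ring.
  rewrite (le_trans (qpolar_bound F id_iso uv y (pt z)))// c1 mul1r.
  by rewrite ler_piMl ?vnorm_ge0.
have mul_le (a d : K) (r : R) : v a <= 1 -> v d <= r -> v (a * d) <= r.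
  by move=> a1; apply: le_trans; rewrite absvalM ler_piMl ?absval_ge0.
have two a : v a <= 1 -> v (2 * a) <= 1.
  by move=> a1; rewrite absvalM mulr_ile1 ?absval_ge0// ultra_nat.
rewrite /qabs ge_max; apply/andP; split; rewrite -[leLHS]mul1r -dxy -absvalM.
  have -> : disc x y * z.1 = B x y * (B x y * z.1 + 2 * Q y * z.2)
      - 2 * Q y * (2 * Q x * z.1 + B x y * z.2) by ring.
  by apply: (ultraB_le uv); apply: mul_le => //; rewrite two.
have -> : disc x y * z.2 = B x y * (2 * Q x * z.1 + B x y * z.2)
    - 2 * Q x * (B x y * z.1 + 2 * Q y * z.2) by ring.
by apply: (ultraB_le uv); apply: mul_le => //; rewrite two// Qx.
Qed.

Lemma qform_good_plane z : v (Q (pt z)) = v (qnorm b c z).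
Proof.
rewrite qform_comb_norm ?good_plane_Qx// absvalM.
by case: gxy => _ -> _ _ _; rewrite mul1r.
Qed.

(** The hypothesis on [w] makes it neutral for multiplicities, so the multiplicity is [k] times that
    of [z]: zero or at least [m]. *)
Lemma campana_good_plane m (z w : K * K) k j : (m <= k)%N ->
  v (qnorm b c w) = qabs v w ^+ 2 ->
  campana_at F m v v idfun (pt (qmul b c (qpow b c z k) (qpow b c w j))).
Proof.
move=> mk hw; have [a ua] := exists_uniformizer uv; exists a => //.
have b1 := good_plane_b; have c1 := good_plane_c; have d1 := good_plane_disc.
rewrite vnorm_good_plane qform_good_plane.
have [[-> _ _] _ _ _ _] := gxy; rewrite mul1r.
have hwj := qnorm_pow_unit uv b1 c1 d1 j hw.
rewrite (qabs_mul_unit uv b1 c1 _ hwj) qnormM absvalM hwj exprMn.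
rewrite qnormX absvalX !(qabs_pow uv b1 c1 d1).
have [e|e] := eqVneq (v (qnorm b c z)) (qabs v z ^+ 2).
  by left; rewrite e -!exprM mulnC.
right; have lt : v (qnorm b c z) < qabs v z ^+ 2.
  by rewrite lt_neqAle e qnorm_le.
(* [t] is a coordinate of [z] of largest value; once [qabs v z] is a value of [K], the strict
   inequality improves by a full factor [v a]. *)
have [t tE] : exists t, qabs v z = v t.
  by rewrite /qabs; case: leP => _; eexists; reflexivity.
have t0 : 0 < v t ^+ 2 by rewrite -tE (le_lt_trans _ lt)// absval_ge0.
have t0' : 0 < v t by rewrite absval_gt0; apply: contraTneq t0 => ->; rewrite absval0 expr0n ltxx.
have [a0 va _] := ua.
have h : v (qnorm b c z) <= v t ^+ 2 * v a.
  rewrite [leRHS]mulrC; have := uniformizer_max (b := qnorm b c z / t ^+ 2) ua.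
  rewrite absvalM absvalV absvalX ltr_pdivrMr// mul1r ler_pdivrMr//; apply.
  by rewrite -tE.
rewrite mulrAC ler_wpM2r ?exprn_ge0 ?qabs_ge0// tE.
rewrite (le_trans (y := (v t ^+ 2 * v a) ^+ k))//.
  by rewrite lerXn2r ?nnegrE ?mulr_ge0 ?exprn_ge0 ?absval_ge0.
rewrite exprMn -!exprM [(2 * k)%N]mulnC ler_wpM2l ?exprn_ge0 ?absval_ge0//.
by rewrite ler_wiXn2l ?absval_ge0// ltW.
Qed.

End GoodPlane.

Lemma finite_content_neq1 : F != 0 ->
  finite_set [set v : place R K | ultra v /\ v (content v F) != 1].
Proof.
move=> F0; apply: (@sub_finite_set _ _ (\bigcup_(k in [set` msupp F])
    [set v : place R K | ultra v /\ v F@_k != 1])).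
  move=> v [uv vc]; have [k ck] := content_ex v F.
  exists k; last by rewrite -ck.
  by rewrite /= mcoeff_msupp -ck content_neq0.
apply: bigcup_finite; first exact: finite_seq.
by move=> k /= kF; apply: finite_places_nonunit; rewrite -mcoeff_msupp.
Qed.

Lemma finite_vnorm_gt1 (x : 'rV[K]_n.+1) :
  finite_set [set v : place R K | ultra v /\ ~~ (vnorm v x <= 1)].
Proof.
apply: (@sub_finite_set _ _ (\bigcup_(i in [set: 'I_n.+1])
    [set v : place R K | ultra v /\ ~~ (v (x 0 i) <= 1)])).
  move=> v [uv vx]; have [i xi] := vnorm_ex v x; exists i => //; split=> //.
  by rewrite -xi.
apply: bigcup_finite => // i _; exact: finite_places_nonintegral.
Qed.

Lemma finite_bad_plane (x y : 'rV[K]_n.+1) : F != 0 -> Q x != 0 -> disc x y != 0 ->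
  finite_set [set v : place R K | ultra v /\ ~ good_plane v x y].
Proof.
move=> F0 Qx dxy.
pose A1 : set (place R K) := [set v | ultra v /\ v (content v F) != 1].
pose A2 (x : 'rV[K]_n.+1) : set (place R K) := [set v | ultra v /\ ~~ (vnorm v x <= 1)].
pose A3 (a : K) : set (place R K) := [set v | ultra v /\ v a != 1].
pose A4 (a : K) : set (place R K) := [set v | ultra v /\ ~~ (v a <= 1)].
apply: (@sub_finite_set _ _ (A1 `|` (A2 x `|` (A2 y `|` (A3 (Q x) `|`
  (A4 (B x y) `|` (A4 (Q y) `|` A3 (disc x y)))))))).
  move=> v [uv g]; apply: contrapT => h; apply: g.
  move: h; rewrite /A1 /A2 /A3 /A4 /setU/=.
  move=> /not_orP[h1 /not_orP[h2 /not_orP[h3 /not_orP[h4 /not_orP[h5 /not_orP[h6 h7]]]]]].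
  have T (P : bool) : ~ (ultra v /\ ~~ P) -> P.
    by move=> hP; apply: contrapT => /negP nP; apply: hP.
  by split; [split; [apply/eqP|..]|apply/eqP|..|apply/eqP]; apply: T.
rewrite !finite_setU; split; first exact: finite_content_neq1.
split; first exact: finite_vnorm_gt1.
split; first exact: finite_vnorm_gt1.
split; first exact: finite_places_nonunit.
split; first exact: finite_places_nonintegral.
split; first exact: finite_places_nonintegral.
exact: finite_places_nonunit.
Qed.

Lemma campana_at_eq m v (x : 'rV[K]_n.+1) : ultra v ->
  v (Q x) = v (content v F) * vnorm v x ^+ 2 -> campana_at F m v v idfun x.
Proof.
by move=> uv h; have [a ua] := exists_uniformizer uv; exists a => //; left.
Qed.

(** The place [v0] of [V] is where nonvanishing is forced: sequences with a nonzero limit at [v0]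
    are eventually nonzero in [K]. This serves for the form at [x1], the discriminant of the plane
    and the norms of [t] and [w]. *)
Lemma exists_global_point (S V : set (place R K)) (m : nat) (v0 : place R K)
    (x : place R K -> 'rV[K]_n.+1) (e : place R K -> R) :
  (0 < n)%N -> smooth_hypersurface F -> F != 0 ->
  (forall v, ~ S v -> ultra v) -> finite_set V -> V v0 ->
  (forall v, V v -> 0 < e v) -> Q (x v0) != 0 ->
  exists2 y : 'rV[K]_n.+1, Q y != 0 &
    (forall v, V v -> forall i, v (y 0 i - x v 0 i) < e v) /\
    forall v, ~ S v -> ~ V v -> campana_at F m v v idfun y.
Proof.
move=> n0 Fs F0 Su finV Vv0 e0 Qx0.
have [x1 Qx1 x1e] : exists2 x1 : 'rV[K]_n.+1, Q x1 != 0 &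
    forall v, V v -> forall i, v (x1 0 i - x v 0 i) < e v.
  have [c hc] := weak_approximation_seq (fun v i => x v 0 i) finV.
  pose c' k : 'rV[K]_n.+1 := \row_i c k i.
  have hc' v i : V v -> acvg v (fun k => c' k 0 i) (x v 0 i).
    by move=> Vv; under [X in acvg _ X _]eq_fun do rewrite mxE; exact: hc.
  have H1 : \forall k \near \oo, Q (c' k) != 0.
    by apply: acvg_neq0 Qx0 (acvg_qform idfun _) => i; exact: hc'.
  have H2 : \forall k \near \oo, forall v, V v ->
      forall i, i \in enum 'I_n.+1 -> v (c' k 0 i - x v 0 i) < e v.
    apply: near_all_set => // v Vv; apply: near_all_seq => i _.
    by apply: acvg_lt; [exact: hc'|exact: e0].
  have /filter_ex[k [hk1 hk2]] : \forall k \near \oo, Q (c' k) != 0 /\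
      forall v, V v -> forall i, i \in enum 'I_n.+1 -> v (c' k 0 i - x v 0 i) < e v.
    by apply: filterS2 H1 H2.
  by exists (c' k) => // v Vv i; apply: hk2 => //; exact: mem_enum.
pose V1 : set (place R K) :=
  [set v | ~ S v /\ ~ V v /\ v (Q x1) != v (content v F) * vnorm v x1 ^+ 2].
have id_iso v a : v ((idfun : {rmorphism K -> K}) a) = v a by [].
have finV1 : finite_set V1.
  apply: (@sub_finite_set _ _ ([set v : place R K | ultra v /\ v (content v F) != 1] `|`
    ([set v : place R K | ultra v /\ ~~ (vnorm v x1 <= 1)] `|`
     [set v : place R K | ultra v /\ v (Q x1) != 1]))); last first.
    rewrite !finite_setU; split; first exact: finite_content_neq1.
    by split; [exact: finite_vnorm_gt1|exact: finite_places_nonunit].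
  move=> v [Sv [_ vx]]; have uv := Su v Sv; apply: contrapT.
  rewrite /setU/= => /not_orP[h1 /not_orP[h2 h3]].
  have T (P : bool) : ~ (ultra v /\ ~~ P) -> P.
    by move=> hP; apply: contrapT => /negP nP; apply: hP.
  have {h1} /eqP c1 := T _ h1; have {h3} /eqP q1 := T _ h3; have {}h2 := T _ h2.
  move/eqP: vx; apply; rewrite c1 q1 mul1r; apply/le_anti.
  rewrite exprn_ile1 ?vnorm_ge0// andbT.
  by have := qform_bound F (id_iso v) uv x1; rewrite c1 mul1r q1.
(* [x2] takes over at the places where [x1] meets the quadric. *)
have [y0 dy0] := exists_disc_neq0 n0 Fs Qx1.
have /choice[u hu] : forall v, exists u : 'rV[K]_n.+1, ultra v ->
    vnorm v u = 1 /\ v (Q u) = v (content v F).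
  move=> v; have [uv|nuv] := pselect (ultra v); last by exists 0.
  by have [u hu] := exists_unit_vector Fhom uv F0; exists u.
have V1v0 : ~ V1 v0 by move=> [_ []].
have [x2 dx2 x2u] : exists2 x2 : 'rV[K]_n.+1, disc x1 x2 != 0 &
    forall v, V1 v -> Q x2 != 0 /\ v (Q x2) = v (content v F) * vnorm v x2 ^+ 2.
  (* As [v0] lies outside [V1], nothing else is asked of [x2] there, and being close to [y0] makes
     its discriminant with [x1] nonzero. *)
  pose tg v := if v == v0 then y0 else u v.
  have finV1' : finite_set (v0 |` V1) by rewrite finite_setU; split.
  have [c hc] := weak_approximation_seq (fun v i => tg v 0 i) finV1'.
  pose c' k : 'rV[K]_n.+1 := \row_i c k i.
  have hc' v i : (v0 |` V1) v -> acvg v (fun k => c' k 0 i) (tg v 0 i).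
    by move=> Vv; under [X in acvg _ X _]eq_fun do rewrite mxE; exact: hc.
  have H1 : \forall k \near \oo, disc x1 (c' k) != 0.
    have tg0 : tg v0 = y0 by rewrite /tg eqxx.
    apply: (acvg_neq0 (w := v0)) dy0 _.
    have cv i : acvg v0 (fun k => c' k 0 i) (y0 0 i).
      by rewrite -tg0; apply: hc'; left.
    apply: acvgD; first by apply: acvgX; exact: acvg_qpolar.
    rewrite -mulNr; under [X in acvg _ X _]eq_fun do rewrite -mulNr.
    apply: acvgM; first exact: acvg_cst.
    by apply: acvgM; [exact: acvg_cst|exact: acvg_qform].
  have H2 : \forall k \near \oo, forall v, V1 v ->
      Q (c' k) != 0 /\ v (Q (c' k)) = v (content v F) * vnorm v (c' k) ^+ 2.
    apply: near_all_set => // v Vv; have uv := Su v Vv.1.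
    have [u1 Qu] := hu v uv.
    have tgv : tg v = u v.
      by rewrite /tg; case: eqVneq => // vv0; exfalso; apply: V1v0; rewrite -vv0.
    have cv i : acvg v (fun k => c' k 0 i) (u v 0 i).
      by rewrite -tgv; apply: hc'; right.
    have c0 : v (content v F) != 0 by rewrite absval_eq0b content_neq0.
    have Qu0 : Q (u v) != 0 by rewrite -(absval_eq0b v) Qu.
    have u0 : u v != 0 by rewrite -(vnorm_gt0 v) u1.
    have n1 := acvg_neq0 Qu0 (acvg_qform idfun cv).
    have n2 := acvg_ultra_eq uv Qu0 (acvg_qform idfun cv).
    have n3 := acvg_vnorm_eq uv u0 cv.
    apply: filterS3 n1 n2 n3 => k -> -> ->; split=> //.
    by rewrite u1 expr1n mulr1.
  have /filter_ex[k [hk1 hk2]] : \forall k \near \oo, disc x1 (c' k) != 0 /\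
      forall v, V1 v -> Q (c' k) != 0 /\ v (Q (c' k)) = v (content v F) * vnorm v (c' k) ^+ 2.
    by apply: filterS2 H1 H2.
  by exists (c' k).
pose bb := B x1 x2 / Q x1; pose cc := Q x2 / Q x1.
pose pt (z : K * K) : 'rV[K]_n.+1 := z.1 *: x1 + z.2 *: x2.
pose bad : set (place R K) := [set v : place R K | ultra v /\ ~ good_plane v x1 x2].
have finbad : finite_set bad by exact: finite_bad_plane.
pose Z := V `|` V1 `|` (bad `\` S).
have finZ : finite_set Z.
  by rewrite !finite_setU; split; [split|exact: finite_setD].
(* The local target in the algebra: 1, which stands for [x1], except on [V1], where the class of X
   stands for [x2]. *)
pose tau v : K * K := if `[< V1 v >] then (0, 1) else (1, 0).
have tau1 v : ~ V1 v -> tau v = (1, 0) by move=> h; rewrite /tau asboolF.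
have Ntau v : V1 v -> qnorm bb cc (tau v) = cc.
  by move=> h; rewrite /tau asboolT// /qnorm/=; ring.
have N1 : qnorm bb cc (1, 0) = 1 by rewrite /qnorm/=; ring.
have Zv0 : Z v0 by left; left.
pose pc (z : K * K) (i : bool) := if i then z.1 else z.2.
have [t ht] := weak_approximation_seq (fun v => pc (qconj bb (tau v))) finZ.
have tcv v : Z v -> qcvg v (fun k => (t k true, t k false)) (qconj bb (tau v)).
  by move=> Zv; split; [exact: (ht v Zv true)|exact: (ht v Zv false)].
pose T k := (t k true, t k false).
(* [w] is chosen after [T k]: besides its targets on [Z], it is close to 1 at the finitely many
   other places where [T k] meets the quadric. This keeps conjugate prime factors of the two powers
   from forming a common content. *)
have /choice[w hw] : forall k, exists w : K * K, qnorm bb cc (T k) != 0 ->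
    (forall v, Z v -> v (w.1 - (tau v).1) < k.+1%:R^-1 /\ v (w.2 - (tau v).2) < k.+1%:R^-1) /\
    (forall v, ~ S v -> ~ Z v -> v (qnorm bb cc (T k)) != qabs v (T k) ^+ 2 ->
       v (qnorm bb cc w) = qabs v w ^+ 2).
  move=> k; have [NT|NT] := eqVneq (qnorm bb cc (T k)) 0; first by exists 0.
  pose badT : set (place R K) := [set v : place R K | ~ S v /\ ~ Z v /\ v (qnorm bb cc (T k)) !=
    qabs v (T k) ^+ 2].
  have gZ v : ~ S v -> ~ Z v -> good_plane v x1 x2.
    by move=> Sv Zv; apply: contrapT => h; apply: Zv; right; split=> //; split=> //; exact: Su.
  have finT : finite_set badT.
    apply: (@sub_finite_set _ _ ([set v : place R K | ultra v /\ v (qnorm bb cc (T k)) != 1] `|`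
      ([set v : place R K | ultra v /\ ~~ (v (T k).1 <= 1)] `|`
       [set v : place R K | ultra v /\ ~~ (v (T k).2 <= 1)]))); last first.
      rewrite !finite_setU; split; first exact: finite_places_nonunit.
      by split; exact: finite_places_nonintegral.
    move=> v [Sv [Zv vT]]; have uv := Su v Sv; have g := gZ v Sv Zv; apply: contrapT.
    rewrite /setU/= => /not_orP[h1 /not_orP[h2 h3]].
    have TT (P : bool) : ~ (ultra v /\ ~~ P) -> P.
      by move=> hP; apply: contrapT => /negP nP; apply: hP.
    have {h1} /eqP q1 := TT _ h1; have {}h2 := TT _ h2; have {}h3 := TT _ h3.
    move/eqP: vT; apply; rewrite q1; apply/le_anti; apply/andP; split.
      rewrite -q1; exact: qnorm_le uv (good_plane_b g) (good_plane_c g) _.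
    by rewrite exprn_ile1 ?qabs_ge0// /qabs ge_max h2 h3.
  have finZT : finite_set (Z `|` badT) by rewrite finite_setU.
  have [a ha] := @weak_approximation R K _ bool (fun v => pc (if `[< Z v >] then tau v else (1,
    0)))
     (fun=> k.+1%:R^-1) finZT (fun _ _ => (ltac:(by rewrite invr_gt0 ltr0n))).
  exists (a true, a false) => _; split.
    move=> v Zv; split.
      by have := ha v (or_introl Zv) true; rewrite asboolT.
    by have := ha v (or_introl Zv) false; rewrite asboolT.
  move=> v Sv Zv vT; have uv := Su v Sv; have g := gZ v Sv Zv.
  have k1 : (k.+1%:R^-1 : R) <= 1 by rewrite invf_le1 ?ler1n ?ltr0n.
  have bT : (Z `|` badT) v by right.
  have := ha v bT true; rewrite asboolF//= => /lt_le_trans/(_ k1) a1.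
  have := ha v bT false; rewrite asboolF//= subr0 => /lt_le_trans/(_ k1) a2.
  have va1 : v (a true) = 1 by rewrite -(absval1 v); apply: (ultra_close uv); rewrite absval1.
  have -> : qabs v (a true, a false) = 1.
    by rewrite /qabs/= va1; apply/max_idPl/ltW.
  rewrite expr1n -(absval1 v); apply: (ultra_close uv); rewrite absval1.
  have -> : qnorm bb cc (a true, a false) - 1 =
     ((a true - 1) * (a true + 1)) + (bb * a true * a false + cc * a false * a false).
    by rewrite /qnorm/=; ring.
  have lt1 (p q : K) : v p <= 1 -> v q < 1 -> v (p * q) < 1.
    by move=> p1; rewrite absvalM; apply: le_lt_trans; rewrite ler_piMl ?absval_ge0.
  apply: (ultraD_lt uv).
    by rewrite mulrC; apply: lt1 => //; apply: (ultraD_le uv); rewrite ?va1 ?absval1.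
  apply: (ultraD_lt uv); apply: lt1 => //; rewrite absvalM mulr_ile1 ?absval_ge0 ?va1//.
  - exact: good_plane_b.
  - exact: good_plane_c.
  exact: ltW.
have NTnear : \forall k \near \oo, qnorm bb cc (T k) != 0.
  apply: (acvg_neq0 (w := v0)) (acvg_qnorm bb cc (tcv v0 Zv0)).
  by rewrite qnorm_conj tau1// N1 oner_eq0.
have wcv v : Z v -> qcvg v w (tau v).
  move=> Zv; split; apply: acvg_le (@cvg_harmonic R);
    by apply: filterS NTnear => k /(hw k)[/(_ v Zv)[h1 h2] _]; rewrite ltW.
have Nwnear : \forall k \near \oo, qnorm bb cc (w k) != 0.
  apply: (acvg_neq0 (w := v0)) (acvg_qnorm bb cc (wcv v0 Zv0)).
  by rewrite tau1// N1 oner_eq0.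
pose z k := qmul bb cc (qpow bb cc (T k) m) (qpow bb cc (w k) m.+1).
have zcv v : Z v -> qcvg v z (qnorm bb cc (tau v) ^+ m * (tau v).1, qnorm bb cc (tau v) ^+ m *
  (tau v).2).
  by move=> Zv; rewrite -qpow_conj; apply: qcvg_mul; apply: qcvg_pow; [exact: tcv|exact: wcv].
pose lim v := pt (qnorm bb cc (tau v) ^+ m * (tau v).1, qnorm bb cc (tau v) ^+ m * (tau v).2).
have ptcv v i : Z v -> acvg v (fun k => pt (z k) 0 i) (lim v 0 i).
  move=> Zv; have [z1 z2] := zcv v Zv.
  rewrite !mxE; under [X in acvg _ X _]eq_fun do rewrite !mxE.
  by apply: acvgD; apply: acvgM => //; exact: acvg_cst.
have lim1 v : ~ V1 v -> lim v = x1.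
  by move=> h; rewrite /lim tau1// N1 expr1n /pt/= !mul1r scale1r scale0r addr0.
have limV1 v : V1 v -> lim v = cc ^+ m *: x2.
  by move=> h; rewrite /lim Ntau// /tau asboolT// /pt/= mulr0 mulr1 scale0r add0r.
have H1 : \forall k \near \oo, forall v, V v ->
    forall i, i \in enum 'I_n.+1 -> v (pt (z k) 0 i - x v 0 i) < e v.
  apply: near_all_set => // v Vv; apply: near_all_seq => i _.
  have Zv : Z v by left; left.
  have V1v : ~ V1 v by move=> [_ []].
  have d0 : 0 < e v - v (x1 0 i - x v 0 i) by rewrite subr_gt0 x1e.
  have := ptcv v i Zv; rewrite lim1// => /acvg_lt/(_ d0); apply: filterS => k h.
  have := absvalD v (pt (z k) 0 i - x1 0 i) (x1 0 i - x v 0 i).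
  by rewrite subrKA => /le_lt_trans; apply; rewrite -ltrBrDr.
(* At these places the plane may be bad, but the limit, [x1] or a multiple of [x2], has multiplicity
   0, and this is an open condition. *)
have H2 : \forall k \near \oo, forall v, (Z `\` (V `|` S)) v ->
    v (Q (pt (z k))) = v (content v F) * vnorm v (pt (z k)) ^+ 2.
  apply: near_all_set; first exact: finite_setD.
  move=> v [Zv /not_orP[Vv Sv]]; have uv := Su v Sv.
  have [Ql vl] : Q (lim v) != 0 /\ v (Q (lim v)) = v (content v F) * vnorm v (lim v) ^+ 2.
    have [V1v|V1v] := pselect (V1 v).
      rewrite limV1// qformZ vnormZ; have [Q2 vx2] := x2u v V1v; split.
        by rewrite !mulf_neq0 ?expf_neq0// mulf_neq0 ?invr_eq0.
      by rewrite absvalM vx2 [v (_ ^+ 2)]absvalX; ring.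
    rewrite lim1//; split=> //; apply/eqP; apply: contrapT => /negP h.
    by apply: V1v.
  have cv i : acvg v (fun k => pt (z k) 0 i) (lim v 0 i) by exact: ptcv.
  have n2 := acvg_ultra_eq uv Ql (acvg_qform idfun cv).
  have n3 := acvg_vnorm_eq uv (qform_neq0 Ql) cv.
  by apply: filterS2 n2 n3 => k -> ->.
have [k [[hT hN] [h1 h2]]] := filter_ex (@filterI _ _ _ _ _
  (@filterI _ _ _ _ _ NTnear Nwnear) (@filterI _ _ _ _ _ H1 H2)).
exists (pt (z k)).
  rewrite qform_comb_norm// mulf_neq0// -/bb -/cc /z qnormM !qnormX.
  by rewrite mulf_neq0 ?expf_neq0.
split=> [v Vv i|v Sv Vv]; first by apply: h1; rewrite ?mem_enum.
have uv := Su v Sv; have [Zv|Zv] := pselect (Z v).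
  by apply: campana_at_eq => //; apply: h2; split=> //; apply/not_orP.
have g : good_plane v x1 x2.
  by apply: contrapT => h; apply: Zv; right; split.
(* One of the two factors is always neutral: if [T k] is, the multiplicity comes from the exponent
   [m.+1] of [w]; otherwise [w] is neutral by its choice, and it comes from the exponent [m] of
   [T k]. *)
have [NT|NT] := eqVneq (v (qnorm bb cc (T k))) (qabs v (T k) ^+ 2).
  rewrite /z qmulC; apply: campana_good_plane => //; exact: leqnSn.
apply: campana_good_plane => //.
by have [_ ] := hw k hT; apply.
Qed.

End Form.
End GlobalPoint.

(** * Density of Campana points *)

Section ProductTopology.
Context {I : Type} (T : I -> topologicalType).

Lemma nbhs_prod_topology (p : prod_topology T) (U : set (prod_topology T)) :
  nbhs p U -> exists (D : set I) (O : forall i, set (T i)),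
    [/\ finite_set D, forall i, nbhs (p i) (O i) &
        forall q : prod_topology T, (forall i, D i -> O i (q i)) -> U q].
Proof.
pose G : set_system (prod_topology T) := fun V => exists (D : set I) (O : forall i, set (T i)),
    [/\ finite_set D, forall i, nbhs (p i) (O i) &
        forall q : prod_topology T, (forall i, D i -> O i (q i)) -> V q].
have FG : Filter G.
  split.
  - by exists set0, (fun=> setT); split=> // i; exact: filterT.
  - move=> A B [DA [OA [fA nA hA]]] [DB [OB [fB nB hB]]].
    exists (DA `|` DB), (fun i => OA i `&` OB i); split.
    + by rewrite finite_setU.
    + by move=> i; exact: filterI.
    + move=> q hq; split; [apply: hA|apply: hB] => i Di.
        by have [] := hq i (or_introl Di).
      by have [] := hq i (or_intror Di).
  - move=> A B AB [D [O [fD nD hD]]]; exists D, O; split=> // q hq.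
    exact/AB/hD.
(* The product topology is a supremum of initial topologies, so convergence is tested one coordinate
   at a time; the cast below accounts for factors that depend on the index. *)
have Gp : G --> (p : prod_topology T).
  apply/cvg_sup => i A /= [B [[C oC <-] Cp] BA].
  exists [set i], (fun j => [set x | forall e : j = i, C (ecast j (T j) e x)]); split.
  - exact: finite_set1.
  - move=> j; have [ji|ji] := pselect (j = i); last first.
      by apply: nearW => x e; case: ji.
    subst j; have := open_nbhs_nbhs (conj oC Cp); apply: filterS => x Cx e.
    by rewrite (Prop_irrelevance e erefl).
  - by move=> q hq; apply: BA; exact: (hq i erefl erefl).
exact: Gp.
Qed.

End ProductTopology.

Section LocalTopology.
Context {R : realType} {K : fieldExtType rat}.
Context (Kv : forall v : place R K, completion v).
Context {n : nat}.
Implicit Types v : place R K.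

Lemma nbhs_local_proj v (x : nonzero_vec n (cfield (Kv v))) (O : set (local_proj Kv v)) :
  nbhs (\pi_(proj_space n (cfield (Kv v)))%qT x : local_proj Kv v) O ->
  exists2 e : R, 0 < e & forall y : nonzero_vec n (cfield (Kv v)),
    (forall i, cval Kv v (val y 0 i - val x 0 i) < e) ->
    O (\pi_(proj_space n (cfield (Kv v)))%qT y).
Proof.
rewrite nbhsE => -[O' [oO' O'x] O'O].
have : open ((fun y : nonzero_vec n (cfield (Kv v)) =>
  \pi_(proj_space n (cfield (Kv v)))%qT y : local_proj Kv v) @^-1` O') by exact: oO'.
move=> [U oU UE].
have Ux : U (val x).
  have : (set_val @^-1` U) x by rewrite UE.
  by [].
have : nbhs (val x) U by exact: open_nbhs_nbhs.
move=> /nbhs_ballP[e /= e0 eU]; exists e => // y hy; apply: O'O.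
suff : (set_val @^-1` U) y by rewrite UE.
apply: eU; split=> // i j; rewrite ballEmdist/= ord1.
have := hy j; rewrite absvalBC -cabsE; exact.
Qed.

Lemma open_local_proj v (O : set (local_proj Kv v)) :
  (forall x : nonzero_vec n (cfield (Kv v)),
    O (\pi_(proj_space n (cfield (Kv v)))%qT x) -> exists2 e : R, 0 < e &
    forall y : nonzero_vec n (cfield (Kv v)),
    (forall i, cval Kv v (val y 0 i - val x 0 i) < e) ->
    O (\pi_(proj_space n (cfield (Kv v)))%qT y)) -> open O.
Proof.
move=> h.
suff : open ((fun y : nonzero_vec n (cfield (Kv v)) =>
  \pi_(proj_space n (cfield (Kv v)))%qT y : local_proj Kv v) @^-1` O) by [].
rewrite openE => x Ox; have [e e0 he] := h x Ox.
rewrite /interior nbhsE.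
exists (set_val @^-1` (interior (ball (val x) e))).
  split; first by exists (interior (ball (val x) e)) => //; exact: open_interior.
  exact: nbhsx_ballx.
move=> y /interior_subset [_ xy]; apply: he => i.
have := xy 0 i; rewrite ballEmdist/= absvalBC -cabsE; exact.
Qed.

End LocalTopology.

Section CampanaWeakApproximation.
Context {R : realType} {K : fieldExtType rat}.
Context (Kv : forall v : place R K, completion v) (S : set (place R K)).
Hypothesis S_nonarch : forall v, ~ S v -> ultra v.
Context {n : nat} (F : {mpoly K[n.+1]}) (m : nat).
Hypothesis Fhom : F \is 2.-homog.
Hypothesis F0 : F != 0.
Implicit Types v : place R K.
Local Notation Q := (qform F idfun).
Local Notation emb v x := (map_mx (cemb (Kv v)) x).

(** Converts sequential openness into a radius: counterexamples at radius 1/(k+1) would form a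
    convergent sequence violating the hypothesis. *)
Lemma acvg_near_ball v (x : 'rV[cfield (Kv v)]_n.+1) (P : 'rV[K]_n.+1 -> Prop) :
  (forall c : nat -> 'rV[K]_n.+1,
     (forall i, acvg (cval Kv v) (fun k => emb v (c k) 0 i) (x 0 i)) ->
     \forall k \near \oo, P (c k)) ->
  exists2 d : R, 0 < d &
    forall y, (forall i, cval Kv v (emb v y 0 i - x 0 i) < d) -> P y.
Proof.
move=> h; apply: contrapT => /forall2NP nd.
have /choice[c hc] : forall k : nat, exists y, (forall i,
    cval Kv v (emb v y 0 i - x 0 i) < k.+1%:R^-1) /\ ~ P y.
  move=> k; case: (nd k.+1%:R^-1); first by rewrite invr_gt0 ltr0n.
  by move=> /existsNP[y /not_implyP[y1 y2]]; exists y.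
have /filter_ex[k] : \forall k \near \oo, P (c k).
  by apply: h => i; apply: acvg_harmonic => k; have [hk _] := hc k; exact: hk.
by have [] := hc k.
Qed.

Lemma exists_qform_neq0 : (exists v, ultra v) -> exists x : 'rV[K]_n.+1, Q x != 0.
Proof.
move=> [v uv]; have [x [_ Qx]] := exists_unit_vector Fhom uv F0; exists x.
by rewrite -(absval_eq0b v) Qx absval_eq0b content_neq0.
Qed.

(** If the first approximation [y] lies on the quadric, move it along some [w] off the quadric:
    [Q (y + c ^+ j *: w)] is [c ^+ j] times an expression affine in [c ^+ j], so it cannot vanish
    for two consecutive exponents [j]. *)
Lemma exists_near_off_quadric v (x : 'rV[cfield (Kv v)]_n.+1) (d : R) :
  (exists v, ultra v) -> 0 < d ->
  exists2 y : 'rV[K]_n.+1, Q y != 0 &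
    forall i, cval Kv v (emb v y 0 i - x 0 i) < d.
Proof.
move=> exu d0; have d2 : 0 < d / 2 by rewrite divr_gt0.
have /choice[a ha] : forall i, exists a, cval Kv v (x 0 i - cemb (Kv v) a) < d / 2.
  by move=> i; exact: cval_dense.
pose y : 'rV[K]_n.+1 := \row_i a i.
have yx i : cval Kv v (emb v y 0 i - x 0 i) < d / 2 by rewrite !mxE absvalBC; exact: ha.
have [Qy|Qy] := eqVneq (Q y) 0; last first.
  by exists y => // i; rewrite (lt_trans (yx i))// ltr_pdivrMr// ltr_pMr// ltr1n.
have [w Qw] := exists_qform_neq0 exu.
have [b b0 vb] := place_nontrivial v.
have c1 : v b^-1 < 1 by rewrite absvalV invf_lt1// absval_gt0.
have c0 : b^-1 != 0 by rewrite invr_eq0.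
set c := b^-1 in c1 c0.
have : \forall k \near \oo, forall i, i \in enum 'I_n.+1 -> v (c ^+ k * w 0 i) < d / 2.
  apply: near_all_seq => i _.
  have := acvgM (acvg_geo c1) (acvg_cst v (w 0 i)); rewrite mul0r => /acvg_lt/(_ d2).
  by apply: filterS => k; rewrite subr0.
move=> /filter_ex[k hk].
have close j : (k <= j)%N -> forall i, cval Kv v (emb v (y + c ^+ j *: w) 0 i - x 0 i) < d.
  move=> kj i; rewrite !mxE rmorphD/= addrAC (splitr d).
  rewrite (le_lt_trans (absvalD _ _ _))// ltrD//; first by have := yx i; rewrite !mxE.
  rewrite cval_emb (le_lt_trans _ (hk i (mem_enum _ _)))// !absvalM !absvalX.
  by rewrite ler_wpM2r ?absval_ge0// ler_wiXn2l ?absval_ge0// ltW.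
have QE j : Q (y + c ^+ j *: w) = c ^+ j * (qpolar F idfun y w + c ^+ j * Q w).
  by rewrite qformD Qy add0r qpolarZr qformZ; ring.
have [e|ne] := eqVneq (Q (y + c ^+ k *: w)) 0; last first.
  by exists (y + c ^+ k *: w) => //; exact: close.
exists (y + c ^+ k.+1 *: w); last by apply: close; exact: leqnSn.
rewrite QE mulf_neq0 ?expf_neq0//.
move/eqP: e; rewrite QE mulf_eq0 expf_eq0 (negPf c0) andbF/= addr_eq0 => /eqP ->.
rewrite addrC -mulrBl mulf_neq0// exprSr -{2}[c ^+ k]mulr1 -mulrBr mulf_neq0 ?expf_neq0//.
by rewrite subr_eq0; apply: contraTneq c1 => ->; rewrite absval1 ltxx.
Qed.

(** Near a point of the quadric the multiplicities are large, hence at least [m]; elsewhere the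
    multiplicity is locally constant. *)
Lemma campana_at_near v (x : 'rV[cfield (Kv v)]_n.+1) : ultra v -> x != 0 ->
  (qform F (cemb (Kv v)) x != 0 -> campana_at F m v (cval Kv v) (cemb (Kv v)) x) ->
  exists2 d : R, 0 < d &
    forall y, (forall i, cval Kv v (emb v y 0 i - x 0 i) < d) ->
    campana_at F m v v idfun y.
Proof.
move=> uv x0 hx; apply: acvg_near_ball => c cx; have ucv : ultra (cval Kv v) := cval_ultra uv.
have n1 := acvg_vnorm_eq ucv x0 cx.
have cvQ := acvg_qform F (cemb (Kv v)) cx.
have [Q0|Q0] := eqVneq (qform F (cemb (Kv v)) x) 0.
  have [a ua] := exists_uniformizer uv; have [a0 _ _] := ua.
  have d0 : 0 < v (content v F) * vnorm (cval Kv v) x ^+ 2 * v a ^+ m.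
    rewrite mulr_gt0 ?exprn_gt0 ?absval_gt0// mulr_gt0 ?exprn_gt0 ?vnorm_gt0//.
    by rewrite absval_gt0 content_neq0.
  have n2 := acvg_lt cvQ d0.
  apply: filterS2 n1 n2 => k.
  rewrite (vnorm_map _ (cval_emb Kv v)) Q0 subr0 qform_map cval_emb => e1 h.
  by exists a => //; right; rewrite e1; exact: ltW.
have n2 := acvg_ultra_eq ucv Q0 cvQ.
have [a ua h] := hx Q0.
apply: filterS2 n1 n2 => k.
rewrite (vnorm_map _ (cval_emb Kv v)) qform_map cval_emb => e1 e2.
by exists a => //; rewrite e1 e2.
Qed.

Lemma orbifold_points_intro (x : nonzero_vec n K) (T : set (place R K)) :
  (forall v, ~ S v -> ~ T v -> campana_at F m v v idfun (val x)) ->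
  orbifold_points Kv S F m Campana (S `|` T) (\pi_(proj_space n K)%qT x).
Proof.
move=> h v /not_orP[Sv Tv]; rewrite proj_map_pi.
apply: campana_local_intro => // _.
exact: (campana_at_map Kv (h v Sv Tv)).
Qed.

Lemma campana_at_of_adelic v (x : nonzero_vec n (cfield (Kv v))) : ~ S v ->
  local_orbifold_points Kv S F m Campana v (\pi_(proj_space n (cfield (Kv v)))%qT x) \/
  div_integral_points Kv S F v (\pi_(proj_space n (cfield (Kv v)))%qT x) ->
  qform F (cemb (Kv v)) (val x) != 0 ->
  campana_at F m v (cval Kv v) (cemb (Kv v)) (val x).
Proof.
move=> Sv [h|[y Py y0]] Qx; first exact: campana_local_elim h.
exfalso; have y1 := integral_coordinates_norm Py; have c0 := content_neq0 v F0.
have : pullback_ideal Kv S F y (qform F (cemb (Kv v)) (val y) / cemb (Kv v) (content v F)).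
  rewrite (pullback_idealE S_nonarch Fhom F0 Sv) ?y1//=.
  by rewrite absvalM absvalV cval_emb mulfVK// absval_eq0b.
rewrite y0 => /eqP; rewrite mulf_eq0 invr_eq0 fmorph_eq0 (negPf c0) orbF => /eqP Qy.
have [yP _ _] := Py; have [a a0 e] := pi_proj_inj yP.
by move: Qx; rewrite e qformZ Qy mulr0 eqxx.
Qed.

(** Translates a local condition into data over [K], a vector and a radius. The disjunction lets the
    strict and the non-strict part of the adelic space be treated alike, and the vector is kept off
    the quadric because [exists_global_point] needs this at one place. *)
Lemma exists_local_model v (P : local_proj Kv v) (O : set (local_proj Kv v)) :
  (exists v, ultra v) -> nbhs P O ->
  (~ S v -> local_orbifold_points Kv S F m Campana v P \/ div_integral_points Kv S F v P) ->
  exists p : 'rV[K]_n.+1 * R, [/\ Q p.1 != 0, 0 < p.2 &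
    forall y : nonzero_vec n K, (forall j, v (val y 0 j - p.1 0 j) < p.2) ->
      O (\pi_(proj_space n (cfield (Kv v)))%qT (nonzero_map (cemb (Kv v)) y)) /\
      (~ S v -> campana_at F m v v idfun (val y))].
Proof.
rewrite -[P]reprK; move: (repr P) => {P} x exu /nbhs_local_proj[e e0 he] hP.
have [d d0 hd] : exists2 d : R, 0 < d & forall y : 'rV[K]_n.+1, ~ S v ->
    (forall j, cval Kv v (emb v y 0 j - val x 0 j) < d) -> campana_at F m v v idfun y.
  have [Sv|Sv] := pselect (S v); first by exists 1.
  have hx := campana_at_of_adelic Sv (hP Sv).
  have [d d0 hd] := campana_at_near (S_nonarch Sv) (nonzero_vecP x) hx.
  by exists d => // y _; exact: hd.
pose r := Num.min d e; have r0 : 0 < r by rewrite lt_min d0 e0.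
have r2 : 0 < r / 2 by rewrite divr_gt0.
have [y Qy yx] := exists_near_off_quadric (val x) exu r2.
exists (y, r / 2); split=> //= z zy.
have zx j : cval Kv v (emb v (val z) 0 j - val x 0 j) < r.
  rewrite -(subrKA (emb v y 0 j)) (splitr r) (le_lt_trans (absvalD _ _ _))// ltrD//.
  by rewrite !mxE -rmorphB/= cval_emb; exact: zy.
split; first by apply: he => j; rewrite (lt_le_trans (zx j))// /r ge_min lexx orbT.
by move=> Sv; apply: hd => // j; rewrite (lt_le_trans (zx j))// /r ge_min lexx.
Qed.

Hypothesis n_gt0 : (0 < n)%N.
Hypothesis Fsmooth : smooth_hypersurface F.
Hypothesis exu : exists v : place R K, ultra v.

Lemma campana_nonempty : orbifold_points Kv S F m Campana S !=set0.
Proof.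
have [v uv] := exu; have [u [u1 Qu]] := exists_unit_vector Fhom uv F0.
have Qu0 : Q u != 0 by rewrite -(absval_eq0b v) Qu absval_eq0b content_neq0.
have u0 : emb v u != 0 by rewrite map_mx_eq0 (qform_neq0 Qu0).
have cu : campana_at F m v v idfun u by apply: campana_at_eq; rewrite // u1 expr1n mulr1.
have [d d0 hd] := campana_at_near uv u0 (fun _ => campana_at_map Kv cu).
have finv : finite_set [set v] by exact: finite_set1.
have [y Qy [yu hy]] := @exists_global_point R K n F Fhom S [set v] m v (fun=> u) (fun=> d)
  n_gt0 Fsmooth F0 S_nonarch finv erefl (fun _ _ => d0) Qu0.
exists (\pi_(proj_space n K)%qT (nzvec (qform_neq0 Qy))).
rewrite -[X in orbifold_points _ _ _ _ _ X](setU0 S).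
apply: orbifold_points_intro => w Sw _ /=.
have [->|wv] := eqVneq w v; last by apply: hy => //; apply/eqP.
apply: hd => i; rewrite !mxE -rmorphB/= cval_emb; exact: yu.
Qed.

Lemma campana_weak_approximation : orbifold_weak_approximation Kv S F m Campana.
Proof.
move=> P hP U /nbhs_prod_topology[D [O [finD nO hU]]].
have [v0 uv0] := exu.
(* An extra index makes the set of places to be approximated nonempty even if [D] is empty. *)
pose i0 : ~` (set0 : set (place R K)) := exist _ v0 (mem_set (fun h => h)).
have /choice[p hp] := fun i => exists_local_model exu (nO i)
  (fun Si => match hP with
    | or_introl (And3 _ h _) => or_introl (h i Si).1
    | or_intror h => or_intror ((h i).2 Si) end).
pose ix v : ~` (set0 : set (place R K)) := exist _ v (mem_set (fun h => h)).
pose V : set (place R K) := [set val i | i in i0 |` D].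
have finV : finite_set V by apply: finite_image; rewrite finite_setU; split.
have ixE (i : ~` (set0 : set (place R K))) : ix (val i) = i by apply: val_inj.
have Vv0 : V v0 by exists i0 => //; left.
have [y Qy [yp hy]] := @exists_global_point R K n F Fhom S V m v0
  (fun v => (p (ix v)).1) (fun v => (p (ix v)).2) n_gt0 Fsmooth F0 S_nonarch finV Vv0
  (fun v _ => let: And3 _ h _ := hp (ix v) in h) (let: And3 h _ _ := hp (ix v0) in h).
pose y' := nzvec (qform_neq0 Qy).
exists (diagonal_emb Kv set0 (\pi_(proj_space n K)%qT y')); split.
  exists (\pi_(proj_space n K)%qT y') => //.
  apply: orbifold_points_intro => v Sv _ /=.
  have [Vv|Vv] := pselect (V v); last exact: hy.
  have [_ _ h] := hp (ix v).
  by have [_ ] := h y' (yp v Vv); exact.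
apply: hU => i Di; rewrite /diagonal_emb proj_map_pi.
have Vi : V (val i) by exists i => //; right.
have [_ _ h] := hp i; apply: (h y' _).1 => j.
by have := yp (val i) Vi j; rewrite ixE.
Qed.

End CampanaWeakApproximation.

(** * Norms of integral polynomials at a generator *)

Section Generator.
Context {K : fieldExtType rat}.

Definition ieval (al : K) (h : {poly int}) : K := (map_poly intr h).[al].

Lemma ievalM al g h : ieval al (g * h) = ieval al g * ieval al h.
Proof. by rewrite /ieval rmorphM hornerM. Qed.

Lemma ievalD al g h : ieval al (g + h) = ieval al g + ieval al h.
Proof. by rewrite /ieval rmorphD hornerD. Qed.

Lemma ievalB al g h : ieval al (g - h) = ieval al g - ieval al h.
Proof. by rewrite /ieval rmorphB hornerD hornerN. Qed.

Lemma ievalC al (z : int) : ieval al z%:P = z%:~R.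
Proof. by rewrite /ieval map_polyC hornerC. Qed.

(* A presentation of [K] as the fraction field of [Z[X] / f]. *)
Definition integral_generator (al : K) (f : {poly int}) : Prop :=
  [/\ f \is monic, (1 < size f)%N, ieval al f = 0,
      forall h, ieval al h = 0 -> exists q, h = q * f &
      forall a, exists2 M : nat, (0 < M)%N & exists h, M%:R * a = ieval al h].

Lemma exists_integral_generator : exists al f, integral_generator al f.
Proof.
have sep : separable 1 {:K}.
  apply/separableP => y _; apply: pcharf0_separable => p.
  by rewrite pchar_lalg pchar_num.
pose be := separable_generator 1 {:K}.
have fullE : {:K}%VS = <<1; be>>%VS.
  exact: eq_adjoin_separable_generator sep (sub1v _).
have [q q0 qE] := int_minPoly be.
have lq0 : (lead_coef q)%:~R != 0 :> K by rewrite intr_eq0_ext lead_coef_eq0.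
have qbe : root (map_poly intr q) be by rewrite qE rootZ ?root_minPoly.
have sq : size q = size (minPoly 1 be).
  have <- : size (map_poly (intr : int -> K) q) = size q by rewrite size_map_poly_id0.
  by rewrite qE size_scale.
have sq1 : (1 < size q)%N by rewrite sq size_minPoly ltnS.
have [f [fm sf fr]] := int_multiple_root q0 qbe sq1.
set al := _ * be in fr.
have alfull : <<1; al>>%VS = {:K}%VS.
  apply/eqP; rewrite eqEsubv subvf /= fullE; apply/FadjoinP; split; first exact: sub1v.
  have -> : be = (lead_coef q)%:~R^-1 * al by rewrite mulKf.
  by rewrite rpredM ?memv_adjoin// rpredV rpred_int.
have sfm : size (minPoly 1 al) = size f.
  rewrite sf sq !size_minPoly; congr _.+1.
  have := dim_Fadjoin 1%AS al; have := dim_Fadjoin 1%AS be.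
  by rewrite alfull -fullE => -> /eqP; rewrite eqn_pmul2r ?adim_gt0// => /eqP.
have f1 : lead_coef f = 1 by apply/monicP.
have f0 : ieval al f = 0 by exact/rootP.
have sf1 : (1 < size f)%N by rewrite sf.
exists al, f; split=> //.
  (* Division by the monic [f] stays integral, and the remainder vanishes at [al] with degree below
     that of the minimal polynomial. *)
  move=> h h0; exists (Pdiv.Ring.rdivp h f).
  have hE := Pdiv.RingMonic.rdivp_eq fm h; set r := Pdiv.Ring.rmodp h f in hE.
  suff r0 : r = 0 by rewrite {1}hE r0 addr0.
  have rr : root (map_poly intr r) al.
    apply/rootP; have := h0; rewrite hE ievalD ievalM f0 mulr0 add0r; exact.
  have rover : map_poly (intr : int -> K) r \is a polyOver 1%VS.
    by apply/polyOverP => i; rewrite coef_map_id0// rpred_int.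
  have sr : (size (map_poly (intr : int -> K) r) < size (minPoly 1 al))%N.
    rewrite sfm (leq_ltn_trans (size_poly _ _))// Pdiv.Ring.ltn_rmodp.
    by rewrite monic_neq0.
  apply/eqP; apply: contraTT (sr) => rn0; rewrite -leqNgt dvdp_leq ?minPoly_dvdp//.
  have [i ri] : exists i, r`_i != 0.
    by exists (size r).-1; rewrite -lead_coefE lead_coef_eq0.
  apply/eqP => /(congr1 (fun g : {poly K} => g`_i)); rewrite coef_map_id0// coef0 => /eqP.
  by rewrite intr_eq0_ext (negPf ri).
move=> a; have aal : a \in <<1; al>>%VS by rewrite alfull memvf.
have /polyOver1P[p0 p0E] := Fadjoin_polyOver 1%VS al a.
have [h [c c0 hE]] := rat_poly_scale p0.
have aE : c%:~R * a = ieval al h.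
  rewrite -(Fadjoin_poly_eq aal) p0E hE /ieval -[map_poly intr h](_ :
    map_poly (GRing.in_alg K) (map_poly intr h) = _); last first.
    by apply/polyP => i; rewrite !coef_map_id0 ?rmorph0// rmorph_int.
  rewrite [in LHS]linearZ/= hornerZ.
  have -> : (c%:~R^-1)%:A = c%:~R^-1 :> K.
    by rewrite -[LHS]/(GRing.in_alg K _) fmorphV rmorph_int.
  by rewrite mulrA mulfV ?mul1r// intr_eq0_ext.
(* [c] may be negative; one more factor [c] gives a positive denominator. *)
exists (`|c| ^ 2)%N; first by rewrite expn_gt0 absz_gt0 c0.
exists (c%:P * h); rewrite ievalM ievalC -aE mulrA -intrM; congr (_ * a).
have -> : c * c = Posz (`|c| ^ 2) by lia.
by [].
Qed.

(** Invert the value of [h] in [K] and clear the denominator. Modulo a prime not dividing [M], the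
    relation says that [h] and [f] are coprime. *)
Lemma ieval_bezout al f h : integral_generator al f -> ieval al h != 0 ->
  exists2 M : nat, (0 < M)%N & exists u q, u * h = (M%:Z)%:P + q * f.
Proof.
move=> [_ _ _ inj gen] h0; have [M M0 [u uE]] := gen (ieval al h)^-1.
exists M => //; exists u.
have [q qE] : exists q, u * h - (M%:Z)%:P = q * f.
  apply: inj; rewrite ievalB ievalM ievalC -uE mulfVK//.
  by rewrite subrr.
by exists q; rewrite -qE addrC subrK.
Qed.

Lemma ieval_deriv_neq0 al f : integral_generator al f -> ieval al f^`() != 0.
Proof.
move=> [fm f1 _ inj _]; apply/eqP => /inj[q fE].
have f0 : f != 0 by exact: monic_neq0.
have sd : (size f^`() < size f)%N by exact: lt_size_deriv.
have [q0|q0] := eqVneq q 0.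
  have : f^`()`_(size f).-2 = 0 by rewrite fE q0 mul0r coef0.
  move/monicP: fm; rewrite lead_coefE coef_deriv.
  case: (size f) f1 => [|[|s]]//= _ ->; lia.
have : (0 < size q)%N by rewrite size_poly_gt0.
move: sd; rewrite fE size_mul//.
case: (size q) => [|t] // + _; rewrite addSn /= => tlt.
by have := leq_ltn_trans (leq_addl t (size f)) tlt; rewrite ltnn.
Qed.

End Generator.

Section PolynomialNorm.
Context (n : nat) (f : {poly int}) (fm : f \is monic) (sf : size f = n.+2).

(* The integer matrix of multiplication by ['X] on [Z['X] / f]. *)
Definition companion : 'M[int]_n.+1 :=
  \matrix_(i, j) if i == ord_max then - f`_j else ((i.+1 == j :> nat)%:R : int).

(** The norm of the class of [h] in [Z[X] / f], in other words the resultant of [f] and [h]; as a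
    determinant it is visibly an integer and multiplicative. *)
Definition poly_norm (h : {poly int}) : int := \det (horner_mx companion h).

Lemma poly_normM g h : poly_norm (g * h) = poly_norm g * poly_norm h.
Proof. by rewrite /poly_norm rmorphM det_mulmx. Qed.

Lemma poly_normC (c : int) : poly_norm c%:P = c ^+ n.+1.
Proof. by rewrite /poly_norm horner_mx_C det_scalar. Qed.

Lemma companion_Vandermonde (L : fieldType) (r : 'rV[L]_n.+1) :
  (forall i, root (map_poly intr f) (r 0 i)) ->
  map_mx intr companion *m Vandermonde n.+1 r = Vandermonde n.+1 r *m diag_mx r.
Proof.
move=> fr; apply/matrixP => i j; rewrite mul_mx_diag !mxE.
under eq_bigr do rewrite !mxE.
have [->|iN] := eqVneq i ord_max.
  have := fr j; rewrite /root horner_coef size_map_poly_id0; last first.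
    by rewrite (monicP fm) rmorph1 oner_eq0.
  rewrite sf big_ord_recr/= coef_map/=.
  have -> : f`_n.+1 = 1 by move/monicP: fm; rewrite lead_coefE sf.
  rewrite rmorph1 mul1r addrC addr_eq0 exprS [r 0 j * _]mulrC => /eqP->.
  rewrite -sumrN; apply: eq_bigr => k _.
  by rewrite coef_map/= rmorphN mulNr.
have ilt : (i.+1 < n.+1)%N.
  have := ltn_ord i; rewrite ltnS leq_eqVlt ltnS => /orP[/eqP iE|//].
  by move/eqP: iN; case; apply: val_inj.
rewrite (bigD1 (Ordinal ilt))//= eqxx mul1r big1 ?addr0 ?exprSr// => k kN.
rewrite (_ : (i.+1 == k :> nat) = false) ?mul0r//.
by apply: contra_neqF kN => /eqP ik; apply: val_inj.
Qed.

Lemma horner_companion_Vandermonde (L : fieldType) (r : 'rV[L]_n.+1) h :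
  (forall i, root (map_poly intr f) (r 0 i)) ->
  map_mx intr (horner_mx companion h) *m Vandermonde n.+1 r =
  Vandermonde n.+1 r *m diag_mx (\row_i (map_poly intr h).[r 0 i]).
Proof.
move=> fr; rewrite map_horner_mx.
elim/poly_ind: h => [|h c IH].
  rewrite !rmorph0 mul0mx (_ : \row_i _ = 0) ?linear0//.
  by apply/rowP => i; rewrite !mxE horner0.
rewrite !rmorphD !rmorphM/= map_polyX map_polyC/= horner_mx_X horner_mx_C.
rewrite mulmxDl -mulmxA -/(map_mx _ _) companion_Vandermonde// mulmxA IH.
rewrite -mulmxA mulmx_diag mul_scalar_mx -mul_mx_scalar -mulmxDr -diag_const_mx.
rewrite -raddfD/=; congr (_ *m diag_mx _); apply/rowP => i.
by rewrite !mxE !hornerE.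
Qed.

(** The Vandermonde matrix of the distinct roots is invertible and diagonalises the companion
    matrix. [L] may have positive characteristic, so the formula also computes norms modulo a
    prime. *)
Lemma poly_normE (L : fieldType) (rho : 'I_n.+1 -> L) h : injective rho ->
  (forall i, root (map_poly intr f) (rho i)) ->
  (poly_norm h)%:~R = \prod_i (map_poly intr h).[rho i].
Proof.
move=> rhoI fr; pose r := \row_i rho i.
have fr' i : root (map_poly intr f) (r 0 i) by rewrite mxE.
have /(congr1 determinant) := horner_companion_Vandermonde h fr'.
rewrite !det_mulmx mulrC => /mulfI; rewrite det_diag det_map_mx => ->.
  by apply: eq_bigr => i _; rewrite !mxE.
rewrite det_Vandermonde; apply/prodf_neq0 => i _; apply/prodf_neq0 => j ij.
by rewrite !mxE subr_eq0 (inj_eq rhoI); apply: contraTneq ij => ->; rewrite ltnn.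
Qed.

(* A Bezout relation between [f] and its derivative makes the roots simple. *)
Lemma exists_roots (L : fieldType) (u q : {poly int}) (M : int) (s : seq L) :
  u * f^`() = M%:P + q * f -> M%:~R != 0 :> L ->
  map_poly intr f %= \prod_(z <- s) ('X - z%:P) ->
  exists2 rho : 'I_n.+1 -> L, injective rho &
    forall z, root (map_poly intr f) z = (z \in codom rho).
Proof.
move=> bz M0 fE.
have us : uniq s.
  rewrite -separable_prod_XsubC -(eqp_separable fE).
  rewrite unlock; apply/Bezout_eq1_coprimepP.
  exists (- (M%:~R^-1 *: map_poly intr q), M%:~R^-1 *: map_poly intr u) => /=.
  rewrite mulNr -!scalerAl deriv_map -!rmorphM/= bz addrC -scalerBr -rmorphB/= addrK.
  by rewrite map_polyC -mul_polyC -polyCM mulVf.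
have sfL : size (map_poly (intr : int -> L) f) = n.+2.
  by rewrite size_map_poly_id0 ?sf// (monicP fm) rmorph1 oner_eq0.
have ss : size s = n.+1.
  by have := eqp_size fE; rewrite sfL size_prod_XsubC => -[].
pose rho := fun i : 'I_n.+1 => nth 0 s i.
exists rho.
  move=> i j /eqP; rewrite nth_uniq ?ss// => /eqP; exact: val_inj.
move=> z; rewrite (eqp_root fE) root_prod_XsubC; apply/idP/codomP => [zs|[i ->]].
  have zi : (index z s < n.+1)%N by rewrite -ss index_mem.
  by exists (Ordinal zi); rewrite /rho nth_index.
by rewrite mem_nth ?ss.
Qed.

End PolynomialNorm.

Section GeneratorNorm.
Context {K : fieldExtType rat} (al : K) (n : nat) (f : {poly int}).
Hypotheses (gen : integral_generator al f) (sf : size f = n.+2).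
Local Notation D := (poly_norm n f).

Lemma poly_norm_congr g q h : g = h + q * f -> D g = D h.
Proof.
have [fm _ _ _ _] := gen => gE.
have [M M0 [u [q' bz]]] := ieval_bezout gen (ieval_deriv_neq0 gen).
have [s sE] := closed_field_poly_normal (map_poly (intr : int -> algC) f).
have lf : lead_coef (map_poly (intr : int -> algC) f) = 1.
  by rewrite lead_coef_map_eq (monicP fm) ?rmorph1 ?oner_eq0.
rewrite lf scale1r in sE.
have fE : map_poly intr f %= \prod_(z <- s) ('X - z%:P) by rewrite -sE eqpxx.
have M0' : (M%:Z)%:~R != 0 :> algC by rewrite intr_eq0; lia.
have [rho rhoI rhoE] := exists_roots fm sf bz M0' fE.
have fr i : root (map_poly intr f) (rho i) by rewrite rhoE codom_f.
apply: (@intr_inj algC); rewrite !(poly_normE fm sf _ rhoI fr).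
apply: eq_bigr => i _; rewrite gE rmorphD rmorphM/= hornerD hornerM.
by rewrite (rootP (fr i)) mulr0 addr0.
Qed.

Lemma poly_norm_eq g h : ieval al g = ieval al h -> D g = D h.
Proof.
move=> gh; have [_ _ _ inj _] := gen.
have [|q qE] := inj (g - h); first by rewrite ievalB gh subrr.
by apply: (@poly_norm_congr _ q); rewrite -qE addrC subrK.
Qed.

Lemma poly_norm_neq0 h : ieval al h != 0 -> D h != 0.
Proof.
move=> /(ieval_bezout gen)[M M0 [u [q uE]]].
have := poly_norm_congr uE; rewrite poly_normM poly_normC => DE.
have : D u * D h != 0 by rewrite DE expf_eq0 /=; lia.
by rewrite mulf_eq0 negb_or => /andP[].
Qed.

End GeneratorNorm.

(** * Places given by the roots of a polynomial modulo a prime *)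

Section RootReduction.
Context {p : nat} (p_prime : prime p) (L : fieldExtType 'F_p).

Lemma in_alg_intr (z : int) : GRing.in_alg L z%:~R = z%:~R.
Proof. by rewrite rmorph_int. Qed.

Lemma map_poly_Fp (h : {poly int}) :
  map_poly (GRing.in_alg L) (map_poly intr h) = map_poly intr h.
Proof. apply/polyP => i; rewrite coef_map/= coef_map/= coef_map/=; exact: in_alg_intr. Qed.

Lemma Fp_int_eq0 (z : int) : (z%:~R == 0 :> 'F_p) = (p %| `|z|)%N.
Proof.
rewrite (dvdn_pcharf (pchar_Fp p_prime)).
by case: (intP z) => [|k|k]; rewrite ?NegzE ?abszN ?rmorphN ?oppr_eq0.
Qed.

Lemma ext_int_eq0 (z : int) : (z%:~R == 0 :> L) = (p %| `|z|)%N.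
Proof. by rewrite -in_alg_intr fmorph_eq0 Fp_int_eq0. Qed.

Lemma Fp_poly_lift (h : {poly 'F_p}) : exists g : {poly int}, map_poly intr g = h.
Proof.
exists (map_poly (fun x : 'F_p => (x : nat)%:Z) h).
apply/polyP => i; rewrite coef_map coef_map_id0//=; exact: natr_Zp.
Qed.

Lemma Fp_poly_eq0 (h : {poly int}) : map_poly (intr : int -> 'F_p) h = 0 ->
  exists g, h = p%:Z *: g.
Proof.
move=> h0; exists (map_poly (fun z : int => (z %/ p)%Z) h).
apply/polyP => i; rewrite coefZ coef_map_id0 ?div0z// mulrC divzK// dvdzE/= -Fp_int_eq0.
by move/(congr1 (fun g : {poly 'F_p} => g`_i)): h0; rewrite coef_map coef0 => ->.
Qed.

(** Let [g] be the gcd of [f] and [h] modulo [p], and [E] lift the cofactor of [g] in [f]. Then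
    [E * h] is a multiple of [f] modulo [p], and [E] does not vanish at [r] because [g] does and the
    root is simple. *)
Lemma root_reduction (f h : {poly int}) (r : L) :
  (map_poly intr f).[r] = 0 -> (map_poly intr f^`()).[r] != 0 ->
  (map_poly intr h).[r] = 0 ->
  exists E q B, (map_poly intr E).[r] != 0 /\ E * h = q * f + p%:Z *: B.
Proof.
move=> f0 f'0 h0; pose red := map_poly (intr : int -> 'F_p).
pose g := gcdp (red f) (red h).
have gr : root (map_poly (GRing.in_alg L) g) r.
  by rewrite gcdp_map !map_poly_Fp root_gcd; apply/andP; split; apply/rootP.
have /dvdpP[e fE] : g %| red f by rewrite dvdp_gcdl.
have /dvdpP[h' hE] : g %| red h by rewrite dvdp_gcdr.
have [E EE] := Fp_poly_lift e; have [q qE] := Fp_poly_lift h'.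
have : red (E * h - q * f) = 0.
  by rewrite /red rmorphB !rmorphM/= EE qE -/red fE hE; ring.
move=> /Fp_poly_eq0[B BE]; exists E, q, B; split; last first.
  by rewrite -BE addrC subrK.
apply: contraNneq f'0 => E0.
rewrite -map_poly_Fp -deriv_map -/(red f) fE -EE derivM rmorphD !rmorphM/=.
by rewrite hornerD !hornerM map_poly_Fp E0 (rootP gr) mul0r mulr0 addr0.
Qed.

End RootReduction.

Section PlaceAtRoot.
Context {R : realType} {K : fieldExtType rat} (al : K) (f : {poly int}).
Context (gen : integral_generator al f) {p : nat} (p_prime : prime p).
Context (L : fieldExtType 'F_p) (r : L).
Hypotheses (f0 : (map_poly intr f).[r] = 0)
  (f'0 : (map_poly intr f^`()).[r] != 0).

Local Notation phi h := (map_poly (intr : int -> L) h).[r].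
Local Notation P := (p%:R : K).
Local Notation ev := (ieval al).

Let p_gt0 : (0 < p)%N. Proof. exact: prime_gt0. Qed.
Let P0 : P != 0. Proof. by rewrite natr_eq0_ext -lt0n. Qed.
Let pR0 : (0 : R) < p%:R. Proof. by rewrite ltr0n. Qed.
Let phiM g h : phi (g * h) = phi g * phi h.
Proof. by rewrite rmorphM hornerM. Qed.
Let phiC z : phi z%:P = z%:~R. Proof. by rewrite map_polyC hornerC. Qed.
Let phip : p%:R = 0 :> L.
Proof. by apply/eqP; have := ext_int_eq0 p_prime L p; rewrite /= dvdnn. Qed.

Lemma phi_congr g h : ev g = ev h -> phi g = phi h.
Proof.
have [_ _ _ inj _] := gen => gh; have [|q qE] := inj (g - h).
  by rewrite ievalB gh subrr.
have -> : g = h + q * f by rewrite -qE addrC subrK.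
by rewrite rmorphD hornerD phiM f0 mulr0 addr0.
Qed.

Let phiP g h k : (0 < k)%N -> ev g = P ^+ k * ev h -> phi g = 0.
Proof.
move=> k0 gh; rewrite (@phi_congr g ((p%:Z ^+ k)%:P * h)).
  by rewrite phiM phiC rmorphXn/= -[p%:Z%:~R]/(p%:R : L) phip expr0n gtn_eqF// mul0r.
by rewrite ievalM ievalC rmorphXn/=.
Qed.

Let nz h : phi h != 0 -> ev h != 0.
Proof.
apply: contraNneq => h0; rewrite (@phi_congr h 0) ?rmorph0 ?horner0//.
by rewrite h0 /ieval rmorph0 horner0.
Qed.

(* [root_val a x]: in the discrete valuation ring of the root [r], with residue
   map induced by [phi] and uniformiser [p], [a] is a unit times [p ^+ (j - i)]. *)
Definition root_val (a : K) (x : R) : Prop := exists i j H B,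
  [/\ phi H != 0, phi B != 0, ev H * P ^+ i * a = P ^+ j * ev B &
      x = p%:R ^+ i / p%:R ^+ j].

Lemma root_val_gt0 a x : root_val a x -> 0 < x.
Proof. by move=> [i [j [H [B [_ _ _ ->]]]]]; rewrite divr_gt0// exprn_gt0. Qed.

(** Cross-multiply the two presentations of [a]: in the wrong order of exponents, a product with
    nonzero residue would equal a multiple of a positive power of [p]. *)
Lemma root_val_le a x i j H G : phi H != 0 ->
  ev H * P ^+ i * a = P ^+ j * ev G -> root_val a x -> x <= p%:R ^+ i / p%:R ^+ j.
Proof.
move=> H0 E [i' [j' [H' [B [H'0 B0 E' ->]]]]].
rewrite ler_pdivlMr ?exprn_gt0// mulrAC ler_pdivrMr ?exprn_gt0// -!exprD.
have [le|lt] := leqP (i' + j) (i + j'); first by rewrite ler_weXn2l// ler1n.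
have := mulf_neq0 H0 B0; rewrite -phiM.
rewrite (@phiP (H * B) (H' * G) (i' + j - (i + j'))) ?eqxx ?subn_gt0//.
rewrite !ievalM; apply: (mulfI (expf_neq0 (i + j') P0)).
rewrite [RHS]mulrA -exprD subnKC; last exact: ltnW.
have a0 : a != 0.
  have : P ^+ j' * ev B != 0 by rewrite mulf_neq0 ?expf_neq0 ?nz.
  by rewrite -E'; apply: contraNneq => ->; rewrite mulr0.
apply: (mulfI a0); rewrite !exprD.
transitivity (ev H * P ^+ i * a * (P ^+ j' * ev B)); first by ring.
by rewrite E -E'; ring.
Qed.

Lemma root_val_uniq a x y : root_val a x -> root_val a y -> x = y.
Proof.
move=> ax ay; apply/eqP; rewrite eq_le; apply/andP; split.
  by have [i [j [H [B [H0 B0 E ->]]]]] := ay; exact: root_val_le H0 E ax.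
by have [i [j [H [B [H0 B0 E ->]]]]] := ax; exact: root_val_le H0 E ay.
Qed.

Lemma root_val_ieval_le1 h x : root_val (ev h) x -> x <= 1.
Proof.
move=> /(@root_val_le _ _ 0 0 1 h); rewrite !expr0 divr1; apply.
  by rewrite rmorph1 hornerC oner_eq0.
by rewrite /ieval rmorph1 hornerC !mul1r.
Qed.

Lemma root_val_unit h : phi h != 0 -> root_val (ev h) 1.
Proof.
move=> h0; exists 0, 0, 1, h; split=> //; last by rewrite !expr0 divr1.
  by rewrite rmorph1 hornerC oner_eq0.
by rewrite /ieval rmorph1 hornerC !mul1r.
Qed.

(** This is what makes [p] a uniformiser: up to the unit [ev E], whatever has residue 0 is divisible
    by [p]. *)
Let step h : phi h = 0 -> exists E B, phi E != 0 /\ ev E * ev h = P * ev B.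
Proof.
have [_ _ al0 _ _] := gen.
move=> /(root_reduction p_prime f0 f'0)[E [q [B [E0 EE]]]].
exists E, B; split=> //; rewrite -ievalM EE ievalD ievalM al0 mulr0 add0r.
by rewrite /ieval -mul_polyC rmorphM/= map_polyC hornerM hornerC.
Qed.

Lemma root_val_lt1 h x : phi h = 0 -> root_val (ev h) x -> x < 1.
Proof.
move=> /step[E [B [E0 EE]]] hx; apply: (@le_lt_trans _ _ (p%:R ^+ 0 / p%:R ^+ 1)).
  by apply: (root_val_le E0 _ hx); rewrite expr0 mulr1 expr1; exact: EE.
by rewrite expr0 mul1r expr1 invf_lt1// ltr1n prime_gt1.
Qed.

Let bound E M B j : phi E != 0 -> (0 < M)%N -> ev E * M%:R = P ^+ j * ev B ->
  (j <= logn p M)%N.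
Proof.
move=> E0 M0 EE; rewrite leqNgt; apply/negP => jM.
have [M' pM ME] := pfactor_coprime p_prime M0.
have : phi (E * M'%:Z%:P) != 0.
  rewrite phiM phiC mulf_neq0// (ext_int_eq0 p_prime)/= -prime_coprime//.
rewrite (@phiP _ B (j - logn p M)) ?eqxx ?subn_gt0// ievalM ievalC.
apply: (mulfI (expf_neq0 (logn p M) P0)).
rewrite [RHS]mulrA -exprD subnKC ?(ltnW jM)// -EE {2}ME natrM natrX mulrCA [P ^+ _ * _]mulrC.
by [].
Qed.

(** Factors [p] are removed until the residue is nonzero. The process stops because [ev h] divides a
    positive integer [M], whose p-adic valuation bounds the number of steps. *)
Lemma root_val_ieval_ex h : ev h != 0 -> exists x, root_val (ev h) x.
Proof.
move=> h0; have [M M0 [u [q uE]]] := ieval_bezout gen h0.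
have [_ _ al0 _ _] := gen.
have uM : ev u * ev h = M%:R by rewrite -ievalM uE ievalD ievalM al0 mulr0 addr0 ievalC.
have [//|N] := pselect (exists x, root_val (ev h) x).
have H j : exists E B, phi E != 0 /\ ev E * ev h = P ^+ j * ev B.
  elim: j => [|j [E [B [E0 EE]]]].
    by exists 1, h; rewrite rmorph1 hornerC oner_eq0 /ieval rmorph1 hornerC !mul1r.
  have [B0|B0] := eqVneq (phi B) 0; last first.
    exfalso; apply: N; exists (p%:R ^+ 0 / p%:R ^+ j), 0, j, E, B; split=> //.
    by rewrite expr0 mulr1.
  have [E' [B' [E'0 E'E]]] := step B0.
  exists (E' * E), B'; split; first by rewrite phiM mulf_neq0.
  by rewrite ievalM -mulrA EE mulrCA E'E mulrA exprSr.
have [E [B [E0 EE]]] := H (logn p M).+1.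
have : ((logn p M).+1 <= logn p M)%N; last by rewrite ltnn.
apply: (@bound E M (u * B)) => //.
by rewrite -uM mulrCA EE ievalM mulrCA.
Qed.

Lemma root_valM a b x y : root_val a x -> root_val b y -> root_val (a * b) (x * y).
Proof.
move=> [i [j [H [B [H0 B0 E ->]]]]] [i' [j' [H' [B' [H'0 B'0 E' ->]]]]].
exists (i + i'), (j + j'), (H * H'), (B * B'); rewrite !phiM !mulf_neq0//; split=> //.
  rewrite !ievalM !exprD.
  transitivity ((ev H * P ^+ i * a) * (ev H' * P ^+ i' * b)); first by ring.
  by rewrite E E'; ring.
by rewrite !exprD invfM; ring.
Qed.

Lemma root_valD a b x y z : root_val a x -> root_val b y -> root_val (a + b) z ->
  z <= Num.max x y.
Proof.
wlog xy : a b x y / y <= x => [wl ax b_y abz|].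
  have [yx|/ltW xy] := leP y x; first by have := wl _ _ _ _ yx ax b_y abz; rewrite max_l.
  by have := wl _ _ _ _ xy b_y ax; rewrite addrC => /(_ abz); rewrite max_l// max_r.
move=> + + abz; rewrite max_l//.
move=> [i [j [H [B [H0 B0 E xE]]]]] [i' [j' [H' [B' [H'0 B'0 E' yE]]]]].
have le : (i' + j <= i + j')%N.
  move: xy; rewrite xE yE ler_pdivlMr ?exprn_gt0// mulrAC ler_pdivrMr ?exprn_gt0//.
  by rewrite -!exprD ler_eXn2l// ltr1n prime_gt1.
have -> : x = p%:R ^+ (i + i') / p%:R ^+ (i' + j).
  by rewrite xE !exprD; field; rewrite !expf_neq0// gt_eqF.
apply: (@root_val_le _ _ _ _ (H * H') (H' * B + (p%:Z ^+ (i + j' - (i' + j)))%:P * H * B')) abz.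
  by rewrite phiM mulf_neq0.
rewrite ievalD !ievalM ievalC rmorphXn/=.
transitivity (ev H' * P ^+ i' * (P ^+ j * ev B) + P ^+ (i + j') * ev H * ev B').
  rewrite -E mulrDr exprD; congr (_ + _); first by ring.
  rewrite [LHS](_ : _ = ev H * P ^+ i * (ev H' * P ^+ i' * b)); last by ring.
  by rewrite E' exprD; ring.
rewrite -[p%:Z%:~R]/P.
have -> : P ^+ (i + j') = P ^+ (i' + j) * P ^+ (i + j' - (i' + j)) by rewrite -exprD subnKC.
by rewrite exprD; move: (P ^+ (_ - _)) => Q; ring.
Qed.

Lemma root_val_ex a : a != 0 -> exists x, root_val a x.
Proof.
move=> a0; have [_ _ _ _ frac] := gen; have [M M0 [h hE]] := frac a.
have M0' : M%:R != 0 :> K by rewrite natr_eq0_ext -lt0n.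
have [x xM] : exists x, root_val (ev M%:Z%:P) x by apply: root_val_ieval_ex; rewrite ievalC.
have [y yh] : exists y, root_val (ev h) y by apply: root_val_ieval_ex; rewrite -hE mulf_neq0.
exists (y / x); have [i [j [H [B [H0 B0 E xE]]]]] := xM.
have -> : a = ev h * (ev M%:Z%:P)^-1 by rewrite -hE ievalC mulrC mulKf.
apply: root_valM => //; exists j, i, B, H; split=> //; last by rewrite xE invf_div.
have M0'' : ev M%:Z%:P != 0 by rewrite ievalC.
apply: (mulIf M0''); rewrite mulfVK//.
transitivity (ev H * p%:R ^+ i * ev M%:Z%:P); last by ring.
by rewrite E mulrC.
Qed.

Lemma exists_place_of_root : exists v : place R K,
  [/\ ultra v, v p%:R < 1, forall h, v (ieval al h) <= 1 &
      forall h, (v (ieval al h) < 1) = ((map_poly intr h).[r] == 0)].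
Proof.
have /choice[w wP] : forall a, exists x, (a != 0 -> root_val a x) /\ (a = 0 -> x = 0).
  move=> a; have [->|a0] := eqVneq a 0; first by exists 0.
  by have [x ax] := root_val_ex a0; exists x; split=> // /eqP; rewrite (negPf a0).
have w0 : w 0 = 0 by exact: (wP 0).2.
have wv a : a != 0 -> root_val a (w a) by move=> /(wP a).1.
have wge0 a : 0 <= w a.
  have [->|a0] := eqVneq a 0; first by rewrite w0.
  exact: ltW (root_val_gt0 (wv _ a0)).
have weq0 a : w a = 0 <-> a = 0.
  split=> [wa|->//]; apply/eqP; apply: contraT => a0.
  by have := root_val_gt0 (wv _ a0); rewrite wa ltxx.
have wM a b : w (a * b) = w a * w b.
  have [->|a0] := eqVneq a 0; first by rewrite !mul0r w0 mul0r.
  have [->|b0] := eqVneq b 0; first by rewrite !mulr0 w0 mulr0.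
  by apply: (@root_val_uniq (a * b)); [apply: wv; rewrite mulf_neq0|apply: root_valM; apply: wv].
have wU a b : w (a + b) <= Num.max (w a) (w b).
  have [->|a0] := eqVneq a 0; first by rewrite add0r le_max lexx orbT.
  have [->|b0] := eqVneq b 0; first by rewrite addr0 le_max lexx.
  have [->|ab0] := eqVneq (a + b) 0; first by rewrite w0 le_max wge0.
  by apply: (@root_valD a b); apply: wv.
have wD a b : w (a + b) <= w a + w b.
  by rewrite (le_trans (wU a b))// ge_max lerDl lerDr !wge0.
pose W := AbsVal wge0 weq0 wM wD.
have wlt h : (w (ev h) < 1) = (phi h == 0).
  have [h0|h0] := eqVneq (ev h) 0.
    rewrite h0 w0 ltr01 (@phi_congr h 0) ?rmorph0 ?horner0 ?eqxx//.
    by rewrite h0 /ieval rmorph0 horner0.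
  have [p0|p0] := eqVneq (phi h) 0; first by rewrite (root_val_lt1 p0 (wv _ h0)).
  by rewrite (root_val_uniq (wv _ h0) (root_val_unit p0)) ltxx.
have wp : w P < 1.
  by rewrite [P](_ : _ = ev p%:Z%:P) ?wlt ?phiC ?ievalC// -[p%:Z%:~R]/(p%:R : L) phip eqxx.
have nt : `[< exists x, x != 0 /\ W x != 1 >].
  by apply/asboolP; exists P; split=> //; rewrite lt_eqF.
pose v0 : nontrivial_absval R K := exist _ W nt.
(* The representative of the class is only a positive power of [w]; the four conclusions are
   insensitive to such a power. *)
have /asboolP[s [s0 vE]] : absval_equiv v0 (repr (\pi_(place R K)%qT v0)).
  by apply/eqmodP; rewrite reprK.
exists (\pi_(place R K)%qT v0).
have {}vE x : (\pi_(place R K)%qT v0 : place R K) x = w x `^ s by exact: vE.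
have n1 : (1 : R) \is Num.nneg by rewrite nnegrE ler01.
have lt1 x : ((\pi_(place R K)%qT v0 : place R K) x < 1) = (w x < 1).
  rewrite vE; have [w1|w1] := ltP (w x) 1.
    by have := gt0_ltr_powR s0 (wge0 x) n1 w1; rewrite powR1.
  by have := ge0_ler_powR (ltW s0) n1 (wge0 x) w1; rewrite powR1 leNgt => /negbTE.
have mono x y : w x <= w y -> w x `^ s <= w y `^ s.
  by move=> xy; exact: ge0_ler_powR (ltW s0) _ _ (wge0 x) (wge0 y) xy.
split=> [x y||h|h]; rewrite ?lt1//.
  rewrite !vE; have := wU x y; rewrite !le_max.
  by case/orP => /mono ->; rewrite ?orbT.
have hle : w (ev h) <= 1.
  have [h0|h0] := eqVneq (ev h) 0; first by rewrite h0 w0.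
  exact: root_val_ieval_le1 (wv _ h0).
by have := ge0_ler_powR (ltW s0) (wge0 _) n1 hle; rewrite powR1 -vE.
Qed.

End PlaceAtRoot.

(** Euclid's argument: with [c = f.[0]], the value of [f] at [c * w] is [c] times a number congruent
    to 1 modulo [w]. Taking [w] divisible by all primes up to [N] forces larger prime divisors,
    provided the second factor is not a unit. *)
Lemma exists_prime_divisor_value (f : {poly int}) (N : nat) : (1 < size f)%N ->
  exists p z, [/\ prime p, (N < p)%N & (p%:Z %| f.[z])%Z].
Proof.
move=> f1; have [p0|f00] := eqVneq f.[0] 0.
  have [p pN pp] := prime_above N; exists p, 0; split=> //.
  by rewrite p0 dvdz0.
pose c := f.[0]; pose w (t : nat) : int := (N`! * t)%N.
have [g gE] : exists g, f = g * 'X + c%:P.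
  have /factor_theorem[g gE] : root (f - c%:P) 0 by rewrite /root !hornerE subrr.
  by exists g; rewrite subr0 in gE; rewrite -gE subrK.
have fE t : f.[c * w t] = c * (w t * g.[c * w t] + 1).
  by rewrite {1}gE hornerMXaddC; ring.
(* The factor is 1 or -1 only at roots of [(f - c) * (f + c)], which are finitely many. *)
have [t tE] : exists t : nat, absz (w t * g.[c * w t] + 1) != 1%N.
  have q0 : (f - c%:P) * (f + c%:P) != 0.
    have sD a : f + a%:P != 0.
      have sa : (size a%:P < size f)%N := leq_ltn_trans (size_polyC_leq1 a) f1.
      by rewrite -size_poly_gt0 size_polyDl// (leq_trans _ f1).
    by rewrite mulf_neq0// -polyCN.
  have [t tN] : exists t : nat, ~~ root ((f - c%:P) * (f + c%:P)) (c * w t).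
    set q := _ * _ in q0 *; apply: contrapT => N'.
    have all_root t : root q (c * w t) by apply: contrapT => /negP tN; apply: N'; exists t.
    have := @max_poly_roots _ q [seq c * w t | t <- iota 0 (size q)] q0.
    rewrite size_map size_iota ltnn => H; suff: false by [].
    apply: H; first by apply/allP => _ /mapP[t _ ->].
    rewrite map_inj_uniq ?iota_uniq// => x y /(mulfI f00) [].
    by move/eqP; rewrite eqn_pmul2l ?fact_gt0// => /eqP.
  exists t; apply: contraNneq tN => w1.
  rewrite /root !hornerE fE.
  have [->|->] : w t * g.[c * w t] + 1 = 1 \/ w t * g.[c * w t] + 1 = -1 by lia.
    by rewrite mulr1 subrr mul0r.
  by rewrite mulrN1 addNr mulr0.
have [k0|k0] := posnP (absz (w t * g.[c * w t] + 1)).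
  have [p pN pp] := prime_above N; exists p, (c * w t); split=> //.
  by rewrite fE (_ : _ + 1 = 0) ?mulr0 ?dvdz0//; lia.
set k := absz _ in tE k0.
have kgt1 : (1 < k)%N by lia.
exists (pdiv k), (c * w t); split; first exact: pdiv_prime.
  rewrite ltnNge; apply/negP => le.
  have : (pdiv k %| N`!)%N by rewrite dvdn_fact// pdiv_gt0.
  have pk : ((pdiv k)%:Z %| w t * g.[c * w t] + 1)%Z by rewrite dvdzE pdiv_dvd.
  move=> pN; have : ((pdiv k)%:Z %| w t * g.[c * w t])%Z.
    by rewrite dvdz_mulr// dvdzE/= dvdn_mulr.
  move=> /(rpredB pk); rewrite addrC addKr => p1.
  have := pdiv_prime kgt1; case: (pdiv k) p1 => [|[|s]]//.
by rewrite fE dvdz_mull// dvdzE pdiv_dvd.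
Qed.

Section RootPlaces.
Context {R : realType} {K : fieldExtType rat} (al : K) (n : nat) (f : {poly int}).
Context (gen : integral_generator al f) (sf : size f = n.+2).

(* The residue map of [v i] is evaluation at [rho i]; conjugate roots give the
   same place, so [v] need not be injective. *)
Definition root_places (p : nat) (L : fieldExtType 'F_p) (rho : 'I_n.+1 -> L)
    (v : 'I_n.+1 -> place R K) : Prop :=
  [/\ injective rho, forall z, root (map_poly intr f) z = (z \in codom rho),
      forall i, ultra (v i) /\ v i p%:R < 1,
      forall i h, v i (ieval al h) <= 1 &
      forall i h, (v i (ieval al h) < 1) = ((map_poly intr h).[rho i] == 0)].

(** [D] comes from a Bezout relation between [f] and its derivative: modulo any other prime the
    roots are simple, and each of them gives a place. *)
Lemma exists_root_places : exists2 D : nat, (0 < D)%N &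
  forall p, prime p -> ~~ (p %| D)%N -> exists L rho v, @root_places p L rho v.
Proof.
have [fm _ _ _ _] := gen.
have [D D0 [u [q bz]]] := ieval_bezout gen (ieval_deriv_neq0 gen).
exists D => // p pp pD.
have f0 : map_poly (intr : int -> 'F_p) f != 0.
  by rewrite map_poly_eq0_id0 ?monic_neq0// (monicP fm) rmorph1 oner_eq0.
have [L [s]] := FinSplittingFieldFor f0; rewrite map_poly_Fp => fE _.
have D0' : (D%:Z)%:~R != 0 :> L by rewrite ext_int_eq0.
have [rho rhoI rhoE] := exists_roots fm sf bz D0' fE.
have fr i : (map_poly intr f).[rho i] = 0 by apply/rootP; rewrite rhoE codom_f.
have f'r i : (map_poly intr f^`()).[rho i] != 0.
  apply: contraNneq D0' => f'0.
  move/(congr1 (fun g : {poly int} => (map_poly (intr : int -> L) g).[rho i])): bz.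
  rewrite rmorphM rmorphD rmorphM/= map_polyC hornerD !hornerM f'0 fr !mulr0 addr0 hornerC.
  by move=> <-.
have /choice[v vP] i := @exists_place_of_root R K al f gen p pp L (rho i) (fr i) (f'r i).
exists L, rho, v; split=> // i.
- by have [] := vP i.
- by have [] := vP i.
- by have [] := vP i.
Qed.

Lemma exists_ultra_place : exists v : place R K, ultra v.
Proof.
have [D D0 DP] := exists_root_places; have [p pD pp] := prime_above D.
have [|L [rho [v [_ _ uv _ _]]]] := DP p pp.
  by apply: contraL pD => /(dvdn_leq D0); rewrite -leqNgt.
by exists (v ord0); have [] := uv ord0.
Qed.

Section AtPrime.
Context {p : nat} (pp : prime p) {L : fieldExtType 'F_p}
  {rho : 'I_n.+1 -> L} {v : 'I_n.+1 -> place R K}.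
Hypothesis (rp : root_places rho v).
Local Notation phi i h := (map_poly (intr : int -> L) h).[rho i].

Lemma root_places_norm h : (poly_norm n f h)%:~R = \prod_i phi i h.
Proof.
have [fm _ _ _ _] := gen; have [rhoI rhoE _ _ _] := rp.
by apply: (poly_normE fm sf) => // i; rewrite rhoE codom_f.
Qed.

Lemma root_places_norm_eq0 h : (p %| `|poly_norm n f h|)%N = [exists i, phi i h == 0].
Proof.
rewrite -(ext_int_eq0 pp L) root_places_norm; apply/eqP/existsP => [/eqP|[i /eqP i0]].
  by rewrite prodf_seq_eq0 => /hasP[i _ /= i0]; exists i.
by apply/eqP; rewrite prodf_seq_eq0; apply/hasP; exists i; rewrite ?mem_index_enum ?i0/=.
Qed.

(** Modulo [p], [f] is the product of the linear factors at the distinct [rho i], so it divides [h];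
    this amounts to [Z[al]] being maximal at [p]. *)
Lemma root_places_divisible h : (forall i, phi i h = 0) ->
  exists B, ieval al h = p%:R * ieval al B.
Proof.
have [fm _ al0 _ _] := gen; have [rhoI rhoE _ _ _] := rp => h0.
have fL : map_poly (intr : int -> L) f = \prod_(z <- codom rho) ('X - z%:P).
  have mf : map_poly (intr : int -> L) f \is monic by apply: monic_map.
  rewrite [LHS](@all_roots_prod_XsubC _ _ (codom rho)) ?(monicP mf) ?scale1r//.
  - by rewrite size_codom card_ord size_map_poly_id0 ?sf// (monicP fm) rmorph1 oner_eq0.
  - by apply/allP => z; rewrite rhoE.
  - by rewrite uniq_rootsE; apply/injectiveP.
have : map_poly (intr : int -> L) f %| map_poly intr h.
  rewrite fL; apply: uniq_roots_dvdp; first by apply/allP => _ /codomP[i ->]; apply/rootP.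
  by rewrite uniq_rootsE; apply/injectiveP.
rewrite -!map_poly_Fp dvdp_map => /dvdpP[e hE].
have [q qE] := Fp_poly_lift e.
have /(Fp_poly_eq0 pp)[B BE] : map_poly (intr : int -> 'F_p) (h - q * f) = 0.
  by rewrite rmorphB rmorphM/= qE hE subrr.
exists B; have -> : h = q * f + p%:Z *: B by rewrite -BE addrC subrK.
by rewrite ievalD ievalM al0 mulr0 add0r /ieval -mul_polyC rmorphM/= map_polyC hornerM hornerC.
Qed.

Lemma root_places_nat_lt1 i (M : nat) : (v i M%:R < 1) = (p %| M)%N.
Proof.
have [_ _ _ _ vphi] := rp.
have -> : M%:R = ieval al M%:Z%:P by rewrite ievalC.
by rewrite vphi map_polyC hornerC (ext_int_eq0 pp).
Qed.

Lemma root_places_nat_eq1 i (M : nat) : ~~ (p %| M)%N -> v i M%:R = 1.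
Proof.
have [_ _ uv _ _] := rp; rewrite -(root_places_nat_lt1 i) -leNgt => le.
by apply/le_anti; rewrite le (ultra_nat (uv i).1).
Qed.

End AtPrime.

(* Take the least denominator. *)
Lemma exists_coprime_denominator (c : K) : exists M h, [/\ (0 < M)%N,
  M%:R * c = ieval al h & forall p (L : fieldExtType 'F_p) (rho : 'I_n.+1 -> L) v,
    prime p -> root_places rho v -> (forall i, v i c <= 1) -> ~~ (p %| M)%N].
Proof.
have [_ _ _ _ frac] := gen.
have exM : exists M, (0 < M)%N && `[< exists h, M%:R * c = ieval al h >].
  by have [M M0 hE] := frac c; exists M; rewrite M0; apply/asboolP.
case: (ex_minnP exM) => M /andP[M0 /asboolP[h hE]] Mmin.
exists M, h; split=> // p L rho v pp rp vc; apply/negP => /dvdnP[M' ME].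
have [_ _ uv _ vphi] := rp.
have [i|B BE] := root_places_divisible pp rp (h := h).
  apply/eqP; rewrite -vphi -hE absvalM (@le_lt_trans _ _ (v i M%:R))//.
    by rewrite ler_piMr ?absval_ge0.
  by rewrite (root_places_nat_lt1 pp rp) ME dvdn_mull.
have M'0 : (0 < M')%N by move: M0; rewrite ME; case: (M').
have : (M <= M')%N.
  apply: Mmin; rewrite M'0; apply/asboolP; exists B.
  have p0 : p%:R != 0 :> K by rewrite natr_eq0_ext -lt0n prime_gt0.
  by apply: (mulfI p0); rewrite -BE -hE ME natrM; ring.
by rewrite ME leqNgt ltn_Pmulr ?prime_gt1.
Qed.

(** Weak approximation gives one [b'] having the prescribed values at all the places [v i]. Then
    [ieval al h] is [b' ^+ 2] times an element that is a unit at all of them, and the norm of such a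
    unit is prime to [p]. *)
Lemma even_logn_norm p (L : fieldExtType 'F_p) (rho : 'I_n.+1 -> L) v h :
  prime p -> root_places rho v -> ieval al h != 0 ->
  (forall i, exists b, v i (ieval al h) = v i b ^+ 2) ->
  ~~ odd (logn p `|poly_norm n f h|).
Proof.
move=> pp rp h0 vb; have [rhoI rhoE uv vle vphi] := rp.
have vh0 (w : place R K) : 0 < w (ieval al h) by rewrite absval_gt0.
have vbn i b : v i (ieval al h) = v i b ^+ 2 -> 0 < v i b.
  move=> bE; rewrite absval_gt0; apply: contraTneq (vh0 (v i)) => b0.
  by rewrite bE b0 absval0 expr0n/= ltxx.
(* [b] is indexed by places and not by roots, since conjugate roots share a place. *)
have /choice[b bE] w : exists b, range v w -> w (ieval al h) = w b ^+ 2.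
  have [[i _ <-]|N] := pselect (range v w); last by exists 0.
  by have [b bE] := vb i; exists b.
have [a aE] : exists a : 'I_1 -> K, forall w, range v w -> forall i, w (a i - b w) < w (b w).
  apply: (@weak_approximation R K _ _ (fun w _ => b w) (fun w => w (b w))).
    by apply: finite_image; exact: finite_finset.
  by move=> _ [i _ <-]; apply: vbn; apply: bE; exists i.
pose b' := a 0; have b'E i : v i b' = v i (b (v i)).
  by apply: (ultra_close (uv i).1); apply: aE; exists i.
have {}bE i : v i (ieval al h) = v i b' ^+ 2 by rewrite b'E; apply: bE; exists i.
have vb0 i : 0 < v i b' by exact: vbn.
pose c := ieval al h / b' ^+ 2.
have vc i : v i c = 1.
  by rewrite /c absvalM absvalV absvalX bE mulfV// expf_neq0 ?gt_eqF.
have [M [d [M0 dE pM]]] := exists_coprime_denominator c.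
have {}pM : ~~ (p %| M)%N by apply: pM rp _ => // i; rewrite vc.
have [_ _ _ _ /(_ b')[M' M'0 [g gE]]] := gen.
have Dd : ~~ (p %| `|poly_norm n f d|)%N.
  rewrite (root_places_norm_eq0 pp rp); apply/existsPn => i.
  by rewrite -vphi -dE absvalM vc mulr1 -leNgt (root_places_nat_eq1 pp rp).
have b'0 : b' != 0.
  have := vb0 ord0; rewrite absval_gt0; exact.
(* An identity between integral elements, to which the norm applies: [M'] and [g] enter squared,
   while [M] and the norm of [d] are prime to [p]. *)
have E : ieval al (h * (M'%:Z ^+ 2)%:P * M%:Z%:P) = ieval al (g * g * d).
  rewrite !ievalM !ievalC rmorphXn/= -gE -dE /c -[M%:Z%:~R]/(M%:R : K) -[M'%:Z%:~R]/(M'%:R : K).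
  by field.
have := poly_norm_eq gen sf E; rewrite !poly_normM !poly_normC => DE.
have g0 : ieval al g != 0 by rewrite -gE mulf_neq0// natr_eq0_ext -lt0n.
have Dg0 := poly_norm_neq0 gen sf g0; have Dh0 := poly_norm_neq0 gen sf h0.
have := congr1 (fun z : int => logn p `|z|%N) DE.
rewrite /= !abszM !abszX /= !lognM ?muln_gt0 ?expn_gt0 ?absz_gt0 ?Dg0 ?Dh0 ?M0 ?M'0//; last first.
  by apply: contraNneq Dd => ->; rewrite absz0 dvdn0.
rewrite !lognX (lognE p M) (negPf pM) !andbF muln0 addn0.
rewrite [in RHS](lognE p `|poly_norm n f d|%N) (negPf Dd) !andbF addn0 => H.
have := congr1 odd H; rewrite oddD [in RHS]oddD addbb !oddM /= andbF addbF => ->.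
by [].
Qed.

End RootPlaces.

(** * Density of Darmon points *)

Lemma nat_square_of_even_logn (k : nat) : (0 < k)%N ->
  (forall p, prime p -> ~~ odd (logn p k)) -> exists j, k = (j ^ 2)%N.
Proof.
move=> k0 ev; exists (\prod_(p <- primes k) p ^ (logn p k)./2)%N.
rewrite [LHS](prod_prime_decomp k0) prime_decompE big_map/=.
rewrite (big_morph (fun j => j ^ 2)%N (fun x y => expnMn x y 2) (exp1n 2)).
rewrite big_seq [RHS]big_seq; apply: eq_bigr => p; rewrite mem_primes => /and3P[pp _ _].
by rewrite -expnM muln2 even_halfK// ev.
Qed.

(* Otherwise the squares are closed under addition, hence everything is a square. *)
Lemma exists_nonsquare_norm (p : nat) (k : 'F_p) : prime p -> odd p -> k != 0 ->
  exists s t : int, forall w : 'F_p, s%:~R ^+ 2 + k * t%:~R ^+ 2 != w ^+ 2.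
Proof.
move=> pp op k0; apply: contrapT => N.
have sq (s t : nat) : exists w : 'F_p, s%:R ^+ 2 + k * t%:R ^+ 2 = w ^+ 2.
  apply: contrapT => N'; apply: N; exists s%:Z, t%:Z => w; apply/eqP => e.
  by apply: N'; exists w.
have [l lE] := sq 0 1; rewrite expr0n/= add0r expr1n mulr1 in lE.
have l0 : l != 0 by apply: contraNneq k0 => l0; rewrite lE l0 expr0n.
have sum (a b : 'F_p) : exists w, a ^+ 2 + b ^+ 2 = w ^+ 2.
  have [w wE] := sq a (b / l : 'F_p); exists w; rewrite -wE !natr_Zp lE.
  by rewrite -exprMn mulrC divfK.
have all_sq (a : 'F_p) : exists w, a = w ^+ 2.
  suff sqn (j : nat) : exists w : 'F_p, j%:R = w ^+ 2 by rewrite -[a]natr_Zp; exact: sqn.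
  elim: j => [|j [w wE]]; first by exists 0; rewrite expr0n.
  by have [w' w'E] := sum w 1; exists w'; rewrite -w'E expr1n mulrSr wE.
have /choice[g gK] := all_sq.
have sqI : injective (fun a : 'F_p => a ^+ 2).
  have gI : injective g by apply: (can_inj (g := fun a => a ^+ 2)) => a; rewrite -gK.
  have [g' gg' g'g] := injF_bij gI.
  by move=> a b /= ab; rewrite -[a]g'g -[b]g'g; congr g; rewrite [LHS]gK [RHS]gK !g'g.
have /sqI/eqP : (1 : 'F_p) ^+ 2 = (-1) ^+ 2 by rewrite sqrrN.
rewrite -subr_eq0 opprK -[1 + 1]/(2%:R) -(dvdn_pcharf (pchar_Fp pp)) dvdn_prime2//.
by move=> /eqP p2; rewrite p2 in op.
Qed.

(** Here [h] and [d] are norms modulo a prime, [h] arising from [d] by trading the residue [a] for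
    [b], up to a square. A square product [h * d] would make the chosen nonsquare a square. *)
Lemma square_ratio (E : fieldType) (G a b c d h s t w : E) :
  G != 0 -> d != 0 -> a != 0 -> b = s ^+ 2 * a + t ^+ 2 * c ->
  h * a = G ^+ 2 * d * b -> h * d = w ^+ 2 ->
  s ^+ 2 + c / a * t ^+ 2 = (w / (G * d)) ^+ 2.
Proof.
move=> G0 d0 a0 bE ha hd; have -> : s ^+ 2 + c / a * t ^+ 2 = b / a.
  by rewrite bE; field.
have hE : h = G ^+ 2 * d * b / a by rewrite -ha mulfK.
by rewrite expr_div_n -hd hE; field; rewrite a0 d0 G0.
Qed.

Lemma square_transfer (E : fieldType) (a b c k w : E) : a != 0 -> a * b = k ^+ 2 ->
  a * c = w ^+ 2 -> b * c = (k * w / a) ^+ 2.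
Proof. by move=> a0 ab ac; rewrite expr_div_n exprMn -ab -ac; field. Qed.

(** * Prescribing the quadratic character of a norm modulo a prime *)

Section SpecialPrime.
Context {R : realType} {K : fieldExtType rat} (al : K) (n : nat) (f : {poly int}).
Context (gen : integral_generator al f) (sf : size f = n.+2).
Local Notation D := (poly_norm n f).

Definition place_system (p : nat) (Z : set (place R K)) : Prop :=
  exists (L : fieldExtType 'F_p) (rho : 'I_n.+1 -> L) v,
    root_places al f rho v /\ Z = range v.

Lemma place_system_finite p Z : place_system p Z -> finite_set Z.
Proof. by move=> [L [rho [v [_ ->]]]]; apply: finite_image; exact: finite_finset. Qed.

Lemma place_system_ultra p Z w : place_system p Z -> Z w -> ultra w /\ w p%:R < 1.
Proof. by move=> [L [rho [v [[_ _ uv _ _] ->]]]] [i _ <-]. Qed.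

Definition Fp_square (p : nat) (z : int) : Prop := exists w : 'F_p, z%:~R = w ^+ 2.

(* With [e] set, only the residue at [v1], a place of degree 1, is changed; this
   multiplies the norm modulo [l] by a nonsquare [s ^+ 2 + C / A * t ^+ 2]. *)
Lemma special_prime (l : nat) (Z : set (place R K)) (A C : {poly int}) (z : int) :
  prime l -> odd l -> place_system l Z -> (l%:Z %| f.[z])%Z ->
  (forall v, Z v -> v (ieval al A) = 1) -> (forall v, Z v -> v (ieval al C) = 1) ->
  exists v1 (s t : int), [/\ Z v1,
    v1 (s%:~R ^+ 2 * ieval al A + t%:~R ^+ 2 * ieval al C) = 1 &
    forall (e : bool) (M : nat) H, ~~ (l %| M)%N ->
      (forall v, Z v -> v (ieval al H - M%:R ^+ 2 * (if e && (v == v1)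
         then s%:~R ^+ 2 * ieval al A + t%:~R ^+ 2 * ieval al C else ieval al A)) < 1) ->
      ~~ (l %| `|D H|)%N /\ (Fp_square l (D H * D A) <-> ~~ e)].
Proof.
move=> lp lodd [L [rho [v [rp ->]]]] fz vA vC; have [rhoI rhoE uv vle vphi] := rp.
pose phi i h := (map_poly (intr : int -> L) h).[rho i].
have fz0 : root (map_poly intr f) (z%:~R : L).
  by rewrite /root horner_map/= ext_int_eq0// -dvdzE.
have [i0 zi0] : exists i, z%:~R = rho i by apply/codomP; rewrite -rhoE.
have phi0 h : phi i0 h = h.[z]%:~R by rewrite /phi -zi0 horner_map.
(* ['X - z%:P] has residue 0 at the rational root only, so this place belongs to one index, and
   changing the residue there changes a single factor of the norm. *)
have vi0 i : v i = v i0 -> i = i0.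
  move=> vi; apply: rhoI; rewrite -zi0; apply/eqP; rewrite -subr_eq0.
  have := vphi i ('X - z%:P); rewrite rmorphB/= map_polyX map_polyC !hornerE /= => <-.
  rewrite vi vphi rmorphB/= map_polyX map_polyC !hornerE/= -zi0 subrr.
  exact: eqxx.
have nz i h : v i (ieval al h) = 1 -> phi i h != 0.
  by move=> h1; rewrite -vphi h1 ltxx.
have A0 i : phi i A != 0 by apply: nz; apply: vA; exists i.
have C0 i : phi i C != 0 by apply: nz; apply: vC; exists i.
have io : {rmorphism 'F_l -> L} := GRing.in_alg L.
set a : 'F_l := A.[z]%:~R; set c : 'F_l := C.[z]%:~R.
have toL (h : {poly int}) : io h.[z]%:~R = phi i0 h by rewrite phi0 rmorph_int.
have aL : io a = phi i0 A := toL A.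
have cL : io c = phi i0 C := toL C.
have a0 : a != 0 by rewrite -(fmorph_eq0 (io)) aL.
have c0 : c != 0 by rewrite -(fmorph_eq0 (io)) cL.
have [|s [t st]] := @exists_nonsquare_norm l (c / a) lp lodd.
  by rewrite mulf_neq0 ?invr_eq0.
pose W := (s ^+ 2)%:P * A + (t ^+ 2)%:P * C.
have WE : ieval al W = s%:~R ^+ 2 * ieval al A + t%:~R ^+ 2 * ieval al C.
  by rewrite ievalD !ievalM !ievalC !rmorphXn.
pose b : 'F_l := s%:~R ^+ 2 * a + t%:~R ^+ 2 * c.
have WzE : W.[z]%:~R = b :> 'F_l.
  by rewrite /W hornerD !hornerM !hornerC rmorphD !rmorphM /b !expr2.
have bE : b = a * (s%:~R ^+ 2 + c / a * t%:~R ^+ 2).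
  by rewrite mulrDr [a * (c / a * _)]mulrA [a * (c / a)]mulrC divfK// [a * _]mulrC [c * _]mulrC.
have b0 : b != 0.
  by have := st 0; rewrite expr0n/= => h; rewrite bE mulf_neq0.
have W0 : phi i0 W != 0 by rewrite -toL WzE fmorph_eq0.
exists (v i0), s, t; split; first by exists i0.
  rewrite -WE; apply/le_anti; rewrite vle leNgt vphi; exact: W0.
move=> e M H lM hH.
have M0 : M%:R != 0 :> L by have := ext_int_eq0 lp L M; rewrite /= => ->.
pose X i := if e && (i == i0) then W else A.
have phiH i : phi i H = M%:R ^+ 2 * phi i (X i).
  have := hH (v i) (ex_intro2 _ _ i I erefl).
  have -> : (v i == v i0) = (i == i0) by apply/eqP/eqP => [/vi0//|->].
  rewrite -WE -(fun_if (ieval al)) -/(X i).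
  have -> : ieval al H - M%:R ^+ 2 * ieval al (X i) =
      ieval al (H - (M%:Z ^+ 2)%:P * X i) by rewrite ievalB ievalM ievalC rmorphXn.
  rewrite vphi rmorphB rmorphM/= map_polyC hornerD hornerN hornerM hornerC/= subr_eq0.
  by rewrite rmorphXn => /eqP.
split.
  rewrite (root_places_norm_eq0 gen sf lp rp); apply/existsPn => i.
  rewrite -/(phi i H) phiH mulf_neq0 ?expf_neq0//.
  by rewrite /X; case: ifP => [/andP[_ /eqP ie]|_]; [rewrite ie|exact: A0].
have DL h : io (D h)%:~R = \prod_i phi i h.
  by rewrite rmorph_int (root_places_norm gen sf rp).
have DA0 : (D A)%:~R != 0 :> 'F_l.
  by rewrite -(fmorph_eq0 (io)) DL; apply/prodf_neq0.
have DH : (D H)%:~R * a = M%:R ^+ 2 ^+ n.+1 * (D A)%:~R * (if e then b else a) :> 'F_l.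
  apply: (fmorph_inj (io)); rewrite !rmorphM !DL aL.
  rewrite (eq_bigr _ (fun i _ => phiH i)) big_split/= prodr_const card_ord.
  rewrite !rmorphXn rmorph_nat -!mulrA; congr (_ * _).
  rewrite (bigD1 i0)//= [in RHS](bigD1 i0)//= {1}/X eqxx andbT.
  under eq_bigr => i /negPf iN do rewrite /X iN andbF.
  case: (e); last by rewrite aL.
  by rewrite -WzE toL; ring.
have M0' : M%:R != 0 :> 'F_l by have := Fp_int_eq0 lp M; rewrite /= => ->.
split=> [[w wE]|/negPf e0].
  apply/negP => e1; rewrite e1 in DH.
  have := st (w / (M%:R ^+ n.+1 * (D A)%:~R)); rewrite rmorphM/= in wE.
  rewrite exprAC in DH; move/eqP; apply.
  by apply: square_ratio DA0 a0 erefl DH wE; exact: expf_neq0.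
exists (M%:R ^+ n.+1 * (D A)%:~R); rewrite rmorphM/=; rewrite e0 in DH.
by rewrite (mulIf a0 DH) exprAC; ring.
Qed.

End SpecialPrime.

Section DarmonApproximation.
Context {R : realType} {K : fieldExtType rat}.
Context (Kv : forall v : place R K, completion v) (S : set (place R K)).
Hypothesis S_nonarch : forall v, ~ S v -> ultra v.
Context {n : nat} (F : {mpoly K[n.+1]}) (m : nat).
Hypothesis Fhom : F \is 2.-homog.
Hypothesis F0 : F != 0.
Implicit Types v : place R K.
Local Notation Q := (qform F idfun).
Local Notation emb v x := (map_mx (cemb (Kv v)) x).
Local Notation Qv v := (qform F (cemb (Kv v))).

(* The factor [l ^+ 2] accounts for the rescaling of the coordinates. *)
Definition near_value v (b : K) : set (local_proj Kv v) :=
  [set P | exists l, cval Kv v (l ^+ 2 * Qv v (val (repr P)) - cemb (Kv v) b) < v b].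

Arguments near_value : clear implicits.

Lemma near_value_pi v b (x : nonzero_vec n (cfield (Kv v))) :
  near_value v b (\pi_(proj_space n (cfield (Kv v)))%qT x) <->
  exists l, cval Kv v (l ^+ 2 * Qv v (val x) - cemb (Kv v) b) < v b.
Proof.
rewrite /near_value/=; have [a a0 ->] := repr_pi_proj x; rewrite qformZ.
split=> -[l hl]; first by exists (l * a); rewrite exprMn -mulrA.
by exists (l / a); rewrite expr_div_n mulrA divfK// expf_neq0.
Qed.

Lemma open_near_value v b : ultra v -> open (near_value v b).
Proof.
move=> uv; have ucv := cval_ultra uv (Kv := Kv); apply: open_local_proj => x /near_value_pi[l hl].
set r := v b in hl *; have r0 : 0 < r := le_lt_trans (absval_ge0 _ _) hl.
pose c := v (content v F); have c0 : 0 < c by rewrite absval_gt0 content_neq0.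
pose N := Num.max 1 (vnorm (cval Kv v) (val x)).
have N0 : 0 < N by rewrite lt_max ltr01.
have l1 : 0 < cval Kv v l ^+ 2 + 1 by rewrite ltr_wpDl// exprn_ge0// absval_ge0.
have cN0 : 0 < (cval Kv v l ^+ 2 + 1) * (c * N) by rewrite mulr_gt0// mulr_gt0.
pose e := Num.min 1 (r / ((cval Kv v l ^+ 2 + 1) * (c * N))).
have e0 : 0 < e by rewrite lt_min ltr01 divr_gt0.
exists e => // y xy; apply/near_value_pi; exists l.
pose d := val y - val x.
have de : vnorm (cval Kv v) d < e.
  by have [i ->] := vnorm_ex (cval Kv v) d; rewrite !mxE.
have -> : val y = val x + d by rewrite addrC subrK.
rewrite qformD -addrA mulrDr addrAC; apply: (ultraD_lt ucv) => //.
rewrite absvalM absvalX.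
have dr : cval Kv v (qpolar F (cemb (Kv v)) (val x) d + Qv v d) <= c * (N * vnorm (cval Kv v) d).
  apply: (ultraD_le ucv).
    apply: le_trans (qpolar_bound F (cval_emb Kv v) ucv _ _) _.
    apply: ler_wpM2l; first exact: ltW.
    by apply: ler_wpM2r; rewrite ?vnorm_ge0// le_max lexx orbT.
  apply: le_trans (qform_bound F (cval_emb Kv v) ucv _) _.
  apply: ler_wpM2l; first exact: ltW.
  rewrite expr2; apply: ler_wpM2r; rewrite ?vnorm_ge0// (le_trans (ltW de))//.
  by rewrite (@le_trans _ _ 1)// ?le_max ?lexx// /e ge_min lexx.
apply: (@le_lt_trans _ _ ((cval Kv v l ^+ 2 + 1) * (c * N) * vnorm (cval Kv v) d)).
  rewrite -[leRHS]mulrA -(mulrA c); apply: ler_pM.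
  - by rewrite exprn_ge0 ?absval_ge0.
  - exact: absval_ge0.
  - by rewrite lerDl.
  - exact: dr.
rewrite mulrC -ltr_pdivlMr// (lt_le_trans de)// /e ge_min lexx orbT//.
Qed.

Lemma near_value_global v b (x : 'rV[K]_n.+1) : ultra v -> b != 0 ->
  (exists l, cval Kv v (l ^+ 2 * Qv v (emb v x) - cemb (Kv v) b) < v b) ->
  exists2 l : K, l != 0 & v (l ^+ 2 * Q x - b) < v b.
Proof.
move=> uv b0 [l hl]; have ucv := cval_ultra uv (Kv := Kv).
have vb0 : 0 < v b by rewrite absval_gt0.
rewrite qform_map in hl.
have lQ : l != 0 /\ Q x != 0.
  split; apply: contraTneq hl => ->; rewrite ?rmorph0 ?mulr0 ?expr0n/= ?mul0r sub0r absvalN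
    cval_emb ltxx//.
have [l0 Qx] := lQ; have cl0 : 0 < cval Kv v l by rewrite absval_gt0.
have q0 : 0 < v (Q x) by rewrite absval_gt0.
pose e := Num.min (cval Kv v l) (v b / (cval Kv v l * v (Q x))).
have e0 : 0 < e by rewrite lt_min cl0 divr_gt0// mulr_gt0.
have [k kl] := cval_dense l e0; rewrite absvalBC in kl.
have kl' : cval Kv v (cemb (Kv v) k - l) < cval Kv v l.
  by rewrite (lt_le_trans kl)// /e ge_min lexx.
have kE := ultra_close ucv kl'; rewrite cval_emb in kE.
exists k; first by rewrite -(absval_gt0 v) kE.
rewrite -(cval_emb Kv) rmorphB rmorphM rmorphXn/=; set k' := cemb (Kv v) k in kl kl' *.
rewrite [X in cval _ _ X](_ : _ = (l ^+ 2 * cemb (Kv v) (Q x) - cemb (Kv v) b)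
  + (k' - l) * (k' + l) * cemb (Kv v) (Q x)); last by ring.
apply: (ultraD_lt ucv) => //; rewrite !absvalM cval_emb.
have : cval Kv v (k' + l) <= cval Kv v l.
  by apply: (ultraD_le ucv) => //; rewrite cval_emb kE.
move=> h; apply: (@le_lt_trans _ _ (cval Kv v (k' - l) * (cval Kv v l * v (Q x)))).
  by rewrite -mulrA ler_wpM2l ?absval_ge0// ler_wpM2r// ltW.
by rewrite -ltr_pdivlMr ?mulr_gt0// (lt_le_trans kl)// /e ge_min lexx orbT.
Qed.

Lemma compl_integral_pointsP v (x : 'rV[K]_n.+1) (x0 : x != 0) : ~ S v ->
  v (Q x) = v (content v F) * vnorm v x ^+ 2 ->
  compl_integral_points Kv S F v
    (\pi_(proj_space n (cfield (Kv v)))%qT (nonzero_map (cemb (Kv v)) (nzvec x0))).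
Proof.
move=> Sv Qx; have [y Py [a a0 [yE y1]]] := integral_coordinates_ex
  (nonzero_map (cemb (Kv v)) (nzvec x0)).
exists y => //; have yn := integral_coordinates_norm Py.
rewrite (pullback_idealE S_nonarch Fhom F0 Sv) ?yn//.
have Qy : cval Kv v (Qv v (val y)) = v (content v F).
  rewrite yE/= qformZ qform_map absvalM absvalX cval_emb Qx mulrCA.
  by move: y1; rewrite /= (vnorm_map _ (cval_emb Kv v)) -exprMn => ->; rewrite expr1n mulr1.
apply/seteqP; split=> z /=; rewrite Qy.
  by rewrite ger_pMl ?absval_gt0 ?content_neq0// => /valuation_ringP.
by move=> /valuation_ringP z1; rewrite ger_pMl ?absval_gt0 ?content_neq0.
Qed.

(** The multiplicity is finite as [Q x] is nonzero, and even as a multiple of [m]. The witness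
    collects half of it and a coordinate of largest value, which accounts for the scaling of [x]. *)
Lemma darmon_square v (x : 'rV[K]_n.+1) (x0 : x != 0) : ~~ odd m -> ~ S v -> Q x != 0 ->
  local_orbifold_points Kv S F m Darmon v
    (\pi_(proj_space n (cfield (Kv v)))%qT (nonzero_map (cemb (Kv v)) (nzvec x0))) ->
  exists b, v (Q x) = v (content v F) * v b ^+ 2.
Proof.
move=> mev Sv Qx []// [[k|] hk /= adm]; last first.
  by move: hk => /(div_points_pi Fhom)/=/eqP; rewrite qform_map fmorph_eq0 (negPf Qx).
have [p [p0 p1 e]] := intersection_mult_elim S_nonarch Fhom F0 Sv hk.
have uv := S_nonarch Sv.
have [b b0 bE] := cval_group uv p0.
have [i xi] := vnorm_ex v x.
exists (x 0 i * b ^+ k./2).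
move: e; rewrite /= qform_map cval_emb (vnorm_map _ (cval_emb Kv v)) bE => ->.
have kev : ~~ odd k by apply: contra mev => ok; move: adm => /dvdnP[q kE]; move: ok;
  rewrite kE oddM => /andP[].
by rewrite xi absvalM absvalX -mulrA exprMn -exprM muln2 even_halfK.
Qed.

Lemma near_prod_finite (T : set (place R K)) (Z : set (place R K))
    (P : local_product Kv T) (O : forall v, set (@local_proj R K Kv n v)) : finite_set Z ->
  (forall i : ~` T, Z (val i) -> open (O (val i)) /\ O (val i) (P i)) ->
  nbhs P [set P' : local_product Kv T | forall i : ~` T, Z (val i) -> O (val i) (P' i)].
Proof.
move=> /finite_seqP[s ->]; elim: s => [|v s IH] h; first by apply: filterS filterT => P' _ i.
have hs : nbhs P [set P' : local_product Kv T |
    forall i : ~` T, val i \in s -> O (val i) (P' i)].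
  by apply: IH => i si; apply: h; rewrite /= inE si orbT.
have hv : nbhs P [set P' : local_product Kv T |
    forall i : ~` T, val i = v -> O (val i) (P' i)].
  have [[i iv]|N] := pselect (exists i : ~` T, val i = v); last first.
    by apply: filterS filterT => P' _ i iv; exfalso; apply: N; exists i.
  have [|oO OP] := h i; first by rewrite /= inE iv eqxx.
  have : nbhs P [set P' : local_product Kv T | O (val i) (P' i)] :=
    @proj_continuous _ (fun v : ~` T => local_proj Kv (val v)) i P _ (open_nbhs_nbhs (conj oO
      OP)).
  apply: filterS => P' hP' j jv.
  by have -> : j = i by apply: val_inj; rewrite jv.
apply: filterS2 hs hv => P' h1 h2 i /=; rewrite inE => /orP[/eqP|]; [exact: h2|exact: h1].
Qed.

(** The test point has the prescribed components on [Z], multiplicity 0 at every place outside [S],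
    and any component off the quadric on [S]; so it lies in the strict part. *)
Lemma darmon_approximation (T Z : set (place R K)) (y : place R K -> 'rV[K]_n.+1) :
  ~~ odd m -> weak_approximation_off Kv S F m Darmon T -> finite_set Z -> Z !=set0 ->
  (forall v, Z v -> [/\ ~ S v, ~ T v, Q (y v) != 0 &
     v (Q (y v)) = v (content v F) * vnorm v (y v) ^+ 2]) ->
  exists x : 'rV[K]_n.+1, [/\ Q x != 0,
    forall v, Z v -> v (Q x - Q (y v)) < v (Q (y v)) &
    forall v, ~ S v -> ~ T v -> exists b, v (Q x) = v (content v F) * v b ^+ 2].
Proof.
move=> mev wa finZ [v0 Zv0] hy; have [Sv0 _ _ _] := hy v0 Zv0.
have [u0 Qu0] := exists_qform_neq0 Fhom F0 (ex_intro _ v0 (S_nonarch Sv0)).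
have /choice[w hw] v : exists w : 'rV[K]_n.+1, [/\ Q w != 0,
    ~ S v -> v (Q w) = v (content v F) * vnorm v w ^+ 2 & Z v -> w = y v].
  have [Zv|Zv] := pselect (Z v); first by have [_ _ h1 h2] := hy v Zv; exists (y v).
  have [Sv|Sv] := pselect (S v); first by exists u0.
  have [u [u1 Qu]] := exists_unit_vector Fhom (S_nonarch Sv) F0; exists u; split=> //.
    by rewrite -(absval_eq0b v) Qu absval_eq0b content_neq0.
  by rewrite u1 expr1n mulr1.
have w0 v : w v != 0 by have [h _ _] := hw v; exact: qform_neq0 h.
pose P : local_product Kv T := fun i : ~` T =>
  \pi_(proj_space n (cfield (Kv (val i))))%qT
    (nonzero_map (cemb (Kv (val i))) (nzvec (w0 (val i)))).
have Pcompl i : compl_points Kv F (val i) (P i).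
  move=> /(div_points_pi Fhom)/=/eqP; rewrite qform_map fmorph_eq0.
  by have [/negPf -> _ _] := hw (val i).
have Pstrict : adelic_orbifold_points Kv S F m Darmon T P.
  left; split=> [i _|i Si|]; first exact: Pcompl.
    split; last exact: Pcompl.
    right; exists (Some 0); last by rewrite /= dvdn0.
    have [a ua] := exists_uniformizer (S_nonarch Si).
    apply: (intersection_mult_intro S_nonarch Fhom F0 Si ua).
    rewrite /= qform_map cval_emb (vnorm_map _ (cval_emb Kv (val i))) expr0 mulr1.
    by have [_ h _] := hw (val i); exact: h.
  apply: (@sub_finite_set _ _ set0) => // i [Si]; apply.
  by apply: compl_integral_pointsP => //; have [_ h _] := hw (val i); exact: h.
have [|Pg [[p hp <-] hO]] := wa P Pstrict _ (near_prod_finite (O := fun v => near_value v (Q (y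
  v))) finZ _).
  move=> i Zi; have [Si _ Qy _] := hy _ Zi; split.
    exact: open_near_value (S_nonarch Si).
  apply/near_value_pi; exists 1; rewrite expr1n mul1r /= qform_map.
  have [_ _ ->//] := hw (val i); rewrite subrr absval0 absval_gt0//.
have pE := reprK p; set x := val (repr p); have x0 : x != 0 by exact: nonzero_vecP.
have prx : repr p = nzvec x0 by exact: val_inj.
rewrite prx in pE.
have near_x v : Z v -> exists2 l : K, l != 0 & v (l ^+ 2 * Q x - Q (y v)) < v (Q (y v)).
  move=> Zv; have [Sv Tv Qy _] := hy v Zv.
  pose i : ~` T := exist _ v (mem_set Tv).
  apply: (near_value_global (S_nonarch Sv) Qy).
  have := hO i Zv; rewrite /diagonal_emb -pE proj_map_pi => /near_value_pi/=.
  exact.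
have Qx : Q x != 0.
  have [Sv Tv Qy _] := hy v0 Zv0; have [l l0] := near_x v0 Zv0.
  by apply: contraTneq => ->; rewrite mulr0 sub0r absvalN ltxx.
(* A projective approximation controls [Q x] only up to the local squares [l v ^+ 2]; a single [k]
   close to all the [l v] absorbs them. *)
have /choice[l hl] v : exists l : K, Z v -> l != 0 /\ v (l ^+ 2 * Q x - Q (y v)) < v (Q (y v)).
  have [Zv|Zv] := pselect (Z v); last by exists 0.
  by have [l l0 hl] := near_x v Zv; exists l.
pose e v := Num.min (v (l v)) (v (Q (y v)) / (v (l v) * v (Q x))).
have e0 v : Z v -> 0 < e v.
  move=> Zv; have [_ _ Qy _] := hy v Zv; have [l0 _] := hl v Zv.
  by rewrite lt_min absval_gt0 l0 divr_gt0 ?mulr_gt0 ?absval_gt0.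
have [k' hk] := @weak_approximation R K Z 'I_1 (fun v _ => l v) e finZ e0.
pose k := k' 0; have {}hk v : Z v -> v (k - l v) < e v by move=> Zv; exact: hk.
have vk v : Z v -> v k = v (l v).
  move=> Zv; have [Sv _ _ _] := hy v Zv; apply: (ultra_close (S_nonarch Sv)).
  by rewrite (lt_le_trans (hk v Zv))// /e ge_min lexx.
have k0 : k != 0 by rewrite -(absval_gt0 v0) vk// absval_gt0; have [] := hl v0 Zv0.
exists (k *: x); rewrite qformZ; split.
- by rewrite mulf_neq0 ?expf_neq0.
- move=> v Zv; have [Sv Tv Qy _] := hy v Zv; have uv := S_nonarch Sv; have [l0 hl'] := hl v Zv.
  rewrite [X in v X < _](_ : _ = (l v ^+ 2 * Q x - Q (y v)) + (k - l v) * (k + l v) * Q x);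
    last by ring.
  apply: (ultraD_lt uv) => //; rewrite !absvalM.
  have h : v (k + l v) <= v (l v) by apply: (ultraD_le uv); rewrite ?vk.
  apply: (@le_lt_trans _ _ (v (k - l v) * (v (l v) * v (Q x)))).
    by rewrite -mulrA ler_wpM2l ?absval_ge0// ler_wpM2r ?absval_ge0.
  rewrite -ltr_pdivlMr ?mulr_gt0 ?absval_gt0//.
  by rewrite (lt_le_trans (hk v Zv))// /e ge_min lexx orbT.
move=> v Sv Tv; have := hp v; rewrite -pE proj_map_pi => /(_ _).
move=> /(_ (fun h => match h with or_introl a => Sv a | or_intror a => Tv a end)).
move=> /(darmon_square mev Sv Qx)[b bE]; exists (k * b).
by rewrite absvalM absvalX bE absvalM exprMn; ring.
Qed.

End DarmonApproximation.

Lemma exists_special_primes (f : {poly int}) (N : nat) : (1 < size f)%N ->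
  exists (l : nat -> nat) (z : nat -> int), injective l /\
    forall j, [/\ prime (l j), (N < l j)%N & ((l j)%:Z %| f.[z j])%Z].
Proof.
move=> f1; have /choice[g gP] M := exists_prime_divisor_value M f1.
have /choice[h hP] := gP.
pose l j := iter j.+1 g N.
have lS j : (l j < l j.+1)%N by have [] := hP (l j).
have lmono : {homo l : i j / (i < j)%N} := homo_ltn ltn_trans lS.
exists l, (fun j => h (iter j g N)); split.
  by move=> i j lij; case: (ltngtP i j) => // /lmono; rewrite lij ltnn.
move=> j; have [pl lt dv] := hP (iter j g N); split=> //.
by elim: j {pl lt dv} => [|j IH]; [have [] := hP N|exact: ltn_trans IH (lS j)].
Qed.

(** * Failure of Darmon weak weak approximation *)

Section DarmonFailure.
Context {R : realType} {K : fieldExtType rat}.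

Lemma exists_prime_bound (Z : set (place R K)) : finite_set Z -> exists N : nat,
  forall p (v : place R K), prime p -> (N < p)%N -> ultra v -> v p%:R < 1 -> ~ Z v.
Proof.
move=> /finite_seqP[s ->]; elim: s => [|w s [N hN]]; first by exists 0%N.
set w' : place R K := w.
have [M hM] : exists M : nat, forall p, prime p -> (M < p)%N -> ultra w' -> ~ w' p%:R < 1.
  have [[q [qp [uw wq]]]|no] := pselect (exists q, prime q /\ (ultra w' /\ w' q%:R < 1)).
    exists q => p pp qp' _ wp; have := ultra_prime_coprime uw pp qp wp wq.
    by move=> e; rewrite e ltnn in qp'.
  by exists 0%N => p pp _ uw wp; apply: no; exists p.
exists (maxn M N) => p v pp; rewrite gtn_max => /andP[Mp Np] uv vp /=.
rewrite inE => /orP[/eqP vw|]; last exact: hN p v pp Np uv vp.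
by rewrite vw in uv vp; exact: hM p pp Mp uv vp.
Qed.

Context (Kv : forall v : place R K, completion v) (S : set (place R K)).
Hypothesis S_nonarch : forall v, ~ S v -> ultra v.
Hypothesis S_finite : finite_set S.
Context {n : nat} (F : {mpoly K[n.+1]}) (m : nat).
Hypothesis Fhom : F \is 2.-homog.
Hypothesis F0 : F != 0.
Hypothesis n_gt0 : (0 < n)%N.
Hypothesis Fsmooth : smooth_hypersurface F.
Local Notation Q := (qform F idfun).
Local Notation B := (qpolar F idfun).

(** Gram-Schmidt without denominators; the form takes the value [- Q x] times the discriminant at
    the new vector. On the plane the form becomes diagonal, the shape that [special_prime] works
    with. *)
Lemma exists_orthogonal_pair : (exists v : place R K, ultra v) ->
  exists x y : 'rV[K]_n.+1, [/\ Q x != 0, Q y != 0 & B x y = 0].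
Proof.
move=> exu; have [x Qx] := exists_qform_neq0 Fhom F0 exu.
have [y disc] := exists_disc_neq0 Fhom n_gt0 Fsmooth Qx.
exists x, ((2 * Q x) *: y + (- B x y) *: x); split=> //.
  rewrite qform_comb [B y x]qpolarC.
  rewrite [X in X != 0](_ : _ = - Q x * (B x y ^+ 2 - 4 * (Q x * Q y))); last by ring.
  by rewrite mulf_neq0// oppr_eq0.
by rewrite qpolarDr !qpolarZr qpolarxx; ring.
Qed.

Lemma integral_multiple (al : K) (f : {poly int}) (x : 'rV[K]_n.+1) :
  integral_generator al f -> Q x != 0 ->
  exists (M : nat) A, (0 < M)%N /\ Q (M%:R *: x) = ieval al A.
Proof.
move=> [_ _ _ _ frac] Qx; have [M M0 [h hE]] := frac (Q x).
exists M, ((M%:Z)%:P * h); split=> //.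
by rewrite qformZ ievalM ievalC -hE expr2 mulrA.
Qed.

Lemma darmon_failure : ~~ odd m -> ~ orbifold_weak_weak_approximation Kv S F m Darmon.
Proof.
move=> mev [T [finT wa]].
have [al [f gen]] := exists_integral_generator (K := K).
have [_ f1 _ _ _] := gen.
have sf : size f = (size f).-2.+2 by case: (size f) f1 => [|[|k]].
set d := (size f).-2 in sf; pose D := poly_norm d f.
have exu := exists_ultra_place (R := R) gen sf.
have [x0 [y0 [Qx0 Qy0 xy0]]] := exists_orthogonal_pair exu.
have [Mx [A [Mx0 xA]]] := integral_multiple gen Qx0.
have [My [C [My0 yC]]] := integral_multiple gen Qy0.
set x := Mx%:R *: x0 in xA; set y := My%:R *: y0 in yC.
have xy : B x y = 0 by rewrite /x /y qpolarZr qpolarC qpolarZr qpolarC xy0 !mulr0.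
have A0 : ieval al A != 0.
  by rewrite -xA qformZ mulf_neq0// expf_neq0// natr_eq0_ext -lt0n.
have C0 : ieval al C != 0.
  by rewrite -yC qformZ mulf_neq0// expf_neq0// natr_eq0_ext -lt0n.
clearbody x y.
pose bad := S `|` T `|` [set v : place R K | ultra v /\ v (content v F) != 1] `|`
  [set v : place R K | ultra v /\ ~~ (vnorm v x <= 1)] `|`
  [set v : place R K | ultra v /\ ~~ (vnorm v y <= 1)] `|`
  [set v : place R K | ultra v /\ v (ieval al A) != 1] `|`
  [set v : place R K | ultra v /\ v (ieval al C) != 1].
have finbad : finite_set bad.
  rewrite !finite_setU; do ![split] => //.
  - exact: finite_content_neq1.
  - exact: finite_vnorm_gt1.
  - exact: finite_vnorm_gt1.
  - exact: finite_places_nonunit.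
  - exact: finite_places_nonunit.
have [N1 hN1] := exists_prime_bound finbad.
have [Del Del0 hDel] := exists_root_places (R := R) gen sf.
(* Primes beyond [N] are odd, lie under no bad place and do not divide [Del]. *)
pose N := maxn 2 (maxn N1 Del).
have good (v : place R K) p : prime p -> (N < p)%N -> ultra v -> v p%:R < 1 ->
    [/\ ~ S v, ~ T v, v (content v F) = 1, vnorm v x <= 1 & vnorm v y <= 1] /\
    v (ieval al A) = 1 /\ v (ieval al C) = 1.
  move=> pp; rewrite !gtn_max => /andP[_ /andP[N1p _]] uv vp.
  have := hN1 p v pp N1p uv vp.
  have U (P : bool) : ~ (ultra v /\ ~~ P) -> P by move=> hP; apply: contrapT => /negP nP;
    apply: hP.
  rewrite /bad /setU/= => /not_orP[/not_orP[/not_orP[/not_orP[/not_orP[/not_orP[hS hT] h1] h2]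
    h3] h4] h5].
  split; [split=> //|split].
  - exact/eqP/U.
  - exact: U.
  - exact: U.
  - exact/eqP/U.
  - exact/eqP/U.
have systems p : prime p -> (N < p)%N -> exists Z : set (place R K), place_system al d f p Z.
  move=> pp; rewrite !gtn_max => /andP[_ /andP[_ Dp]].
  have [|L [rho [v rp]]] := hDel p pp.
    by apply: contraL Dp => /(dvdn_leq Del0); rewrite -leqNgt.
  by exists (range v), L, rho, v.
have [l [z [linj lP]]] := exists_special_primes N f1.
(* The sign and the parities at the indices 0 to [N] give [2 ^ N.+2] possible values of [data]
   below, so [N.+3] independent choices suffice for a collision. *)
pose r := N.+3.
have /choice[spec specP] : forall j : 'I_r, exists q : (set (place R K) * place R K) * (int *
  int),
  [/\ place_system al d f (l j) q.1.1, q.1.1 q.1.2,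
    q.1.2 (Q (q.2.1%:~R *: x + q.2.2%:~R *: y)) = 1 &
    forall (e : bool) (M : nat) H, ~~ (l j %| M)%N ->
      (forall v, q.1.1 v -> v (ieval al H - M%:R ^+ 2 *
        Q (if e && (v == q.1.2) then q.2.1%:~R *: x + q.2.2%:~R *: y else x)) < 1) ->
      ~~ (l j %| `|D H|)%N /\ (Fp_square (l j) (D H * D A) <-> ~~ e)].
  move=> j; have [lp Nl lz] := lP j; have [Z sys] := systems _ lp Nl.
  have lodd : odd (l j).
    by case: (even_prime lp) => // l2; move: Nl; rewrite l2 !gtn_max.
  have [v vA|v vC|v1 [s [t [Zv1 v1W HW]]]] := special_prime gen sf lp lodd sys lz (A := A) (C :=
    C).
  - by have [uv vl] := place_system_ultra sys vA; have [_ []] := good v _ lp Nl uv vl.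
  - by have [uv vl] := place_system_ultra sys vC; have [_ []] := good v _ lp Nl uv vl.
  have QW : Q (s%:~R *: x + t%:~R *: y) =
      s%:~R ^+ 2 * ieval al A + t%:~R ^+ 2 * ieval al C.
    by rewrite qform_comb xy xA yC mulr0 addr0.
  exists ((Z, v1), (s, t)); split=> //=; first by rewrite QW.
  move=> e M H lM hH; apply: HW lM _ => v Zv; have := hH v Zv.
  by case: ifP => _; rewrite ?QW ?xA.
pose Z := \bigcup_(j in [set: 'I_r]) (spec j).1.1.
have finZ : finite_set Z.
  apply: bigcup_finite => [|j _]; first exact: finite_finset.
  by have [sys _ _ _] := specP j; exact: place_system_finite sys.
(* A place lies over a single prime and [l] is injective, so the targets at different primes do not
   conflict. *)
have Zuniq (v : place R K) (i j : 'I_r) : (spec i).1.1 v -> (spec j).1.1 v -> i = j.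
  move=> vi vj; have [si _ _ _] := specP i; have [sj _ _ _] := specP j.
  have [uv v1] := place_system_ultra si vi; have [_ v2] := place_system_ultra sj vj.
  have [p1 _ _] := lP i; have [p2 _ _] := lP j.
  by apply/val_inj/linj; exact: ultra_prime_coprime uv p1 p2 v1 v2.
pose tgt (e : {ffun 'I_r -> bool}) (j : 'I_r) (v : place R K) := if e j && (v == (spec j).1.2)
  then (spec j).2.1%:~R *: x + (spec j).2.2%:~R *: y else x.
have tgtP e j (v : place R K) : (spec j).1.1 v -> [/\ ~ S v, ~ T v, v (content v F) = 1,
    v (Q (tgt e j v)) = 1 & vnorm v (tgt e j v) = 1].
  move=> vj; have [sys _ W1 _] := specP j; have [pl Nl _] := lP j.
  have [uv v1] := place_system_ultra sys vj.
  have [[Sv Tv vc xv yv] [vA vC]] := good v _ pl Nl uv v1.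
  have Qt : v (Q (tgt e j v)) = 1.
    by rewrite /tgt; case: ifP => [/andP[_ /eqP->]//|_]; rewrite xA.
  split=> //; apply/le_anti/andP; split.
    rewrite /tgt; case: ifP => _ //; apply: vnorm_le => // i; rewrite 3!mxE.
    have le1 (k : int) (u : 'rV[K]_n.+1) : vnorm v u <= 1 -> v (k%:~R * u 0 i) <= 1.
      by move=> u1; rewrite absvalM mulr_ile1 ?absval_ge0 ?ultra_int// (le_trans (le_vnorm _ _
        _)).
    by apply: (ultraD_le uv); apply: le1.
  have := qform_bound F (w := v) (f := idfun) (fun _ => erefl) uv (tgt e j v).
  by rewrite Qt vc mul1r => h; rewrite -(@ler_pXn2r _ 2) ?nnegrE ?vnorm_ge0// expr1n.
have build (e : {ffun 'I_r -> bool}) : exists H : {poly int}, [/\ ieval al H != 0,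
    forall p, prime p -> (N < p)%N -> ~~ odd (logn p `|D H|) &
    forall j : 'I_r, ~~ (l j %| `|D H|)%N /\ (Fp_square (l j) (D H * D A) <-> ~~ e j)].
  have /choice[w hw] (v : place R K) : exists w : 'rV[K]_n.+1, forall j, (spec j).1.1 v -> w =
    tgt e j v.
    have [[j _ vj]|no] := pselect (Z v); last by exists 0 => j vj; case: no; exists j.
    by exists (tgt e j v) => i vi; rewrite (Zuniq _ _ _ vi vj).
  have Zne : Z !=set0 by have [_ v0Z _ _] := specP ord0; exists (spec ord0).1.2; exists ord0.
  have [v [j _ vj]|X [QX Xw Xsq]] := darmon_approximation S_nonarch Fhom F0 mev wa finZ Zne (y
    := w).
    rewrite (hw v j vj); have [Sv Tv vc Qt nt] := tgtP e j v vj; split=> //.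
      by rewrite -(absval_eq0b v) Qt oner_eq0.
    by rewrite Qt vc nt expr1n mulr1.
  have Xt j (v : place R K) : (spec j).1.1 v -> v (Q X - Q (tgt e j v)) < 1.
    move=> vj; have := Xw v (ex_intro2 _ _ j I vj); rewrite (hw v j vj).
    by have [_ _ _ -> _] := tgtP e j v vj.
  have X1 j (v : place R K) : (spec j).1.1 v -> v (Q X) = 1.
    move=> vj; have [Sv _ _ Qt _] := tgtP e j v vj; rewrite -Qt.
    by apply: (ultra_close (S_nonarch Sv)); rewrite Qt; exact: Xt.
  have [M [h [M0 hE hM]]] := exists_coprime_denominator (R := R) gen sf (Q X).
  (* One more factor [M] turns the denominator into a square, so that the parities of the valuations
     of [Q X] survive. *)
  have HE : ieval al ((M%:Z)%:P * h) = M%:R ^+ 2 * Q X.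
    by rewrite ievalM ievalC -hE expr2 mulrA.
  have H0 : ieval al ((M%:Z)%:P * h) != 0.
    by rewrite HE mulf_neq0// expf_neq0// natr_eq0_ext -lt0n.
  exists ((M%:Z)%:P * h); split=> // [p pp Np|j].
    have [Zp [L [rho [v [rp _]]]]] := systems p pp Np.
    apply: (even_logn_norm gen sf pp rp H0) => i; rewrite HE.
    have [_ _ uv _ _] := rp; have [ui vi] := uv i.
    have [[Sv Tv vc _ _] _] := good (v i) p pp Np ui vi.
    have [b bE] := Xsq _ Sv Tv; exists (M%:R * b).
    by rewrite [LHS]absvalM absvalX bE vc mul1r [v i (M%:R * b)]absvalM exprMn.
  have [[L [rho [v [rp vZ]]]] _ _ HS] := specP j; have [lp _ _] := lP j.
  apply: (HS (e j) M).
    by apply: (hM _ L rho v lp rp) => i; rewrite (X1 j)// vZ; exists i.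
  move=> u uj; rewrite HE -mulrBr absvalM absvalX.
  have [Sv _ _ _ _] := tgtP e j u uj.
  apply: le_lt_trans (Xt j u uj); rewrite ler_piMl ?absval_ge0// exprn_ile1 ?absval_ge0//.
  exact: ultra_nat (S_nonarch Sv) _.
have /choice[H HP] := build.
pose data (e : {ffun 'I_r -> bool}) : bool * {ffun 'I_N.+1 -> bool} :=
  (0 < D (H e), [ffun p : 'I_N.+1 => odd (logn p `|D (H e)|)]).
have /injectivePn[e [e' ee' dE]] : ~~ injectiveb data.
  apply/negP => /injectiveP/leq_card; rewrite card_prod !card_ffun card_bool !card_ord.
  by rewrite -expnS leq_exp2l// ltnn.
have [j ej] : exists j, e j != e' j.
  by apply: contrapT => /forallNP h; case/eqP: ee'; apply/ffunP => j; apply/eqP/negPn/negP/h.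
have [H0 Hev Hl] := HP e; have [H0' Hev' Hl'] := HP e'.
have D0 : D (H e) != 0 := poly_norm_neq0 gen sf H0.
have D0' : D (H e') != 0 := poly_norm_neq0 gen sf H0'.
have sE : (0 < D (H e)) = (0 < D (H e')) by have : (data e).1 = (data e').1 by rewrite dE.
have /ffunP oE : (data e).2 = (data e').2 by rewrite dE.
have DD : 0 < D (H e) * D (H e').
  move: sE; case: (ltrgt0P (D (H e))) D0 => // h _ /esym; first exact: mulr_gt0.
  by move/negbT; rewrite -leNgt => h'; rewrite nmulr_rgt0// lt_neqAle D0'.
have [k kE] : exists k : nat, absz (D (H e) * D (H e')) = (k ^ 2)%N.
  apply: nat_square_of_even_logn; first by rewrite absz_gt0 gt_eqF.
  move=> p pp; rewrite abszM lognM ?absz_gt0// oddD.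
  have [Np|pN] := ltnP N p; first by rewrite (negPf (Hev p pp Np)) (negPf (Hev' p pp Np)).
  have pN' : (p < N.+1)%N by [].
  by have := oE (Ordinal pN'); rewrite !ffunE/= => ->; rewrite addbb.
have kE' : D (H e) * D (H e') = (k%:Z) ^+ 2.
  by rewrite -[LHS]gtz0_abs// kE.
have [lp _ _] := lP j.
have [lD sq] := Hl j; have [lD' sq'] := Hl' j.
have transfer (a b c : int) : a * b = k%:Z ^+ 2 -> ~~ (l j %| `|a|)%N ->
    Fp_square (l j) (a * c) -> Fp_square (l j) (b * c).
  move=> abk la [w wE]; have a0 : a%:~R != 0 :> 'F_(l j) by rewrite Fp_int_eq0.
  exists (k%:R * w / a%:~R); rewrite rmorphM/=; apply: square_transfer => //.
    by rewrite -intrM abk rmorphXn.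
  by rewrite -wE rmorphM.
have kE'' : D (H e') * D (H e) = k%:Z ^+ 2 by rewrite mulrC.
case/negP: ej; apply/eqP; apply: negb_inj; apply/idP/idP => ne.
  by apply/sq'; apply: transfer kE' lD _; apply/sq.
by apply/sq; apply: transfer kE'' lD' _; apply/sq'.
Qed.

End DarmonFailure.

Theorem theorem1p3 (R : realType) (K : fieldExtType rat)
  (Kv : forall v : place R K, completion v)
  (S : set (place R K)) (S_finite : finite_set S)
  (S_archimedean : forall v : place R K, archimedean v -> S v)
  (n m : nat) (m_ge2 : (2 <= m)%N)
  (F : {mpoly K[n.+2]}) (F_smooth : smooth_quadric F) :
  (orbifold_weak_approximation Kv S F m Campana /\
   orbifold_points Kv S F m Campana S !=set0) /\
  (~~ odd m -> ~ orbifold_weak_weak_approximation Kv S F m Darmon).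
Proof.
have S_nonarch v : ~ S v -> ultra v.
  by move=> Sv; apply: contrapT => nu; apply/Sv/S_archimedean.
have [F0 Fhom Fsm] := F_smooth.
have [al [f gen]] := exists_integral_generator (K := K); have [_ f1 _ _ _] := gen.
have sf : size f = (size f).-2.+2 by case: (size f) f1 => [|[|k]].
have exu : exists v : place R K, ultra v := exists_ultra_place gen sf.
split; first split.
- exact: campana_weak_approximation.
- exact: campana_nonempty.
exact: darmon_failure.
Qed.
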